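(* Identify a $\mu$-involution with the permutation in $S_n$ whose one-line notation is the concatenation of its strings. For $\mu=(1,1,\dots,1)$ the $\mu$-involutions are the elements of $S_n$, and for $\mu=(n)$ they are the involutions in $S_n$; the restriction of the Bruhat order on $S_n$ to involutions agrees with the Bruhat order on involutions. This fails for general $\mu$: the Bruhat order on $\mu$-involutions ($\pi\le\rho$ iff $\mathscr{X}^\pi\subseteq\mathscr{X}^\rho$) differs from the restriction of the Bruhat order on $S_n$. Namely, the Bruhat order on $\mu$-involutions is always graded, whereas for $n=4$ and $\mu=(3,1)$ the order on $(3,1)$-involutions induced from the Bruhat order on $S_4$ is not graded, as shown by the interval from $[432|1]$ to $[321|4]$. In particular these two orders on $(3,1)$-involutions are not isomorphic.
   Context: A poset is graded if all its maximal chains have the same length. The Bruhat order on $S_n$ is taken here as the opposite of the Bruhat–Chevalley order (so that $n\cdots21$ is the minimum and $12\cdots n$ the maximum). Let $k$ be the base field, $G=SL_n(k)$, and $B\subset G$ the Borel subgroup of upper triangular matrices. The variety of complete quadrics $\mathcal{X}_n$ is the wonderful compactification (De Concini–Procesi) of the homogeneous space $SL_n/SO_n$, i.e. of the space of nonsingular quadric hypersurfaces in $\mathbb{P}^{n-1}$, with its natural $G$-action. A point of $\mathcal{X}_n$ can be thought of as a complete quadric: a partial flag $0=V_0\subset V_1\subset\dots\subset V_r=k^n$ together with a nondegenerate quadric on (the projectivization of) each successive quotient $V_j/V_{j-1}$. A composition of $n$ is a sequence $\mu=(\mu_1,\dots,\mu_r)$ of positive integers with sum $n$. A $\mu$-involution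 is a permutation of $[n]$ in one-line notation cut into consecutive strings $\pi=[\pi_1|\dots|\pi_r]$ with $\pi_j$ of length $\mu_j$, such that each $\pi_j$ is an involution when read as the one-line notation of a permutation of its own alphabet $\mathcal{A}_j$ (the set of its letters, in natural order). The distinguished complete quadric $Q_\pi$ is: $V_j$ is spanned by the standard basis vectors $e_a$ with $a\in\mathcal{A}_1\cup\dots\cup\mathcal{A}_j$, and the quadric on $V_j/V_{j-1}$ is $\sum x_{a}x_{b}+\sum x_{c}^2$, summed over the two-cycles $(a,b)$ and one-cycles $(c)$ of $\pi_j$. The $B$-orbits in $\mathcal{X}_n$ are parametrized by the $\mu$-involutions, $\mu$ ranging over compositions of $n$, the orbit indexed by $\pi$ being the one containing $Q_\pi$; $\mathscr{X}^\pi$ is its closure in $\mathcal{X}_n$. *)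

(* Defs.v *)
From HB Require Import structures.
From mathcomp Require Import all_boot all_order all_algebra all_fingroup.
From mathcomp Require Import mpoly.

Set Implicit Arguments.
Unset Strict Implicit.
Unset Printing Implicit Defensive.

Import GRing.Theory.
Local Open Scope ring_scope.

(* The variety of complete quadrics in P^(n-1) is realised, following
   De Concini and Procesi, as the Zariski closure in
     prod_(0 < i < n) P(bilinear forms on Lambda^i k^n)
   of the image of A |-> ([A], [Lambda^2 A], ..., [Lambda^(n-1) A]), where A
   runs over the nonsingular symmetric matrices (Gram matrices of nonsingular
   quadrics).  A bilinear form on Lambda^i k^n is given by its coefficients
   x(I,J) = x(e_I, e_J) on pairs of i-subsets of {0, ..., n-1}, where
   e_I = e_(a_1) /\ ... /\ e_(a_i) for I = {a_1 < ... < a_i}. *)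

Definition coord (n : nat) :=
  {IJ : {set 'I_n} * {set 'I_n} |
     (#|IJ.1| == #|IJ.2|) && (0 < #|IJ.1| < n)%N}.

Definition cdeg (n : nat) (c : coord n) : nat := #|(val c).1|.

(* Meaningful only when #|I| = #|J|: the default value of nth is never used. *)
Definition minor (k : fieldType) (n : nat) (A : 'M[k]_n) (I J : {set 'I_n}) : k :=
  \det (\matrix_(a < #|I|, b < #|I|)
          A (enum_val a) (nth (enum_val a) (enum J) b)).

Section CompleteQuadrics.

Variables (k : fieldType) (n : nat).

(* Multihomogeneous coordinates.  A point of the product of projective spaces
   is a vector that is nonzero in each degree, up to one scalar per degree;
   subsets of the product are handled through representatives, and their
   closures below are invariant under rescaling. *)
Definition mvec := {ffun coord n -> k}.

Definition is_point (x : mvec) : Prop :=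
  forall i : nat, (0 < i < n)%N -> exists c : coord n, cdeg c = i /\ x c != 0.

Definition multihomogeneous (f : {mpoly k[#|{: coord n}|]}) : Prop :=
  exists d : nat -> nat, forall m, m \in msupp f ->
    forall i : nat, (\sum_(v < #|{: coord n}| | cdeg (enum_val v) == i) m v)%N = d i.

Definition peval (f : {mpoly k[#|{: coord n}|]}) (x : mvec) : k :=
  f.@[fun v => x (enum_val v)].

Definition zariski_closure (S : mvec -> Prop) (x : mvec) : Prop :=
  is_point x /\
  forall f, multihomogeneous f -> (forall y, S y -> peval f y = 0) ->
    peval f x = 0.

Definition compounds (A : 'M[k]_n) : mvec :=
  [ffun c => minor A (val c).1 (val c).2].

Definition nonsingular_quadric (x : mvec) : Prop :=
  exists A : 'M[k]_n, [/\ A^T = A, \det A != 0 & x = compounds A].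

Definition complete_quadrics : mvec -> Prop :=
  zariski_closure nonsingular_quadric.

(* (g . x)(v, w) = x (g^-1 v, g^-1 w); in particular g maps compounds A to
   compounds ((g^-1)^T *m A *m g^-1). *)
Definition qact (g : 'M[k]_n) (x : mvec) : mvec :=
  [ffun c => \sum_(c' | cdeg c' == cdeg c)
     minor (invmx g) (val c').1 (val c).1 * x c'
       * minor (invmx g) (val c').2 (val c).2].

Definition borel (g : 'M[k]_n) : Prop :=
  \det g = 1 /\ forall i j : 'I_n, (j < i)%N -> g i j = 0.

Definition B_orbit (x y : mvec) : Prop :=
  exists2 b, borel b & y = qact b x.

(* The complete quadric with flag V_j = span {e_a | blk a <= j} and quadric on
   V_j / V_(j-1) given by the block of S on {a | blk a = j}; S must vanish
   outside of the blocks and have nonsingular blocks.  For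
   codim V_j <= i <= codim V_(j-1), the degree i component of its point is the
   form induced on the quotient
     Lambda^m (k^n / V_j) (x) Lambda^(i-m) (V_j / V_(j-1)),  m = codim V_j,
   of Lambda^i k^n by the quadrics on the successive quotients; e_I is nonzero
   in this quotient iff I consists of basis vectors from the last blocks.  With
   r the last block, this is also the limit as t -> 0 of the nonsingular
   quadrics with Gram matrices (t ^ (r - blk a) * S a b). *)
Definition last_blocks (blk : 'I_n -> nat) (I : {set 'I_n}) : bool :=
  [forall a in I, forall b in ~: I, (blk b <= blk a)%N].

Definition coordinate_quadric (blk : 'I_n -> nat) (S : 'M[k]_n) : mvec :=
  [ffun c => if last_blocks blk (val c).1 && last_blocks blk (val c).2
             then minor S (val c).1 (val c).2 else 0].

End CompleteQuadrics.

Section MuInvolutions.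

Variable n : nat.

Definition composition (mu : seq nat) : Prop :=
  all (fun m => 0 < m)%N mu /\ sumn mu = n.

Definition strings (mu : seq nat) (w : 'S_n) : seq (seq 'I_n) :=
  reshape mu (codom w).

Definition alphabet (s : seq 'I_n) : seq 'I_n :=
  [seq a <- enum 'I_n | a \in s].

(* The string s read as the one-line notation of a permutation of its alphabet,
   extended by the identity. *)
Definition read_string (s : seq 'I_n) (a : 'I_n) : 'I_n :=
  nth a s (index a (alphabet s)).

Definition is_mu_involution (mu : seq nat) (w : 'S_n) : bool :=
  all (fun s => [forall a, read_string s (read_string s a) == a])
      (strings mu w).

Definition mu_involution (mu : seq nat) := {w : 'S_n | is_mu_involution mu w}.

(* Strings printed with the letters 1, ..., n. *)
Definition letters (mu : seq nat) (w : 'S_n) : seq (seq nat) :=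
  [seq [seq (val a).+1 | a <- s] | s <- strings mu w].

Definition string_index (mu : seq nat) (w : 'S_n) (a : 'I_n) : nat :=
  find (fun s => a \in s) (strings mu w).

Definition partner (mu : seq nat) (w : 'S_n) (a : 'I_n) : 'I_n :=
  read_string (nth [::] (strings mu w) (string_index mu w a)) a.

(* Gram matrix of sum x_a x_b + sum x_c ^ 2, over the two-cycles (a, b) and the
   one-cycles (c) of all the strings. *)
Definition distinguished_gram (k : fieldType) (mu : seq nat) (w : 'S_n) :
    'M[k]_n :=
  \matrix_(a, b) (if partner mu w a == b then (if a == b then 1 else 2%:R^-1)
                  else 0).

Definition distinguished_quadric (k : fieldType) (mu : seq nat) (w : 'S_n) :
    mvec k n :=
  coordinate_quadric (string_index mu w) (distinguished_gram k mu w).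

Definition orbit_closure (k : fieldType) (mu : seq nat) (w : 'S_n)
    (x : mvec k n) : Prop :=
  complete_quadrics x /\
  zariski_closure (B_orbit (distinguished_quadric k mu w)) x.

Definition mu_bruhat (k : fieldType) (mu : seq nat) (pi rho : mu_involution mu) :
    Prop :=
  forall x : mvec k n,
    orbit_closure mu (val pi) x -> orbit_closure mu (val rho) x.

Definition inversions (w : 'S_n) : nat :=
  #|[set p : 'I_n * 'I_n | (p.1 < p.2)%N && (w p.2 < w p.1)%N]|.

Definition reflection_step (u v : 'S_n) : bool :=
  (inversions u < inversions v)%N &&
  [exists i : 'I_n, exists j : 'I_n, v == (u * tperm i j)%g].

Definition bruhat_chevalley : rel 'S_n := connect reflection_step.

(* Opposite of the Bruhat-Chevalley order: n ... 2 1 is the minimum. *)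
Definition bruhat (u v : 'S_n) : bool := bruhat_chevalley v u.

Definition induced_bruhat (mu : seq nat) (pi rho : mu_involution mu) : Prop :=
  bruhat (val pi) (val rho).

End MuInvolutions.

Section Posets.

Variables (T : finType) (le : T -> T -> Prop).

Definition partial_order : Prop :=
  [/\ forall x, le x x,
      forall x y, le x y -> le y x -> x = y
    & forall x y z, le x y -> le y z -> le x z].

Definition chain (C : {set T}) : Prop :=
  forall x y, x \in C -> y \in C -> le x y \/ le y x.

Definition maximal_chain (A C : {set T}) : Prop :=
  [/\ C \subset A, chain C &
      forall D : {set T}, D \subset A -> chain D -> C \subset D -> D = C].

(* The subposet A is graded. *)
Definition graded (A : {set T}) : Prop :=
  forall C D, maximal_chain A C -> maximal_chain A D -> #|C| = #|D|.

End Posets.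

Definition order_isomorphic (T U : Type) (le1 : T -> T -> Prop)
    (le2 : U -> U -> Prop) : Prop :=
  exists2 f : T -> U, bijective f & forall x y, le1 x y <-> le2 (f x) (f y).

Definition bruhat_interval (n : nat) (mu : seq nat) (pi rho : mu_involution n mu) :
    {set mu_involution n mu} :=
  [set x | bruhat (val pi) (val x) && bruhat (val x) (val rho)].

(* Main.v *)
(** A mu-involution is encoded by the map [b] sending a letter to the index of
its string and by the involution [p] exchanging the letters of its two-cycles.
The closure order is governed by the numbers
  [r j z w = #{a < z | j < b a} + #{a < w | j < b a} + #{a < z | b a = j, p a < w}]:
the orbit of [x] lies in the closure of the orbit of [y] iff [r x <= r y].

Necessity.  The coordinate [(I, J)], with
[I = {a | j < b a} U {a < z | b a = j, p a < w}] and [J = p(I)], is nonzero at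
the distinguished quadric of [x].  By upper triangularity it vanishes on the
orbit of [y] unless the quadric of [y] has a nonzero coordinate [(I', J')] with
[I' <= I], [J' <= J] in the Gale order, and counting then gives [r x <= r y].

Sufficiency.  Exchanging the adjacent letters [i, i+1] (by conjugation, or by
trading two fixed points for a two-cycle) only changes [r] at [z = i+1] or
[w = i+1], where an inequality [r x <= r y] follows from the neighbouring ones
when the exchange raises [x] or lowers [y].  Hence the lifting property, which makes [r x <= r y] the smallest preorder compatible with these
exchanges.  The closure order is compatible with them, because the closure of
the larger of the two orbits is stable under the minimal parabolic subgroup
of [i]: it suffices to move the distinguished quadric by a lower elementary
matrix, and the result is explicitly congruent to it by upper triangular ones.

The lifting property also yields a rank function, so the order is graded; for a
single string [r] is the rank matrix, which describes the Bruhat order of the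
symmetric group. *)

(* Gradedness is obtained without dimensions of orbits: it is a fact about finite posets with the
   lifting property, and geometry serves only to identify the closure order with [mu_le]. The same
   abstract argument is used a second time to prove the rank-matrix criterion for the symmetric
   group. The obstacle on the geometric side is that a closure is given only through
   multihomogeneous equations. Membership is therefore established by continuity: a polynomial curve
   lying in a closure for all but finitely many parameters lies in it for all of them, because an
   algebraically closed field is infinite. This yields the completeness of the degenerate quadrics
   and repairs matrix decompositions that break down at special parameters. Algebraic closedness
   also supplies roots: of order [n], to normalise determinants, so that [B] may be replaced by all
   invertible upper triangular matrices, and of order 2, to turn [x ^ 2 + y ^ 2] into a product. *)
Require Import Defs.
From mathcomp Require Import all_boot all_order all_algebra all_fingroup.
From mathcomp Require Import mpoly ring zify.

Set Implicit Arguments.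
Unset Strict Implicit.
Unset Printing Implicit Defensive.
Import GRing.Theory.
(* MathComp has its own [coord] and [qact]. *)
Local Notation coord := Defs.coord.
Local Notation qact := Defs.qact.

(** * Posets with the lifting property *)

Section Lifting.

Variables (T I : finType) (le : T -> T -> bool) (s : I -> T -> T).
Variable asc : I -> T -> bool.

Hypothesis le_refl : reflexive le.
Hypothesis le_anti : forall x y, le x y -> le y x -> x = y.
Hypothesis le_trans : forall x y z, le x y -> le y z -> le x z.
Hypothesis sK : forall i, involutive (s i).
Hypothesis asc_s : forall i x, asc i (s i x) = ~~ asc i x.
Hypothesis asc_le : forall i x, asc i x -> le x (s i x).
Hypothesis lift_le :
  forall i x y, le x y -> asc i x -> ~~ asc i y -> le x (s i y).
Hypothesis all_asc_le : forall x, (forall i, asc i x) -> forall y, le x y.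

(** The induction measure of this section: it increases strictly along [le]. *)
Definition down_card (y : T) := #|[set x | le x y]|.

Lemma down_card_lt x y : le x y -> x <> y -> down_card x < down_card y.
Proof.
move=> lxy nxy; apply: proper_card; apply/properP; split.
  by apply/subsetP => z; rewrite !inE => /le_trans; apply.
exists y; rewrite !inE //; apply/negP => lyx; exact/nxy/le_anti.
Qed.

Lemma s_neq i x : s i x <> x.
Proof. by move=> e; have := asc_s i x; rewrite e; case: asc. Qed.

Lemma desc_le i x : ~~ asc i x -> le (s i x) x.
Proof. by move=> d; rewrite -{2}(sK i x); apply: asc_le; rewrite asc_s. Qed.

Lemma desc_or_min x : (exists i, ~~ asc i x) \/ (forall i, asc i x).
Proof.
case: (boolP [forall i, asc i x]) => [/forallP|/forallPn]; first by right.
by left.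
Qed.

(** Induction on [down_card y]. At a descent [i] of [y], lifting places [x] or [s i x] below the
    smaller [s i y], according to whether [i] is an ascent or a descent of [x]; [Ra] or [Rs] then
    climbs back to [y]. If [y] has no descent, it is least and equals [x]. *)
Lemma le_minimal_preorder (R : T -> T -> Prop) :
    (forall x, R x x) -> (forall x y z, R x y -> R y z -> R x z) ->
    (forall i x, asc i x -> R x (s i x)) ->
    (forall i x y, R x y -> asc i y -> R (s i x) (s i y)) ->
  forall x y, le x y -> R x y.
Proof.
move=> Rr Rt Ra Rs x y; have [m] := ubnP (down_card y).
elim: m x y => // m IH x y; rewrite ltnS => ym lxy.
have [[i dy]|] := desc_or_min y; last first.
  by move=> /all_asc_le/(_ x) lyx; rewrite (le_anti lxy lyx).
have my : down_card (s i y) < m.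
  by apply: leq_trans ym; apply: down_card_lt (desc_le dy) _; apply: s_neq.
have asy : asc i (s i y) by rewrite asc_s.
have [ax|dx] := boolP (asc i x).
  apply: Rt (IH _ _ my (lift_le lxy ax dy)) _.
  by rewrite -{2}(sK i y); apply: Ra.
rewrite -(sK i x) -(sK i y); apply: (Rs) => //; apply: IH => //.
by apply: lift_le => //; [apply: le_trans lxy; apply: desc_le | rewrite asc_s].
Qed.

Hypothesis s_le : forall i x y, le x y -> asc i y -> le (s i x) (s i y).

Definition covers (x y : T) : Prop :=
  [/\ le x y, x <> y & forall z, le x z -> le z y -> z = x \/ z = y].

Lemma desc_s_le i x y : le x y -> ~~ asc i y -> le (s i x) y.
Proof.
move=> lxy dy; have [ax|dx] := boolP (asc i x); last first.
  by apply: le_trans lxy; apply: desc_le.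
by rewrite -(sK i y); apply: s_le; rewrite ?asc_s //; apply: lift_le.
Qed.

(** The cover is one side of a square. If [i] were an ascent of [x], lifting would put [s i y]
    strictly between [x] and [y]. The two other covers follow by reflecting intermediate elements
    with [s i]. *)
Lemma covers_desc i x y : covers x y -> ~~ asc i y -> x <> s i y ->
  [/\ ~~ asc i x, covers (s i x) (s i y) & covers (s i x) x].
Proof.
move=> [lxy nxy cxy] dy nx.
have dx : ~~ asc i x.
  apply/negP => ax; have [] := cxy _ (lift_le lxy ax dy) (desc_le dy).
    by move=> e; apply: nx.
  exact: s_neq.
have asx : asc i (s i x) by rewrite asc_s.
have lsx := desc_le dx; have lsy := desc_le dy.
have below z : le (s i x) z -> z <> s i x -> ~~ asc i z -> le x z.
  by move=> l _ d; rewrite -(sK i x); apply: desc_s_le.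
split=> //; split=> //; last 2 first.
- exact: s_neq.
- move=> z l1 l2; have [az|dz] := boolP (asc i z).
    left; apply: le_anti => //; exact: lift_le.
  right; apply: le_anti => //; rewrite -(sK i x); exact: desc_s_le.
- by apply: lift_le => //; apply: le_trans lxy.
- by move/(can_inj (sK i)).
move=> z l1 l2; have [az|dz] := boolP (asc i z); last first.
  have lxz : le x z by rewrite -(sK i x); apply: desc_s_le.
  have [|e|e] := cxy z lxz; first exact: le_trans lsy.
    rewrite e in l2; case: (cxy _ l2 lsy) => [e'|]; last by move/s_neq.
    by case: nx.
  by rewrite e in l2; case: (@s_neq i y); apply: le_anti.
(* An intermediate [z] with an ascent at [i] reflects to an element between [x] and [y], hence to
   one of them. *)
have lz : le (s i z) y by apply: desc_s_le => //; apply: le_trans lsy.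
have lxz : le x (s i z).
  by rewrite -(sK i x); apply: desc_s_le; rewrite ?asc_s ?az //;
     apply: le_trans (asc_le az).
by case: (cxy _ lxz lz) => [<-|<-]; rewrite sK; [left|right].
Qed.

(** Walks down to the least element through arbitrarily picked descents, with [m] as fuel;
    [down_card x] is enough, since every step lowers it. That the result is a rank function is
    proved in [height_covers]. *)
Fixpoint height_rec (m : nat) (x : T) : nat :=
  if m is m'.+1 then
    if [pick i | ~~ asc i x] is Some i then (height_rec m' (s i x)).+1 else 0
  else 0.

Definition height x := height_rec (down_card x) x.

Lemma height_recE m x : down_card x <= m -> height_rec m x = height x.
Proof.
rewrite /height; move: {2}(down_card x) (leqnn (down_card x)) => k.
have ht : forall m k x, down_card x <= m -> down_card x <= k ->
    height_rec m x = height_rec k x.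
  elim=> [|{}m IH] {}k {}x.
    rewrite leqn0 => /eqP h; have : x \in [set z | le z x] by rewrite inE.
    by rewrite (cards0_eq h) inE.
  case: k => [_|k hm hk].
    rewrite leqn0 => /eqP h; have : x \in [set z | le z x] by rewrite inE.
    by rewrite (cards0_eq h) inE.
  rewrite /=; case: pickP => // i di; congr _.+1; apply: IH.
  - by rewrite -ltnS; apply: leq_trans hm; apply: down_card_lt (desc_le di) _;
      apply: s_neq.
  - by rewrite -ltnS; apply: leq_trans hk; apply: down_card_lt (desc_le di) _;
      apply: s_neq.
by move=> hk hm; apply: ht.
Qed.

Lemma heightE x :
  height x = if [pick i | ~~ asc i x] is Some i then (height (s i x)).+1 else 0.
Proof.
rewrite -(@height_recE (down_card x).+1) //=; case: pickP => // i di.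
rewrite height_recE //; apply: ltnW; apply: down_card_lt (desc_le di) _.
exact: s_neq.
Qed.

Lemma height_covers x y : covers x y -> height y = (height x).+1.
Proof.
have [m] := ubnP (down_card y); elim: m x y => // m IH x y.
rewrite ltnS => ym cxy; rewrite heightE; case: pickP => [i dy|h]; last first.
  have [lxy nxy _] := cxy; case: nxy; apply: le_anti => //.
  by apply: all_asc_le => i; have := h i; case: asc.
have [->//|/eqP nx] := eqVneq x (s i y).
have [dx c1 c2] := covers_desc cxy dy nx; have [lxy nxy _] := cxy.
have ym' : down_card (s i y) < m.
  by apply: leq_trans ym; apply: down_card_lt (desc_le dy) _; apply: s_neq.
(* Two sides of the square have tops smaller than [y]; both start at [s i x], so [s i y] and [x]
   have the same height. *)
rewrite (IH _ _ ym' c1) (IH _ _ _ c2) //.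
by apply: leq_trans ym; apply: down_card_lt.
Qed.

Lemma covers_above x y : le x y -> x <> y -> exists2 z, covers x z & le z y.
Proof.
move=> lxy /eqP nxy.
have [z /andP[lxz /andP[nz lz]] minz] :=
  @arg_minnP T y (fun z => [&& le x z, x != z & le z y]) down_card
    (introT and3P (And3 lxy nxy (le_refl y))).
exists z => //; split=> //; first exact/eqP.
move=> t lxt ltz; have [->|/eqP nxt] := eqVneq t x; [by left | right].
apply: le_anti => //; have [<-//|/eqP nt] := eqVneq t z.
have := minz t; rewrite lxt (le_trans ltz lz) andbT /=.
have -> : x != t by apply/eqP => e; apply: nxt.
by move=> /(_ isT); rewrite leqNgt (down_card_lt ltz nt).
Qed.

Lemma height_mono x y : le x y -> x <> y -> height x < height y.
Proof.
have [m] := ubnP (#|T| - down_card x); elim: m x => // m IH x.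
rewrite ltnS => hm lxy nxy; have [z cxz lzy] := covers_above lxy nxy.
have hz := height_covers cxz; have [->|/eqP nz] := eqVneq y z.
  by rewrite hz.
rewrite -ltnS -hz ltnS ltnW //; apply: IH => //; last by move=> e; apply: nz.
have [lxz nxz _] := cxz; have h1 := down_card_lt lxz nxz.
by apply: leq_trans hm; apply: ltn_sub2l => //; apply: leq_trans h1 (max_card _).
Qed.

Hypothesis all_desc_le : forall x, (forall i, ~~ asc i x) -> forall y, le y x.

Lemma greatest_exists (x0 : T) : exists t, forall y, le y t.
Proof.
have [t _ tmax] := @arg_maxnP T x0 xpredT down_card isT; exists t.
apply: all_desc_le => i; apply/negP => ai.
have := tmax (s i t) isT; rewrite /= leqNgt.
by rewrite (down_card_lt (asc_le ai)) // => e; apply: (@s_neq i t).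
Qed.

Lemma least_exists (x0 : T) : exists b, forall y, le b y.
Proof.
have [b _ bmin] := @arg_minnP T x0 xpredT down_card isT; exists b.
apply: all_asc_le => i; apply/negPn/negP => di.
have := bmin (s i b) isT; rewrite leqNgt.
by rewrite (down_card_lt (desc_le di)) // => e; apply: (@s_neq i b).
Qed.

Lemma maximal_chain_mem (C : {set T}) z :
  maximal_chain le [set: T] C -> (forall c, c \in C -> le c z \/ le z c) ->
  z \in C.
Proof.
move=> [_ chC maxC] hz; rewrite -(maxC (z |: C)) ?setU11 ?subsetUr //.
move=> a b; rewrite !inE => /orP[/eqP->|aC] /orP[/eqP->|bC].
- by left.
- by case: (hz b bC); [right|left].
- exact: hz.
- exact: chC.
Qed.

(** A maximal chain skips no height: if [y] is the next member above [x], a cover of [x] below [y]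
    is comparable with the whole chain and so belongs to it. *)
Lemma maximal_chain_heights (C : {set T}) t :
  (forall y, le y t) -> maximal_chain le [set: T] C ->
  forall r, r <= height t -> exists2 x, x \in C & height x = r.
Proof.
move=> ht mC; have [_ chC _] := mC.
have tC : t \in C by apply: maximal_chain_mem => // c _; left.
elim=> [_|r IH rt].
  have [b hb] := least_exists t.
  exists b; first by apply: maximal_chain_mem => // c _; right.
  rewrite heightE; case: pickP => // i db; case: (@s_neq i b).
  exact/le_anti/hb/desc_le.
have [x xC xr] := IH (ltnW rt).
have nxt : x <> t by move=> e; rewrite -xr e ltnn in rt.
have Dt : (t \in C) && (height x < height t) by rewrite tC xr rt.
have [y /andP[yC hxy] ymin] :=
  @arg_minnP T t (fun y => (y \in C) && (height x < height y)) height Dt.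
have lxy : le x y.
  case: (chC x y xC yC) => // lyx; have [->//|/eqP nyx] := eqVneq x y.
  by have := height_mono lyx (not_eq_sym nyx); rewrite ltnNge (ltnW hxy).
have [|z cxz lzy] := covers_above lxy; first by move=> e; rewrite e ltnn in hxy.
have hz := height_covers cxz; exists z; last by rewrite hz xr.
apply: maximal_chain_mem => // c cC.
have [hc|hc] := leqP (height c) (height x).
  left; have [lxz _ _] := cxz; apply: le_trans lxz.
  case: (chC c x cC xC) => // lxc; have [->//|/eqP nxc] := eqVneq x c.
  by have := height_mono lxc nxc; rewrite ltnNge hc.
right; apply: (le_trans lzy); have hyc : height y <= height c.
  by apply: ymin; rewrite cC.
case: (chC y c yC cC) => // lcy; have [->//|/eqP nxc] := eqVneq c y.
by have := height_mono lcy nxc; rewrite ltnNge hyc.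
Qed.

Lemma maximal_chain_card (C : {set T}) t :
  (forall y, le y t) -> maximal_chain le [set: T] C -> #|C| = (height t).+1.
Proof.
move=> ht mC; have [_ chC _] := mC.
have hle x : height x <= height t.
  by have [->//|/eqP n] := eqVneq x t; apply/ltnW/height_mono.
have inj : {in C &, injective (fun x => inord (height x) : 'I_(height t).+1)}.
  move=> x y xC yC /(congr1 val) /=; rewrite !inordK ?ltnS // => e.
  apply/eqP; case: (eqVneq x y) => // /eqP n.
  have [l|l] := chC x y xC yC.
    by have := height_mono l n; rewrite e ltnn.
  by have := height_mono l (not_eq_sym n); rewrite e ltnn.
rewrite -(card_in_imset inj) -[RHS]card_ord -cardsT; apply: eq_card => r.
rewrite !inE; apply/imsetP.
have [x xC xr] := maximal_chain_heights ht mC (leq_ord r).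
by exists x => //; apply: val_inj; rewrite /= inordK xr // ltnS leq_ord.
Qed.

Theorem lifting_graded : graded le [set: T].
Proof.
move=> C D mC mD; have [/eqP h|[x0 _]] := set_0Vmem [set: T].
  have e0 (A : {set T}) : A = set0.
    by apply/eqP; rewrite -subset0 -(eqP h) subsetT.
  by rewrite (e0 C) (e0 D).
have [t ht] := greatest_exists x0.
by rewrite (maximal_chain_card ht mC) (maximal_chain_card ht mD).
Qed.

End Lifting.

Lemma chain_iff (T : finType) (R R' : T -> T -> Prop) :
  (forall x y, R x y <-> R' x y) -> forall C, chain R C -> chain R' C.
Proof.
by move=> RR' C h x y xC yC; case: (h x y xC yC) => /RR'; [left | right].
Qed.

Lemma graded_iff (T : finType) (R R' : T -> T -> Prop) (A : {set T}) :
  (forall x y, R x y <-> R' x y) -> graded R A -> graded R' A.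
Proof.
move=> RR' gA C D mC mD.
have R'R x y : R' x y <-> R x y by apply: iff_sym.
have tr B : maximal_chain R' A B -> maximal_chain R A B.
  move=> [sB cB mB]; split=> //; first exact: chain_iff cB.
  by move=> E sE /(chain_iff RR'); apply: mB.
exact: gA (tr _ mC) (tr _ mD).
Qed.

(** * Rank functions of block pairings *)

Section Rank.

Variable n : nat.
Implicit Types (b : 'I_n -> nat) (p : 'I_n -> 'I_n) (f g : 'I_n -> bool).

Definition below f (z : nat) : nat := \sum_(a < n | a < z) f a.

Lemma below0 f : below f 0 = 0.
Proof. by rewrite /below big_pred0. Qed.

Lemma belowS f (i : 'I_n) : below f i.+1 = below f i + f i.
Proof.
rewrite /below (bigD1 i) //= addnC; congr (_ + _); apply: eq_bigl => a.
by rewrite ltnS leq_eqVlt -val_eqE /=; case: ltngtP.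
Qed.

Lemma below_ge f z : n <= z -> below f z = below f n.
Proof. by move=> h; apply: eq_bigl => a; rewrite ltn_ord (leq_trans _ h). Qed.

Lemma below_step f z : below f z <= below f z.+1 <= (below f z).+1.
Proof.
case: (ltnP z n) => h; last by rewrite !below_ge ?leqnn ?leqnSn // ltnW.
by rewrite (belowS f (Ordinal h)) /=; case: (f _); lia.
Qed.

Lemma below_mono f z z' : z <= z' -> below f z <= below f z' <= below f z + (z' - z).
Proof.
move=> h; rewrite -(subnKC h); elim: (z' - z) => [|d IH].
  by rewrite addn0; lia.
by have := below_step f (z + d); rewrite addnS; lia.
Qed.

Lemma below_false f z : (forall a : 'I_n, a < z -> f a = false) -> below f z = 0.
Proof. by move=> h; rewrite /below big1 // => a /h ->. Qed.

Lemma below_true f z : z <= n -> (forall a : 'I_n, z <= a -> f a) ->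
  below f n = below f z + (n - z).
Proof.
move=> zn; have [d] := ubnP (n - z); elim: d z zn => // d IH z zn hd h.
have [->|nz] := eqVneq z n; first by lia.
have zl : z < n by rewrite ltn_neqAle nz.
have := IH z.+1 zl; rewrite (belowS f (Ordinal zl)) /= h // => -> //=; first lia.
  lia.
by move=> a za; apply: h; lia.
Qed.

Lemma tperm_ltn (i i' a : 'I_n) (z : nat) :
  i' = i.+1 :> nat -> z <> i' -> (tperm i i' a < z) = (a < z).
Proof.
move=> e nz; case: tpermP => [->|->|] //.
  by apply/idP/idP; lia.
by apply/idP/idP; lia.
Qed.

Lemma tperm_val (i i' a : 'I_n) : tperm i i' a =
  (if a == i :> nat then i' else if a == i' :> nat then i else a) :> nat.
Proof.
have vE (c d : 'I_n) : (c == d :> nat) = (c == d) by [].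
rewrite !vE; case: tpermP => [->|->|/eqP/negbTE-> /eqP/negbTE->] //.
  by rewrite eqxx.
by case: eqP => [->|_]; rewrite ?eqxx.
Qed.

Lemma below_tperm f f' (i i' : 'I_n) (z : nat) :
  i' = i.+1 :> nat -> z <> i' -> (forall a, f' (tperm i i' a) = f a) ->
  below f' z = below f z.
Proof.
move=> e nz ff; rewrite /below (reindex_inj (@perm_inj _ (tperm i i'))) /=.
by apply: eq_big => a; [rewrite (tperm_ltn _ e nz) | rewrite ff].
Qed.

(** The increments of [below] are 0 or 1. The first alternative makes [below f] convex at [i'], the
    second makes [below g] concave there; either way the inequality at [i'] is forced by those at
    its two neighbours. *)
Lemma below_fill f g (i i' : 'I_n) c d :
  i' = i.+1 :> nat -> (f i -> f i') \/ (g i' -> g i) ->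
  (forall z : nat, z <> i' -> c + below f z <= d + below g z) ->
  forall z, c + below f z <= d + below g z.
Proof.
move=> e fg h z; have [->|/eqP] := eqVneq z i'; last exact: h.
have h1 := h i; have h2 := h i'.+1.
have h1' : c + below f i <= d + below g i by apply: h1; lia.
have h2' : c + below f i'.+1 <= d + below g i'.+1 by apply: h2; lia.
move: h2'; rewrite !belowS e !belowS.
by case: (f i) (f i') (g i) (g i') fg => [] [] [] [] [] // h3; lia.
Qed.

Definition upclosed f := forall i i' : 'I_n, i' = i.+1 :> nat -> f i -> f i'.
Definition downclosed f := forall i i' : 'I_n, i' = i.+1 :> nat -> f i' -> f i.

Lemma upclosed_le f : upclosed f -> forall a c : 'I_n, a <= c -> f a -> f c.
Proof.
move=> uf a c; have [d] := ubnP (c - a); elim: d a => // d IH a hd ac fa.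
have [e|nz] := eqVneq a c; first by rewrite -e.
have ac' : a < c by rewrite ltn_neqAle nz.
have lac : a.+1 < n by apply: leq_ltn_trans (ltn_ord c).
by apply: (IH (Ordinal lac)); [move=> /=; lia | | apply: uf fa].
Qed.

Lemma downclosed_le f : downclosed f -> forall a c : 'I_n, a <= c -> f c -> f a.
Proof.
move=> df a c ac; apply: contraLR => na.
apply: (@upclosed_le (fun x => ~~ f x) _ a c ac na).
by move=> i i' e; apply: contra; apply: df.
Qed.

(** [below f] is first constant and then of slope one, while the slopes of [below g] are 0 or 1: the
    inequalities at the two ends suffice. [below_downclosed] is the mirror image. *)
Lemma below_upclosed f g c d z : upclosed f ->
  c <= d -> c + below f n <= d + below g n -> c + below f z <= d + below g z.
Proof.
move=> uf cd hn; case: (leqP n z) => zn; first by rewrite !(below_ge _ zn).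
case: (boolP [exists a : 'I_n, (a < z) && f a]) => [/existsP[a /andP[az fa]]|].
  have e : below f n = below f z + (n - z).
    apply: below_true (ltnW zn) _ => x xz.
    by apply: (upclosed_le uf _ fa); lia.
  by have := below_mono g (ltnW zn); lia.
move=> /existsPn h; rewrite below_false; first by lia.
by move=> a az; have := h a; rewrite az; case: (f a).
Qed.

Lemma below_const z : z <= n -> below (fun=> true) z = z.
Proof.
elim: z => [|z IH] zn; first exact: below0.
by rewrite (belowS _ (Ordinal zn)) /= IH ?addn1 // ltnW.
Qed.

Lemma belowC f z : z <= n -> below f z + below (fun a => ~~ f a) z = z.
Proof.
move=> zn; rewrite -[RHS](below_const zn) /below -big_split.
by apply: eq_bigr => a _; case: (f a).
Qed.

Lemma below_downclosed f g c d z : downclosed g ->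
  c <= d -> c + below f n <= d + below g n -> c + below f z <= d + below g z.
Proof.
move=> dg cd hn; case: (leqP n z) => zn; first by rewrite !(below_ge _ zn).
have neg h := belowC h (ltnW zn); have negn h := belowC h (leqnn n).
case: (boolP [exists a : 'I_n, (z <= a) && g a]) => [/existsP[a /andP[az ga]]|].
  have e : below (fun a => ~~ g a) z = 0.
    apply: below_false => x xz; apply/negbTE/negPn.
    by apply: (downclosed_le dg _ ga); lia.
  by have := neg g; have := neg f; lia.
move=> /existsPn h; have e := @below_true (fun a => ~~ g a) z (ltnW zn).
have {e}e : below (fun a => ~~ g a) n = below (fun a => ~~ g a) z + (n - z).
  by apply: e => x xz; have := h x; rewrite xz.
have := below_mono f (ltnW zn); have := neg g; have := negn g; lia.
Qed.

End Rank.

Section RankFunction.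

Variable n : nat.
Implicit Types (b : 'I_n -> nat) (p : 'I_n -> 'I_n) (i : 'I_n).

(** The increment of the rank in the variable [z]. With [w] frozen inside, the rank is a
    one-variable count to which [below_fill] applies. *)
Definition corner b p (j w : nat) (a : 'I_n) : bool :=
  (j < b a) || ((b a == j) && (p a < w)).

Definition rank_fun b p (j z w : nat) : nat :=
  below (fun a => j < b a) w + below (corner b p j w) z.

Definition block_pairing b p := involutive p /\ forall a, b (p a) = b a.

(** Reindexing by [p] exchanges the conditions [a < z] and [p a < w]. Arguments made in the variable
    [z] are carried over to [w] by this symmetry. *)
Lemma rank_fun_sym b p j z w : block_pairing b p ->
  rank_fun b p j z w = rank_fun b p j w z.
Proof.
move=> [pK bp]; rewrite /rank_fun.
have e z' w' : below (corner b p j w') z' = below (fun a => j < b a) z' +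
    \sum_(a : 'I_n) [&& a < z', b a == j & p a < w'].
  rewrite /below big_mkcond [in RHS]big_mkcond -big_split /=.
  by apply: eq_bigr => a _; rewrite /corner;
    case: (a < z'); case: (ltngtP j (b a)); case: (p a < w').
rewrite !e addnCA; congr (_ + (_ + _)).
rewrite (reindex_inj (can_inj pK)); apply: eq_bigr => a _.
by rewrite pK bp andbA andbC andbA andbAC -andbA andbC -andbA.
Qed.

(** Differences in [z] recover [corner]. At [w = n] it reads [j <= b a], which determines [b]; at
    [j = b a] it reads [p a < w], which determines [p]. *)
Lemma rank_fun_inj b p b' p' :
  (forall j z w, rank_fun b p j z w = rank_fun b' p' j z w) ->
  b =1 b' /\ p =1 p'.
Proof.
move=> h.
have hc j w a : corner b p j w a = corner b' p' j w a.
  have := h j a.+1 w; have := h j a w.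
  by rewrite /rank_fun !belowS !addnA => -> /addnI; do 2 case: corner.
have hb a : b a = b' a.
  have hj j : (j <= b a) = (j <= b' a).
    have := hc j n a; rewrite /corner !ltn_ord !andbT.
    by rewrite ![_ == j]eq_sym orbC -leq_eqVlt orbC -leq_eqVlt.
  by apply/eqP; rewrite eqn_leq -hj leqnn hj leqnn.
split=> // a; apply/val_inj/eqP.
have hw w : (p a < w) = (p' a < w).
  by have := hc (b a) w a; rewrite /corner -hb ltnn eqxx.
by rewrite eqn_leq -ltnS hw ltnSn -ltnS -hw ltnSn.
Qed.

(** The case in which conjugation by the transposition changes nothing: [i] and [i'] share a block
    and are both fixed or exchanged by [p]. There [swap_pairing] composes with the transposition
    instead, which trades two fixed points for a two-cycle. *)
Definition swap_singular b p (i i' : 'I_n) :=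
  [&& b i == b i', p i \in pred2 i i' & p i' \in pred2 i i'].

Definition swap_blocks b (i i' : 'I_n) a := b (tperm i i' a).

Definition swap_pairing b p (i i' : 'I_n) a :=
  if swap_singular b p i i' then p (tperm i i' a)
  else tperm i i' (p (tperm i i' a)).

(* [i'] is always the successor of [i]. *)
Definition ascent b p (i i' : 'I_n) : bool :=
  (b i < b i') || ((b i == b i') && (p i' < p i)).

(** An ascent makes the rank convex at [i'] for all [j] and [w] at once; [descent_corner] gives the
    corresponding concavity. *)
Lemma ascent_corner b p i i' j w :
  ascent b p i i' -> corner b p j w i -> corner b p j w i'.
Proof.
rewrite /ascent /corner => /orP[h|/andP[/eqP <- h]].
  by case: ltngtP => //= h' _; apply/orP; left; lia.
by case: ltngtP => //= _ h'; lia.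
Qed.

Lemma descent_corner b p i i' j w : i != i' -> block_pairing b p ->
  ~~ ascent b p i i' -> corner b p j w i' -> corner b p j w i.
Proof.
move=> ni [pK _]; rewrite /ascent /corner negb_or -leqNgt negb_and -leqNgt.
move=> /andP[h1 /orP[h2|h2]].
  by case: ltngtP => //= h' _; apply/orP; left; lia.
case: (eqVneq (b i) (b i')) => [->|h3]; last first.
  by case: ltngtP => //= h' _; apply/orP; left; lia.
by case: ltngtP => //= _ h'; apply: leq_ltn_trans h'.
Qed.

(** [below_fill] is applied twice: in [z], and then in [w] through [rank_fun_sym]. *)
Lemma rank_fun_fill b p b' p' (i i' : 'I_n) :
  block_pairing b p -> block_pairing b' p' -> i' = i.+1 :> nat ->
  ascent b p i i' \/ ~~ ascent b' p' i i' ->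
  (forall j (z w : nat), z <> i' -> w <> i' ->
     rank_fun b p j z w <= rank_fun b' p' j z w) ->
  forall j z w, rank_fun b p j z w <= rank_fun b' p' j z w.
Proof.
move=> bp bp' e ad h.
have ni : i != i' by rewrite -val_eqE /= e; lia.
have fill (w : nat) j : (forall z : nat, z <> i' -> rank_fun b p j z w <= rank_fun b' p' j z w) ->
    forall z, rank_fun b p j z w <= rank_fun b' p' j z w.
  apply: (below_fill e) => //; case: ad => ad; first by left; apply: ascent_corner.
  by right; apply: descent_corner.
have h1 j (z w : nat) : w <> i' -> rank_fun b p j z w <= rank_fun b' p' j z w.
  by move=> nw; apply: fill => z' nz; apply: h.
move=> j z w; apply: fill => z' nz.
by rewrite rank_fun_sym // [leqRHS]rank_fun_sym //; apply: h1.
Qed.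

Lemma swap_singularP b p i i' : i != i' -> block_pairing b p ->
  swap_singular b p i i' ->
  b i = b i' /\ ((p i = i /\ p i' = i') \/ (p i = i' /\ p i' = i)).
Proof.
move=> ni [pK _] /and3P[/eqP-> /pred2P h1 /pred2P h2]; split=> //.
case: h1 h2 => h1 [] h2; [|by left|by right|].
  by rewrite -(pK i') h2 h1 eqxx in ni.
by rewrite -(pK i) h1 h2 eqxx in ni.
Qed.

Lemma swap_singular_comm b p i i' : i != i' -> block_pairing b p ->
  swap_singular b p i i' -> forall a, p (tperm i i' a) = tperm i i' (p a).
Proof.
move=> ni bp sg a; have [_ pi] := swap_singularP ni bp sg.
case: tpermP => [->|->|n1 n2].
- by case: pi => [[-> ->]|[-> ->]]; rewrite ?tpermL ?tpermR.
- by case: pi => [[-> ->]|[-> ->]]; rewrite ?tpermL ?tpermR.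
have [pK _] := bp.
have nope c : c = p a -> p c = a by move=> ->; rewrite pK.
rewrite tpermD //; apply/eqP => /nope h.
  by case: pi => [[e _]|[e _]]; [apply: n1 | apply: n2]; rewrite -h e.
by case: pi => [[_ e]|[_ e]]; [apply: n2 | apply: n1]; rewrite -h e.
Qed.

Lemma swap_blockingK b (i i' : 'I_n) :
  swap_blocks (swap_blocks b i i') i i' =1 b.
Proof. by move=> a; rewrite /swap_blocks tpermK. Qed.

Lemma swap_singular_swap b p i i' : i != i' -> block_pairing b p ->
  swap_singular (swap_blocks b i i') (swap_pairing b p i i') i i' =
  swap_singular b p i i'.
Proof.
move=> ni bp; rewrite {1}/swap_singular /swap_blocks tpermL tpermR eq_sym.
rewrite /swap_pairing tpermL tpermR; case: ifP => sg.
  by have /and3P[-> /= -> ->] := sg.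
rewrite -{}sg /swap_singular; case: (b i =P b i') => //= _.
have ht a : (tperm i i' a \in pred2 i i') = (a \in pred2 i i').
  by rewrite !inE; case: tpermP => [->|->|/eqP/negbTE-> /eqP/negbTE-> //];
    rewrite !eqxx ?orbT.
by rewrite !ht andbC.
Qed.

Lemma swap_pairingK b p i i' : i != i' -> block_pairing b p ->
  swap_pairing (swap_blocks b i i') (swap_pairing b p i i') i i' =1 p.
Proof.
move=> ni bp a; rewrite {1}/swap_pairing swap_singular_swap //.
by rewrite /swap_pairing; case: (swap_singular b p i i'); rewrite !tpermK.
Qed.

Lemma swap_block_pairing b p i i' : i != i' -> block_pairing b p ->
  block_pairing (swap_blocks b i i') (swap_pairing b p i i').
Proof.
move=> ni bpp; have [pK bp] := bpp.
have [sg|/negbTE sg] := boolP (swap_singular b p i i');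
  split=> a; rewrite /swap_pairing /swap_blocks sg.
- by rewrite (swap_singular_comm ni bpp sg) pK tpermK.
- rewrite -(swap_singular_comm ni bpp sg) tpermK bp.
  by have [bi _] := swap_singularP ni bpp sg; case: tpermP => [->|->|].
- by rewrite tpermK pK tpermK.
- by rewrite tpermK bp.
Qed.

Lemma ascent_swap b p (i i' : 'I_n) : i != i' -> block_pairing b p ->
  i' = i.+1 :> nat ->
  ascent (swap_blocks b i i') (swap_pairing b p i i') i i' = ~~ ascent b p i i'.
Proof.
move=> ni bp e; rewrite /ascent /swap_blocks tpermL tpermR.
rewrite /swap_pairing tpermL tpermR; have [pK _] := bp.
case: ltngtP => //= h; case: ifP => [/(swap_singularP ni bp)[_ pi]|sg].
  by case: pi => [[-> ->]|[-> ->]]; apply/idP/idP; lia.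
have np : p i <> p i' :> nat.
  by move=> /val_inj/(can_inj pK) h'; rewrite h' eqxx in ni.
have sg' : ~~ ((p i \in pred2 i i') && (p i' \in pred2 i i')).
  by move/negbT: sg; rewrite /swap_singular h eqxx.
move: np sg'; rewrite !inE -!val_eqE /= !tperm_val.
case: (p i =P i :> nat); case: (p i =P i' :> nat); case: (p i' =P i :> nat);
  case: (p i' =P i' :> nat) => /=; move=> *; apply/idP/idP; lia.
Qed.

End RankFunction.

(** * Mu-involutions as block pairings *)

Lemma mem_nth_flatten (T : eqType) (ss : seq (seq T)) a j :
  uniq (flatten ss) -> a \in flatten ss ->
  (a \in nth [::] ss j) = (find (fun s => a \in s) ss == j).
Proof.
elim: ss j => [|s ss IH] j //=; rewrite cat_uniq mem_cat => /and3P[_ /hasPn dis us].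
have [as_ _|ns /= ain] := boolP (a \in s).
  case: j => [|j] //=; apply/negbTE/negP => aj.
  have /dis /= : a \in flatten ss; last by rewrite as_.
  apply/flattenP; exists (nth [::] ss j) => //.
  by apply: mem_nth; rewrite ltnNge; apply/negP => h; rewrite nth_default in aj.
by case: j => [|j] /=; rewrite ?(negbTE ns) // IH.
Qed.

Lemma perm_codom_mem (n : nat) (w : 'S_n) a : a \in codom w.
Proof. by apply/codomP; exists (w^-1 a)%g; rewrite permKV. Qed.

Lemma perm_codom_uniq (n : nat) (w : 'S_n) : uniq (codom w).
Proof. by rewrite map_inj_uniq ?enum_uniq //; apply: perm_inj. Qed.

Lemma mem_alphabet n (s : seq 'I_n) a : (a \in alphabet s) = (a \in s).
Proof. by rewrite mem_filter mem_enum andbT. Qed.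

Lemma alphabet_uniq n (s : seq 'I_n) : uniq (alphabet s).
Proof. by rewrite filter_uniq // enum_uniq. Qed.

Lemma size_alphabet n (s : seq 'I_n) : uniq s -> size (alphabet s) = size s.
Proof.
by move=> us; apply/perm_size/uniq_perm => //; [apply: alphabet_uniq | apply: mem_alphabet].
Qed.

Lemma read_string_notin n (s : seq 'I_n) a : uniq s -> a \notin s -> read_string s a = a.
Proof.
move=> us ns; rewrite /read_string nth_default //.
by rewrite -size_alphabet // memNindex // mem_alphabet.
Qed.

Lemma read_string_in n (s : seq 'I_n) a : uniq s -> a \in s -> read_string s a \in s.
Proof.
by move=> us ins; apply: mem_nth; rewrite -size_alphabet // index_mem mem_alphabet.
Qed.

Lemma map_read_string n (s : seq 'I_n) : uniq s -> map (read_string s) (alphabet s) = s.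
Proof.
move=> us; have sz := size_alphabet us.
case: s us sz => [|x s] us sz; first by case: (alphabet _) sz.
apply: (@eq_from_nth _ x); rewrite size_map // => i hi.
rewrite (nth_map x) // /read_string index_uniq //; last exact: alphabet_uniq.
by apply: set_nth_default; rewrite -sz.
Qed.

Lemma card_ord_filter n (P : pred 'I_n) : #|[set a | P a]| = size [seq a <- enum 'I_n | P a].
Proof.
rewrite cardE; apply/perm_size/uniq_perm; first exact: enum_uniq.
  exact/filter_uniq/enum_uniq.
by move=> a; rewrite [RHS]mem_filter !mem_enum inE andbT.
Qed.

Section MuData.

Variables (n : nat) (mu : seq nat).
Hypothesis mu_sum : sumn mu = n.
Implicit Types w : 'S_n.

Lemma flatten_strings w : flatten (strings mu w) = codom w.
Proof. by rewrite reshapeKr // mu_sum size_codom card_ord. Qed.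

Lemma shape_strings w : shape (strings mu w) = mu.
Proof. by rewrite reshapeKl // mu_sum size_codom card_ord. Qed.

Lemma size_strings w : size (strings mu w) = size mu.
Proof. by rewrite size_reshape. Qed.

Lemma mem_string w a j : (a \in nth [::] (strings mu w) j) = (string_index mu w a == j).
Proof.
apply: mem_nth_flatten; rewrite flatten_strings ?perm_codom_uniq //.
exact: perm_codom_mem.
Qed.

Lemma string_uniq w j : uniq (nth [::] (strings mu w) j).
Proof.
case: (ltnP j (size mu)) => h; last by rewrite nth_default // size_strings.
have : nth [::] (strings mu w) j \in strings mu w by rewrite mem_nth ?size_strings.
have := perm_codom_uniq w; rewrite -flatten_strings; move: (nth _ _ _) => s + ins.
case/splitPr: ins => s1 s2; rewrite flatten_cat /= !cat_uniq.
by case/and3P => _ _ /and3P[].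
Qed.

Lemma alphabet_string w j :
  alphabet (nth [::] (strings mu w) j) = [seq a <- enum 'I_n | string_index mu w a == j].
Proof. by apply: eq_filter => a; rewrite mem_string. Qed.

Lemma card_string w j : #|[set a | string_index mu w a == j]| = nth 0 mu j.
Proof.
rewrite -{2}(shape_strings w).
have -> : nth 0 (shape (strings mu w)) j = size (nth [::] (strings mu w) j).
  case: (ltnP j (size mu)) => h; first by rewrite (nth_map [::]) ?size_strings.
  by rewrite !nth_default ?size_map ?size_strings.
by rewrite -(size_alphabet (string_uniq w j)) alphabet_string card_ord_filter.
Qed.

Lemma string_index_partner w a : string_index mu w (partner mu w a) = string_index mu w a.
Proof.
apply/eqP; rewrite -mem_string; apply: read_string_in; first exact: string_uniq.
by rewrite mem_string.
Qed.

(** This makes the encoding faithful: strings are recovered from the blocks and from [partner],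
    whence [mu_data_inj], and the formula dictates the word built in [mu_data_surj]. *)
Lemma string_partner w j : nth [::] (strings mu w) j =
  map (partner mu w) [seq a <- enum 'I_n | string_index mu w a == j].
Proof.
rewrite -alphabet_string -[LHS](map_read_string (string_uniq w j)).
by apply/eq_in_map => a; rewrite mem_alphabet mem_string /partner => /eqP ->.
Qed.

Lemma is_mu_involutionE w : is_mu_involution mu w <-> involutive (partner mu w).
Proof.
split=> [/allP h a|pK].
  have hs : nth [::] (strings mu w) (string_index mu w a) \in strings mu w.
    apply: mem_nth; rewrite ltnNge; apply/negP => h'.
    by have := mem_string w a (string_index mu w a); rewrite eqxx nth_default.
  have /forallP hh := h _ hs; have /eqP := hh a.
  by rewrite -/(partner mu w a) => e; rewrite {1}/partner string_index_partner.
apply/allP => s /(nthP [::])[j _ <-]; apply/forallP => a.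
have us := string_uniq w j.
have [|ns] := boolP (a \in nth [::] (strings mu w) j); last first.
  by rewrite !read_string_notin.
by rewrite mem_string => /eqP <-; have := pK a; rewrite {1}/partner string_index_partner => ->.
Qed.

Lemma mu_data_inj w w' :
  string_index mu w =1 string_index mu w' -> partner mu w =1 partner mu w' -> w = w'.
Proof.
move=> hb hp; apply/permP; have e : codom w = codom w'.
  rewrite -!flatten_strings; congr flatten.
  apply: (@eq_from_nth _ [::]); rewrite !size_strings // => j _.
  by rewrite !string_partner (eq_map hp); congr map; apply: eq_filter => a; rewrite hb.
by move=> a; move/eq_in_map: e => /(_ a) -> //; rewrite mem_enum.
Qed.

Lemma mu_data_surj (b : 'I_n -> nat) (p : 'I_n -> 'I_n) :
  block_pairing b p -> (forall j, #|[set a | b a == j]| = nth 0 mu j) ->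
  exists2 w : 'S_n, string_index mu w =1 b & partner mu w =1 p.
Proof.
move=> [pK bp] hc.
pose A j := [seq a <- enum 'I_n | b a == j].
pose ss := [seq map p (A j) | j <- iota 0 (size mu)].
have memA j a : (a \in A j) = (b a == j) by rewrite mem_filter mem_enum andbT.
have mem_ss j a : (a \in map p (A j)) = (b a == j).
  by rewrite -{1}(pK a) mem_map ?memA ?bp //; apply: can_inj pK.
have b_lt a : b a < size mu.
  rewrite ltnNge; apply/negP => h; have := hc (b a); rewrite nth_default // => /eqP.
  by rewrite cards_eq0 => /eqP/setP/(_ a); rewrite !inE eqxx.
have nth_ss j : j < size mu -> nth [::] ss j = map p (A j).
  by move=> h; rewrite (nth_map 0) ?size_iota // nth_iota.
have sh : shape ss = mu.
  apply: (@eq_from_nth _ 0); rewrite !size_map size_iota // => j hj.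
  rewrite (nth_map [::]) ?size_map ?size_iota // nth_ss // size_map -hc.
  by rewrite card_ord_filter.
have sz : size (flatten ss) = n by rewrite size_flatten sh.
have full a : a \in flatten ss.
  apply/flattenP; exists (map p (A (b a))); last by rewrite mem_ss.
  by apply: map_f; rewrite mem_iota b_lt.
(* A list of length [n] that contains all [n] letters has no repetition. *)
have un : uniq (flatten ss).
  apply: (@leq_size_uniq _ (enum 'I_n)); rewrite ?enum_uniq ?size_enum_ord ?sz //.
pose f (a : 'I_n) := nth a (flatten ss) a.
have finj : injective f.
  move=> x y; rewrite /f (set_nth_default y) ?sz // => /eqP.
  by rewrite nth_uniq ?sz // => /eqP/val_inj.
have cw : codom (perm finj) = flatten ss.
  case: (posnP n) => [n0|n0].
    have e1 : size (codom (perm finj)) = 0 by rewrite size_codom card_ord.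
    have e2 : size (flatten ss) = 0 by rewrite sz.
    by rewrite (size0nil e1) (size0nil e2).
  apply: (@eq_from_nth _ (Ordinal n0)); rewrite ?size_codom ?card_ord ?sz // => i hi.
  rewrite (nth_map (Ordinal n0)) ?size_enum_ord // permE /f.
  rewrite nth_enum_ord //; apply: set_nth_default; by rewrite sz.
have st : strings mu (perm finj) = ss by rewrite /strings cw -sh flattenK.
have sb : string_index mu (perm finj) =1 b.
  move=> a; apply/eqP; rewrite -mem_string st nth_ss ?mem_ss //.
exists (perm finj) => // a.
have := string_partner (perm finj) (b a); rewrite st nth_ss //.
rewrite (eq_filter (a2 := fun c => b c == b a)); last by move=> c; rewrite sb.
by move/eq_in_map => -> //; rewrite memA.
Qed.

End MuData.

Lemma string_index_nil (n : nat) (w : 'S_n) a : string_index [:: n] w a = 0.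
Proof.
by apply/eqP; rewrite -mem_string /= ?addn0 // take_oversize ?size_codom ?card_ord ?perm_codom_mem.
Qed.

Lemma partner_whole (n : nat) (w : 'S_n) a : partner [:: n] w a = w a.
Proof.
rewrite /partner string_index_nil /= take_oversize ?size_codom ?card_ord //.
have e : alphabet (codom w) = enum 'I_n.
  by apply/all_filterP/allP => c _; apply: perm_codom_mem.
rewrite /read_string e (nth_map a) ?index_mem ?mem_enum // nth_index ?mem_enum //.
Qed.

Lemma is_mu_involution_whole (n : nat) (w : 'S_n) :
  is_mu_involution [:: n] w <-> involutive w.
Proof.
rewrite is_mu_involutionE /= ?addn0 //.
by split=> h a; have := h a; rewrite !partner_whole.
Qed.

Lemma is_mu_involution_ones (n : nat) (w : 'S_n) : is_mu_involution (nseq n 1) w.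
Proof.
have hs : sumn (nseq n 1) = n by rewrite sumn_nseq mul1n.
apply/(is_mu_involutionE hs) => a.
have id1 c : partner (nseq n 1) w c = c.
  have := card_string hs w (string_index (nseq n 1) w c).
  have h : string_index (nseq n 1) w c < n.
    have := mem_string hs w c (string_index (nseq n 1) w c); rewrite eqxx ltnNge => aj.
    apply/negP => h'; rewrite nth_default ?size_strings ?size_nseq // in aj.
  rewrite nth_nseq h => /eqP/cards1P[d /setP hd].
  have := hd c; have := hd (partner (nseq n 1) w c).
  by rewrite !inE string_index_partner // eqxx => /esym/eqP -> /esym/eqP ->.
by rewrite !id1.
Qed.

Definition adjacent (n : nat) := {q : 'I_n * 'I_n | q.2 == q.1.+1 :> nat}.

Section AdjacentLemmas.
Variable n : nat.
Implicit Types q : adjacent n.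

Lemma adjacentP q : (val q).2 = (val q).1.+1 :> nat.
Proof. exact/eqP/(valP q). Qed.

Lemma adjacent_neq q : (val q).1 != (val q).2.
Proof. by apply/eqP => e; have := adjacentP q; rewrite e => /n_Sn. Qed.

Definition mk_adjacent (i i' : 'I_n) (e : i' = i.+1 :> nat) : adjacent n :=
  exist _ (i, i') (introT eqP e).

End AdjacentLemmas.

Section RankBounds.
Variables (n : nat) (b : 'I_n -> nat) (p : 'I_n -> 'I_n).

(** Together with [rank_fun_large] this reduces the comparison of ranks to finitely many [j], [z],
    [w], so that [mu_le] can be Boolean. *)
Lemma rank_fun_minn j z w :
  rank_fun b p j z w = rank_fun b p j (minn z n) (minn w n).
Proof.
have e (f : 'I_n -> bool) z' : below f z' = below f (minn z' n) :> nat.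
  by case: (leqP z' n) => h //; rewrite below_ge // ltnW.
rewrite /rank_fun -!e; congr (_ + _); apply: eq_bigr => a _; congr nat_of_bool.
by rewrite /corner; congr (_ || (_ && _)); rewrite leq_min ltn_ord andbT.
Qed.

Lemma rank_fun_large j z w : (forall a, b a < j) -> rank_fun b p j z w = 0.
Proof.
move=> h; rewrite /rank_fun !below_false // => a _; rewrite /corner; last first.
  by have := h a; lia.
by have := h a; case: ltngtP.
Qed.

Lemma rank_fun_0n j : rank_fun b p j 0 n = #|[set a | j < b a]|.
Proof.
rewrite /rank_fun below0 addn0 /below cardE -sum1_size big_enum_cond /= big_mkcond.
rewrite [RHS]big_mkcond; apply: eq_bigr => a _.
by rewrite ltn_ord inE; case: (_ < _).
Qed.

Lemma rank_fun_nn j :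
  rank_fun b p j n n = #|[set a | j < b a]| + #|[set a | j <= b a]|.
Proof.
rewrite -rank_fun_0n /rank_fun below0 addn0; congr (_ + _).
rewrite /below cardE -sum1_size big_enum_cond /= big_mkcond.
rewrite [RHS]big_mkcond; apply: eq_bigr => a _.
by rewrite ltn_ord inE /corner ltn_ord andbT; case: ltngtP.
Qed.
End RankBounds.

(** * The rank order on mu-involutions and its lifting property *)

Section MuOrder.

Variables (n : nat) (mu : seq nat).
Hypothesis mu_sum : sumn mu = n.
Local Notation T := (mu_involution n mu).
Implicit Types (x y : T) (q : adjacent n).

Definition block_of x := string_index mu (val x).
Definition pairing_of x := partner mu (val x).

Lemma block_pairing_of x : block_pairing (block_of x) (pairing_of x).
Proof.
split; first exact/(is_mu_involutionE mu_sum)/(valP x).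
exact: string_index_partner.
Qed.

Lemma block_of_lt x a : block_of x a < size mu.
Proof.
rewrite ltnNge; apply/negP => h; have := mem_string mu_sum (val x) a (block_of x a).
by rewrite eqxx nth_default // size_strings.
Qed.

Lemma mu_involution_ext x y :
  block_of x =1 block_of y -> pairing_of x =1 pairing_of y -> x = y.
Proof. by move=> hb hp; apply/val_inj/(mu_data_inj mu_sum). Qed.

Definition mu_rank x := rank_fun (block_of x) (pairing_of x).

Definition mu_le x y : bool :=
  [forall j : 'I_(size mu), forall z : 'I_n.+1, forall w : 'I_n.+1,
    mu_rank x j z w <= mu_rank y j z w].

Lemma mu_leP x y :
  reflect (forall j z w, mu_rank x j z w <= mu_rank y j z w) (mu_le x y).
Proof.
apply: (iffP forallP) => [h j z w|h j]; last first.
  by apply/forallP => z; apply/forallP => w; apply: h.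
case: (ltnP j (size mu)) => hj; last first.
  by rewrite /mu_rank rank_fun_large // => a; apply: leq_trans (block_of_lt x a) hj.
have /forallP h1 := h (Ordinal hj).
have hz t : minn t n < n.+1 by rewrite ltnS geq_minr.
have /forallP h2 := h1 (Ordinal (hz z)).
have hh := h2 (Ordinal (hz w)).
by rewrite /mu_rank [leqLHS]rank_fun_minn [leqRHS]rank_fun_minn.
Qed.

Lemma mu_le_refl : reflexive mu_le.
Proof. by move=> x; apply/mu_leP. Qed.

Lemma mu_le_trans x y z : mu_le x y -> mu_le y z -> mu_le x z.
Proof.
by move=> /mu_leP h1 /mu_leP h2; apply/mu_leP => j a c; apply: leq_trans (h1 _ _ _) _.
Qed.

Lemma mu_le_anti x y : mu_le x y -> mu_le y x -> x = y.
Proof.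
move=> /mu_leP h1 /mu_leP h2.
have [|hb hp] := @rank_fun_inj n (block_of x) (pairing_of x) (block_of y) (pairing_of y).
  by move=> j z w; apply/eqP; rewrite eqn_leq h1 h2.
exact: mu_involution_ext.
Qed.

(** The exchange of two letters preserves the sizes of the blocks, so [mu_data_surj] realises the
    exchanged pair. The Boolean form lets [xchoose] extract the element. *)
Lemma mu_swap_exists q x : exists y : T, [forall a,
  (block_of y a == swap_blocks (block_of x) (val q).1 (val q).2 a) &&
  (pairing_of y a == swap_pairing (block_of x) (pairing_of x) (val q).1 (val q).2 a)].
Proof.
have bp := swap_block_pairing (adjacent_neq q) (block_pairing_of x).
have [|w hb hp] := mu_data_surj mu_sum bp.
  move=> j; rewrite -(card_string mu_sum (val x)).
  rewrite -[RHS](card_imset _ (@perm_inj _ (tperm (val q).1 (val q).2))).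
  apply: eq_card => a; rewrite inE; apply/eqP/imsetP => [e|[c]].
    by exists (tperm (val q).1 (val q).2 a); rewrite ?tpermK // inE; apply/eqP.
  by rewrite inE => /eqP e ->; rewrite /swap_blocks tpermK.
have hw : is_mu_involution mu w.
  by apply/(is_mu_involutionE mu_sum) => a; rewrite !hp; case: bp => ->.
exists (exist _ w hw); apply/forallP => a.
by rewrite /block_of /pairing_of /= hb hp !eqxx.
Qed.

Definition mu_swap q x : T := xchoose (mu_swap_exists q x).

Lemma block_of_swap q x :
  block_of (mu_swap q x) =1 swap_blocks (block_of x) (val q).1 (val q).2.
Proof. by move=> a; have /forallP/(_ a)/andP[/eqP] := xchooseP (mu_swap_exists q x). Qed.

Lemma pairing_of_swap q x : pairing_of (mu_swap q x) =1
  swap_pairing (block_of x) (pairing_of x) (val q).1 (val q).2.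
Proof. by move=> a; have /forallP/(_ a)/andP[_ /eqP] := xchooseP (mu_swap_exists q x). Qed.

Definition mu_asc q x := ascent (block_of x) (pairing_of x) (val q).1 (val q).2.

Lemma eq_swap_blocks (b b' : 'I_n -> nat) i i' :
  b =1 b' -> swap_blocks b i i' =1 swap_blocks b' i i'.
Proof. by move=> e a; rewrite /swap_blocks e. Qed.

Lemma eq_swap_pairing (b b' : 'I_n -> nat) p p' i i' :
  b =1 b' -> p =1 p' -> swap_pairing b p i i' =1 swap_pairing b' p' i i'.
Proof. by move=> eb ep a; rewrite /swap_pairing /swap_singular !eb !ep. Qed.

Lemma mu_swapK q : involutive (mu_swap q).
Proof.
move=> x; apply: mu_involution_ext => a.
  rewrite block_of_swap (eq_swap_blocks _ _ (block_of_swap q x)).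
  exact: swap_blockingK.
rewrite pairing_of_swap (eq_swap_pairing _ _ (block_of_swap q x) (pairing_of_swap q x)).
by apply: swap_pairingK (adjacent_neq q) (block_pairing_of x) _.
Qed.

Lemma mu_asc_swap q x : mu_asc q (mu_swap q x) = ~~ mu_asc q x.
Proof.
rewrite -(ascent_swap (adjacent_neq q) (block_pairing_of x) (adjacentP q)).
by rewrite /mu_asc /ascent !block_of_swap !pairing_of_swap.
Qed.

Lemma mu_rank_swap q x j (z w : nat) : z <> (val q).2 -> w <> (val q).2 ->
  mu_rank (mu_swap q x) j z w = mu_rank x j z w.
Proof.
move=> nz nw; have e := adjacentP q; rewrite /mu_rank /rank_fun; congr (_ + _).
  by apply: (below_tperm e nw) => a; rewrite block_of_swap /swap_blocks tpermK.
apply: (below_tperm e nz) => a.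
rewrite /corner block_of_swap pairing_of_swap /swap_blocks /swap_pairing tpermK.
congr (_ || (_ && _)).
by case: ifP => _; rewrite ?tperm_ltn.
Qed.

Lemma mu_le_fill q x y : mu_asc q x \/ ~~ mu_asc q y ->
  (forall j (z w : nat), z <> (val q).2 -> w <> (val q).2 ->
    mu_rank x j z w <= mu_rank y j z w) -> mu_le x y.
Proof.
move=> ad h; apply/mu_leP.
exact: (rank_fun_fill (block_pairing_of x) (block_pairing_of y) (adjacentP q)).
Qed.

Lemma mu_asc_le q x : mu_asc q x -> mu_le x (mu_swap q x).
Proof.
by move=> ax; apply: (@mu_le_fill q); [left | move=> *; rewrite mu_rank_swap].
Qed.

Lemma mu_lift_le q x y : mu_le x y -> mu_asc q x -> ~~ mu_asc q y ->
  mu_le x (mu_swap q y).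
Proof.
move=> /mu_leP lxy ax dy; apply: (@mu_le_fill q); first by left.
by move=> *; rewrite mu_rank_swap.
Qed.

Lemma mu_swap_le q x y : mu_le x y -> mu_asc q y -> mu_le (mu_swap q x) (mu_swap q y).
Proof.
move=> /mu_leP lxy ay; apply: (@mu_le_fill q); first by right; rewrite mu_asc_swap ay.
by move=> *; rewrite !mu_rank_swap.
Qed.

Lemma card_above x y j : #|[set a | j < block_of x a]| = #|[set a | j < block_of y a]|.
Proof.
have e x' : #|[set a | j < block_of x' a]| = \sum_(t < size mu | j < t) nth 0 mu t.
  rewrite -sum1_card (partition_big (fun a => Ordinal (block_of_lt x' a)) (fun t => j < t)) /=.
    apply: eq_bigr => t jt; rewrite -(card_string mu_sum (val x')) -sum1_card.
    apply: eq_bigl => a; rewrite !inE -val_eqE /= andbC.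
    by rewrite /block_of; case: eqP => // ->; rewrite jt.
  by move=> a; rewrite inE.
by rewrite !e.
Qed.

Lemma card_from x y j : #|[set a | j <= block_of x a]| = #|[set a | j <= block_of y a]|.
Proof.
case: j => [|j]; last exact: card_above.
by apply: eq_card => a; rewrite !inE.
Qed.

(** At the four corners the rank only counts letters by block, and [mu] fixes the block sizes. *)
Lemma mu_rank_corners x y j (z w : nat) : z \in [:: 0; n] -> w \in [:: 0; n] ->
  mu_rank x j z w = mu_rank y j z w.
Proof.
rewrite !inE => /orP[] /eqP-> /orP[] /eqP->.
- by rewrite /mu_rank /rank_fun !below0.
- by rewrite /mu_rank !rank_fun_0n; apply: card_above.
- rewrite /mu_rank !(rank_fun_sym _ n); try exact: block_pairing_of.
  by rewrite !rank_fun_0n; apply: card_above.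
by rewrite /mu_rank !rank_fun_nn (card_above x y) (card_from x y).
Qed.

(** Two passes of interpolation: from the corners to the edges [z = 0] and [z = n], by symmetry, and
    from these edges to all [z]. *)
Lemma mu_le_edges x y :
    (forall j w z, mu_rank x j 0 w <= mu_rank y j 0 w ->
      mu_rank x j n w <= mu_rank y j n w -> mu_rank x j z w <= mu_rank y j z w) ->
  mu_le x y.
Proof.
move=> h; have edge j (z w : nat) : z \in [:: 0; n] -> mu_rank x j z w <= mu_rank y j z w.
  move=> hz; have sym x' := rank_fun_sym j z w (block_pairing_of x').
  by rewrite /mu_rank !sym; apply: h; rewrite (@mu_rank_corners x y) ?inE ?eqxx ?orbT //; move: hz; rewrite !inE.
by apply/mu_leP => j z w; apply: h; apply: edge; rewrite !inE eqxx ?orbT.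
Qed.

(** With ascents everywhere the rank of [x] is convex in each variable, hence as small as the corner
    values allow. *)
Lemma mu_all_asc_le x : (forall q, mu_asc q x) -> forall y, mu_le x y.
Proof.
move=> ha y; apply: mu_le_edges => j w z.
rewrite {1 2}/mu_rank /rank_fun below0 addn0 => h0 hn.
apply: below_upclosed => //; last by move: h0; rewrite /mu_rank /rank_fun below0 addn0.
move=> i i' e; apply: ascent_corner.
exact: (ha (mk_adjacent e)).
Qed.

Lemma mu_all_desc_le x : (forall q, ~~ mu_asc q x) -> forall y, mu_le y x.
Proof.
move=> hd y; apply: mu_le_edges => j w z.
rewrite {1 2}/mu_rank /rank_fun below0 addn0 => h0 hn.
apply: below_downclosed => //; last by move: h0; rewrite /mu_rank /rank_fun below0 addn0.
move=> i i' e; apply: descent_corner; last exact: (hd (mk_adjacent e)).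
  exact: (adjacent_neq (mk_adjacent e)).
exact: block_pairing_of.
Qed.

Lemma mu_le_graded : graded mu_le [set: T].
Proof.
apply: (@lifting_graded _ _ mu_le mu_swap mu_asc).
- exact: mu_le_refl.
- exact: mu_le_anti.
- exact: mu_le_trans.
- exact: mu_swapK.
- exact: mu_asc_swap.
- exact: mu_asc_le.
- exact: mu_lift_le.
- exact: mu_all_asc_le.
- exact: mu_swap_le.
- exact: mu_all_desc_le.
Qed.

Lemma mu_le_minimal (R : T -> T -> Prop) :
    (forall x, R x x) -> (forall x y z, R x y -> R y z -> R x z) ->
    (forall q x, mu_asc q x -> R x (mu_swap q x)) ->
    (forall q x y, R x y -> mu_asc q y -> R (mu_swap q x) (mu_swap q y)) ->
  forall x y, mu_le x y -> R x y.
Proof.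
move=> h1 h2 h3 h4; apply: (le_minimal_preorder mu_le_refl mu_le_anti mu_le_trans
  mu_swapK mu_asc_swap mu_asc_le mu_lift_le mu_all_asc_le) => //.
Qed.

End MuOrder.

(** * The symmetric group *)

Section SymmetricGroup.

Variable n : nat.
Implicit Types (u v x y : 'S_n) (q : adjacent n).

(** An entry of the rank matrix, written through the inverse so that [z] bounds a letter, as in
    [rank_fun]. *)
Definition perm_rank u (z w : nat) : nat := below (fun a => (u^-1)%g a < w) z.

(** The map [phi] injects the inversions of [u] into those of [v]: it moves a pair by the
    transposition of positions when the pair stays increasing, and leaves it alone otherwise. The
    inversion [(P, Q)] of [v] is missed. *)
Lemma inversions_lt u (P Q : 'I_n) : P < Q -> u P < u Q ->
  inversions u < inversions (u * tperm (u P) (u Q))%g.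
Proof.
move=> PQ uPQ; set v := (u * _)%g; pose t := tperm P Q.
have nPQ : P != Q by apply/eqP => e; rewrite e ltnn in PQ.
have vE a : v a = u (t a).
  rewrite permM /t; case: (tpermP P Q a) => [->|->|/eqP n1 /eqP n2].
  - by rewrite tpermL.
  - by rewrite tpermR.
  by rewrite tpermD // (inj_eq perm_inj) eq_sym.
pose phi (c : 'I_n * 'I_n) := if t c.1 < t c.2 then (t c.1, t c.2) else c.
rewrite /inversions; set A := [set _ | _]; set C := [set _ | _].
have injphi : {in A &, injective phi}.
  move=> [a c] [a' c']; rewrite !inE /phi /= => /andP[ac _] /andP[ac' _].
  case: ifP => h1; case: ifP => h2 //.
  - by move=> [/perm_inj -> /perm_inj ->].
  - by move=> [e1 e2]; rewrite -e1 -e2 /t !tpermK ac in h2.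
  - by move=> [e1 e2]; rewrite e1 e2 /t !tpermK ac' in h1.
rewrite -(card_in_imset injphi); apply: proper_card; apply/properP; split.
  apply/subsetP => _ /imsetP[[a c] h ->]; move: h; rewrite inE /= => /andP[ac uca].
  rewrite inE /phi /=; case: ifP => h /=; first by rewrite h !vE /t !tpermK uca.
  rewrite ac !vE /=; move: h; rewrite /t.
  case: (tpermP P Q a) ac uca => [->|->|_ _] ac uca;
    case: (tpermP P Q c) ac uca => [->|->|_ _] ac uca; lia.
exists (P, Q); first by rewrite inE /= PQ !vE /t tpermL tpermR uPQ.
apply/negP => /imsetP[[a c]]; rewrite inE /= => /andP[ac uca]; rewrite /phi /=.
case: ifP => _ [e1 e2]; last by move: uca; rewrite -e1 -e2; lia.
by move: ac; rewrite -(tpermK P Q a) -(tpermK P Q c) -/t -e1 -e2 /t tpermL tpermR; lia.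
Qed.

Lemma perm_rank_tperm u (P Q : 'I_n) z w : P < Q -> u P < u Q ->
  perm_rank (u * tperm (u P) (u Q))%g z w <= perm_rank u z w.
Proof.
move=> PQ uPQ; have ne : u P != u Q by apply/eqP => e; rewrite e ltnn in uPQ.
have vE a : ((u * tperm (u P) (u Q))^-1 a = u^-1 (tperm (u P) (u Q) a))%g.
  by rewrite invMg permM tpermV.
rewrite /perm_rank /below ![\sum_(_ | _ < z) _]big_mkcond.
rewrite (bigD1 (u P)) // (bigD1 (u Q)) 1?eq_sym //=.
rewrite [leqRHS](bigD1 (u P)) // [X in _ <= _ + X](bigD1 (u Q)) 1?eq_sym //=.
rewrite !addnA leq_add //.
  rewrite !vE tpermL tpermR !permK; do 2 case: ifP => ?; lia.
apply: leq_sum => a /andP[n1 n2]; rewrite vE tpermD // 1?eq_sym //.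
Qed.

(** The definition only asks for more inversions. Had the exchanged values been decreasing, undoing
    the exchange would add inversions by [inversions_lt], a contradiction. *)
Lemma reflection_stepP x y : reflection_step x y ->
  exists P Q : 'I_n, [/\ P < Q, x P < x Q & y = (x * tperm (x P) (x Q))%g].
Proof.
move=> /andP[h /existsP[i /existsP[j /eqP e]]].
have [P iE] : exists P, i = x P by exists (x^-1 i)%g; rewrite permKV.
have [Q jE] : exists Q, j = x Q by exists (x^-1 j)%g; rewrite permKV.
move: e h; rewrite {}iE {}jE => -> h {i j}.
wlog lPQ : P Q h / P < Q.
  move=> wl; case: (ltngtP P Q) => [|l|/val_inj e]; first exact: wl.
  - by rewrite tpermC; apply: wl => //; rewrite tpermC.
  - by rewrite e tperm1 mulg1 ltnn in h.
case: (ltngtP (x P) (x Q)) => [l|l|/val_inj/perm_inj e]; first by exists P, Q.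
  set v := (x * _)%g in h.
  have vP : v P = x Q by rewrite permM tpermL.
  have vQ : v Q = x P by rewrite permM tpermR.
  have := @inversions_lt v P Q lPQ; rewrite vP vQ => /(_ l).
  rewrite tpermC {2}/v -mulgA tperm2 mulg1 => /(ltn_trans h).
  by rewrite ltnn.
by rewrite e ltnn in lPQ.
Qed.

Lemma reflection_step_intro x (P Q : 'I_n) : P < Q -> x P < x Q ->
  reflection_step x (x * tperm (x P) (x Q))%g.
Proof.
move=> PQ xPQ; rewrite /reflection_step inversions_lt //.
by apply/existsP; exists (x P); apply/existsP; exists (x Q).
Qed.

Definition perm_le u v : bool :=
  [forall z : 'I_n.+1, forall w : 'I_n.+1, perm_rank u z w <= perm_rank v z w].

Lemma perm_leP u v :
  reflect (forall z w, perm_rank u z w <= perm_rank v z w) (perm_le u v).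
Proof.
apply: (iffP forallP) => [h z w|h z]; last by apply/forallP => w; apply: h.
have hz t : minn t n < n.+1 by rewrite ltnS geq_minr.
have e (s : 'S_n) : perm_rank s z w = perm_rank s (minn z n) (minn w n).
  transitivity (perm_rank s (minn z n) w).
    by rewrite /perm_rank; case: (leqP z n) => h' //; rewrite below_ge // ltnW.
  apply: eq_bigr => a _; congr nat_of_bool.
  by rewrite leq_min ltn_ord andbT.
by rewrite !e; have /forallP := h (Ordinal (hz z)); move=> /(_ (Ordinal (hz w))).
Qed.

Lemma bruhat_perm_le u v : bruhat u v -> perm_le u v.
Proof.
move=> /connectP[s]; elim: s v => [|y s IH] v /=; first by move=> _ ->; apply/perm_leP.
move=> /andP[/reflection_stepP[P [Q [PQ vPQ e]]] ps lu].
have /perm_leP h := IH y ps lu; apply/perm_leP => z w.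
by apply: leq_trans (h z w) _; rewrite e; apply: perm_rank_tperm.
Qed.

Definition perm_asc q u := (u^-1)%g (val q).2 < (u^-1)%g (val q).1.
Definition perm_swap q u := (u * tperm (val q).1 (val q).2)%g.

Lemma perm_swapV q u a : ((perm_swap q u)^-1 a = u^-1 (tperm (val q).1 (val q).2 a))%g.
Proof. by rewrite invMg permM tpermV. Qed.

Lemma perm_swapK q : involutive (perm_swap q).
Proof. by move=> u; rewrite /perm_swap -mulgA tperm2 mulg1. Qed.

Lemma perm_asc_swap q u : perm_asc q (perm_swap q u) = ~~ perm_asc q u.
Proof.
rewrite /perm_asc !perm_swapV tpermL tpermR.
have ne : (u^-1)%g (val q).1 <> (u^-1)%g (val q).2 :> nat.
  by move=> /val_inj/perm_inj/eqP; apply/negP/adjacent_neq.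
by apply/idP/idP; lia.
Qed.

Lemma perm_rank_swap q u (z w : nat) : z <> (val q).2 ->
  perm_rank (perm_swap q u) z w = perm_rank u z w.
Proof.
move=> nz; apply: (below_tperm (adjacentP q) nz) => a.
by rewrite perm_swapV tpermK.
Qed.

Lemma perm_le_fill q x y : perm_asc q x \/ ~~ perm_asc q y ->
  (forall z w : nat, z <> (val q).2 -> perm_rank x z w <= perm_rank y z w) ->
  perm_le x y.
Proof.
move=> ad h; apply/perm_leP => z w; rewrite -[leqLHS]add0n -[leqRHS]add0n.
apply: (below_fill (adjacentP q)) => [|z' nz]; last exact: h.
case: ad => h'; [left|right]; first exact: ltn_trans.
by apply: leq_ltn_trans; rewrite leqNgt.
Qed.

Lemma bruhat_trans x y z : bruhat x y -> bruhat y z -> bruhat x z.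
Proof. by move=> h1 h2; apply: connect_trans h2 h1. Qed.

Lemma bruhat_asc q x : perm_asc q x -> bruhat x (perm_swap q x).
Proof.
move=> ax; apply: connect1; set y := perm_swap q x.
have y1 : y ((x^-1)%g (val q).2) = (val q).1 by rewrite permM permKV tpermR.
have y2 : y ((x^-1)%g (val q).1) = (val q).2 by rewrite permM permKV tpermL.
have := @reflection_step_intro y _ _ ax; rewrite y1 y2 adjacentP ltnSn => /(_ isT).
by rewrite -/(perm_swap q y) perm_swapK.
Qed.

(** The [bruhat]-smaller of [u] and [perm_swap q u]; applying [perm_swap q] to it gives the larger
    one. *)
Definition perm_lower q u := if perm_asc q u then u else perm_swap q u.


Lemma perm_upper_ge q u : bruhat u (perm_swap q (perm_lower q u)).
Proof.
rewrite /perm_lower; case: ifP => [|/negbT d]; first exact: bruhat_asc.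
by rewrite perm_swapK; apply: connect0.
Qed.

Lemma perm_swap_upper q u :
  bruhat (perm_swap q u) (perm_swap q (perm_lower q u)).
Proof.
rewrite /perm_lower; case: ifP => [_|/negbT d]; first exact: connect0.
by rewrite perm_swapK -{2}(perm_swapK q u); apply: bruhat_asc; rewrite perm_asc_swap.
Qed.

(** Conjugation by the simple transposition sends the reflection to a reflection, and keeps the
    order of the exchanged values unless these are the two adjacent letters themselves. *)
Lemma reflection_step_swap q x y : reflection_step x y ->
  y = perm_swap q x \/ reflection_step (perm_swap q x) (perm_swap q y).
Proof.
move=> /reflection_stepP[P [Q [PQ xPQ ->]]]; set s := tperm (val q).1 (val q).2.
have e1 c : perm_swap q x c = s (x c) by rewrite permM.
have [l|l] := ltnP (s (x P)) (s (x Q)); [right | left].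
  have -> : perm_swap q (x * tperm (x P) (x Q))%g =
    (perm_swap q x * tperm (perm_swap q x P) (perm_swap q x Q))%g.
    rewrite !e1 /perm_swap -/s -!mulgA; congr (_ * _)%g.
    by rewrite conjgC tpermJ.
  by apply: reflection_step_intro; rewrite ?e1.
have gen (c d : 'I_n) : c < d -> s d <= s c -> c = (val q).1 /\ d = (val q).2.
  have := adjacentP q; rewrite /s; move: (val q).1 (val q).2 => i i' e cd h.
  split; apply/val_inj; move: cd h; rewrite !tperm_val;
  case: (c =P i :> nat); case: (c =P i' :> nat); case: (d =P i :> nat);
  case: (d =P i' :> nat); move=> * /=; lia.
by have [-> ->] := gen _ _ xPQ l.
Qed.

(** One reflection step at a time: either it is the exchange itself, and the larger member of the
    pair does not change, or the exchanged permutations again form a step. *)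
Lemma bruhat_lower q u v : bruhat u v ->
  bruhat (perm_swap q (perm_lower q u)) (perm_swap q (perm_lower q v)).
Proof.
move=> /connectP[s]; elim: s v => [|y s IH] v /=; first by move=> _ ->; apply: connect0.
move=> /andP[st ps lu]; apply: bruhat_trans (IH y ps lu) _.
have lvy : bruhat y v by apply: connect1.
have [e|st'] := reflection_step_swap q st.
  suff -> : perm_lower q y = perm_lower q v by apply: connect0.
  by rewrite e /perm_lower perm_asc_swap perm_swapK; case: perm_asc.
have lvy' : bruhat (perm_swap q y) (perm_swap q v) by apply: connect1.
rewrite {1}/perm_lower; case: ifP => _.
  by apply: bruhat_trans lvy' _; apply: perm_swap_upper.
by rewrite perm_swapK; apply: bruhat_trans lvy _; apply: perm_upper_ge.
Qed.

Lemma bruhat_swap q u v : bruhat u v -> perm_asc q v ->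
  bruhat (perm_swap q u) (perm_swap q v).
Proof.
move=> huv av; apply: bruhat_trans (perm_swap_upper q u) _.
by have := bruhat_lower q huv; rewrite {2}/perm_lower av.
Qed.

Lemma perm_le_anti u v : perm_le u v -> perm_le v u -> u = v.
Proof.
move=> /perm_leP h1 /perm_leP h2.
have e z w : perm_rank u z w = perm_rank v z w by apply/eqP; rewrite eqn_leq h1 h2.
apply: (can_inj invgK); apply/permP => a; apply/val_inj/eqP.
have hw w : ((u^-1)%g a < w) = ((v^-1)%g a < w).
  have := e a.+1 w; have := e a w; rewrite /perm_rank !belowS => -> /addnI.
  by do 2 case: (_ < w).
by rewrite eqn_leq -ltnS hw ltnSn -ltnS -hw ltnSn.
Qed.

Lemma perm_rank_full u w : perm_rank u n w = below (fun a : 'I_n => a < w) n.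
Proof.
rewrite /perm_rank /below (reindex_inj (@perm_inj _ u)).
by apply: eq_big => [a|a _]; rewrite ?ltn_ord ?permK.
Qed.

(** The converse of [bruhat_perm_le] is the minimality of a lifting order among compatible
    preorders, with [bruhat] as the preorder; compatibility is [bruhat_swap]. *)
Theorem bruhatE u v : bruhat u v = perm_le u v.
Proof.
apply/idP/idP; first exact: bruhat_perm_le.
move: u v; apply: (@le_minimal_preorder _ _ perm_le perm_swap perm_asc
  _ _ _ _ _ _ _ _ (fun u v => bruhat u v)).
- by move=> x; apply/perm_leP.
- exact: perm_le_anti.
- by move=> x y z /perm_leP h1 /perm_leP h2; apply/perm_leP => i j; apply: leq_trans (h1 _ _) _.
- exact: perm_swapK.
- exact: perm_asc_swap.
- by move=> q x ax; apply: (@perm_le_fill q); [left | move=> *; rewrite perm_rank_swap].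
- move=> q x y /perm_leP lxy ax dy; apply: (@perm_le_fill q); first by left.
  by move=> *; rewrite perm_rank_swap.
- move=> x ha y; apply/perm_leP => z w; rewrite -[leqLHS]add0n -[leqRHS]add0n.
  apply: below_upclosed => //; last by have := perm_rank_full x w; rewrite /perm_rank => ->;
    have := perm_rank_full y w; rewrite /perm_rank => ->.
  by move=> i i' e; apply: ltn_trans; apply: (ha (mk_adjacent e)).
- by move=> x; apply: connect0.
- exact: bruhat_trans.
- exact: bruhat_asc.
- exact: bruhat_swap.
Qed.

End SymmetricGroup.

(** The only block has index 0, so the rank vanishes for [j > 0]; at [j = 0] the pairing is the
    permutation, which equals its inverse. *)
Lemma mu_le_bruhat (n : nat) (x y : mu_involution n [:: n]) :
  mu_le x y = bruhat (val x) (val y).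
Proof.
have hs : sumn [:: n] = n by rewrite /= addn0.
have rE (t : mu_involution n [:: n]) z w : mu_rank t 0 z w = perm_rank (val t) z w.
  rewrite /mu_rank /rank_fun below_false => [|a _]; last first.
    by rewrite /block_of string_index_nil.
  apply: eq_bigr => a _; congr nat_of_bool.
  rewrite /corner /block_of /pairing_of string_index_nil /= partner_whole.
  have /is_mu_involution_whole tK := valP t.
  by congr (nat_of_ord _ < w); apply: (@perm_inj _ (val t)); rewrite permKV tK.
rewrite bruhatE; apply/(mu_leP hs)/perm_leP => h; first by move=> z w; rewrite -!rE.
case=> [|j] z w; first by rewrite !rE.
by rewrite /mu_rank rank_fun_large // => a; rewrite /block_of string_index_nil.
Qed.

(** * The poset of (3,1)-involutions *)

Section Words.

Variable n : nat.
Implicit Types (w u v : 'S_n).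

(** Letters start at 0. Order and involution tests on such words are closed Boolean computations. *)
Definition word w : seq nat := [seq val a | a <- codom w].

Lemma size_word w : size (word w) = n.
Proof. by rewrite size_map size_codom card_ord. Qed.

Lemma word_inj : injective word.
Proof.
move=> u v /(inj_map val_inj) e; apply/permP => a.
by move/eq_in_map: e; apply; rewrite mem_enum.
Qed.

Lemma word_perm_eq w : perm_eq (word w) (iota 0 n).
Proof.
rewrite /word -val_enum_ord; apply: perm_map; apply: uniq_perm.
- exact: perm_codom_uniq.
- exact: enum_uniq.
by move=> a; rewrite mem_enum perm_codom_mem.
Qed.

Lemma word_exists (l : seq nat) : perm_eq l (iota 0 n) -> exists w, word w = l.
Proof.
move=> hl; have sl : size l = n by rewrite (perm_size hl) size_iota.
have ul : uniq l by rewrite (perm_uniq hl) iota_uniq.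
have lt (a : 'I_n) : nth 0 l a < n.
  have : nth 0 l a \in iota 0 n by rewrite -(perm_mem hl) mem_nth // sl.
  by rewrite mem_iota.
have finj : injective (fun a => Ordinal (lt a)).
  by move=> a c /(congr1 val)/eqP /=; rewrite nth_uniq ?sl // => /eqP/val_inj.
exists (perm finj); apply: (@eq_from_nth _ 0); rewrite size_word // => i hi.
rewrite (nth_map (Ordinal hi)) ?size_codom ?card_ord //.
rewrite (nth_map (Ordinal hi)) ?size_enum_ord // permE /=.
by rewrite nth_enum_ord.
Qed.

Definition word_rank (s : seq nat) (z w : nat) : nat := count (fun c => c < z) (take w s).

Lemma word_rankE u (z w : nat) : w <= n -> perm_rank u z w = word_rank (word u) z w.
Proof.
move=> wn; rewrite /perm_rank /below (reindex_inj (@perm_inj _ u)).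
rewrite (eq_bigr (fun a : 'I_n => (a < w : nat))); last by move=> a _; rewrite permK.
rewrite -big_mkcondr /= sum1dep_card card_ord_filter (size_filter _ (enum 'I_n)).
rewrite /word_rank /word -map_take [RHS]count_map.
have -> : take w (codom u) = map u (filter (fun a : 'I_n => a < w) (enum 'I_n)).
  rewrite -map_take; congr map; apply: (inj_map val_inj); rewrite map_take val_enum_ord.
  rewrite take_iota (minn_idPl wn) -[in RHS](filter_map val (fun a => a < w)) val_enum_ord.
  rewrite -(subnKC wn) iotaD filter_cat add0n.
  rewrite (eq_in_filter (a2 := predT)) ?filter_predT => [|c]; last by rewrite mem_iota.
  rewrite (eq_in_filter (a2 := pred0)) ?filter_pred0 ?cats0 // => c.
  by rewrite mem_iota /=; lia.
by rewrite [RHS]count_map [RHS]count_filter; apply: eq_count => a /=; rewrite andbC.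
Qed.

Definition word_le (s t : seq nat) : bool :=
  all (fun z => all (fun r => word_rank s z r <= word_rank t z r) (iota 0 n.+1)) (iota 0 n.+1).

Lemma bruhat_word u v : bruhat u v = word_le (word u) (word v).
Proof.
rewrite bruhatE; apply/idP/allP => [/perm_leP h z _|h].
  apply/allP => w; rewrite mem_iota add0n ltnS => /= wn.
  by rewrite -!word_rankE.
apply/forallP => z; apply/forallP => w.
have /h/allP/(_ w) : val z \in iota 0 n.+1 by rewrite mem_iota ltn_ord.
by rewrite mem_iota ltn_ord /= -!word_rankE ?leq_ord //; apply.
Qed.

Definition read_word (s : seq nat) (a : nat) : nat :=
  nth a s (index a [seq c <- iota 0 n | c \in s]).

Lemma read_wordE (s : seq 'I_n) a : val (read_string s a) = read_word (map val s) (val a).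
Proof.
rewrite /read_word -val_enum_ord filter_map (eq_filter (a2 := fun c => c \in s)); last first.
  by move=> c; rewrite /= mem_map //; apply: val_inj.
rewrite index_map; last exact: val_inj.
rewrite /read_string -/(alphabet s).
case: (ltnP (index a (alphabet s)) (size s)) => h; last by rewrite !nth_default ?size_map.
by rewrite (nth_map a).
Qed.

Definition word_involution (mu l : seq nat) : bool :=
  all (fun s => all (fun a => read_word s (read_word s a) == a) (iota 0 n)) (reshape mu l).

Lemma map_reshape (A B : Type) (f : A -> B) (sh : seq nat) (s : seq A) :
  reshape sh (map f s) = map (map f) (reshape sh s).
Proof. by elim: sh s => //= m sh IH s; rewrite map_take -map_drop IH. Qed.

Lemma is_mu_involution_word mu w :
  is_mu_involution mu w = word_involution mu (word w).
Proof.
rewrite /is_mu_involution /word_involution /word map_reshape all_map.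
apply: eq_all => s /=; rewrite -val_enum_ord all_map.
apply/forallP/allP => [h a _|h a] /=; first by rewrite -!read_wordE (eqP (h a)).
by have := h a (mem_enum _ _); rewrite /= -!read_wordE.
Qed.

Lemma letters_word mu w : letters mu w = reshape mu (map S (word w)).
Proof.
rewrite /letters /word -map_comp map_reshape; apply: eq_map => s.
by apply: eq_map.
Qed.

Variable mu : seq nat.
Local Notation T := (mu_involution n mu).

Definition words : seq (seq nat) :=
  [seq l <- permutations (iota 0 n) | word_involution mu l].

Lemma mem_words (x : T) : word (val x) \in words.
Proof.
rewrite mem_filter mem_permutations word_perm_eq andbT.
by rewrite -is_mu_involution_word; apply: valP x.
Qed.

Lemma words_exist l : l \in words -> exists x : T, word (val x) = l.
Proof.
rewrite mem_filter mem_permutations => /andP[hl /word_exists[w hw]].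
have hi : is_mu_involution mu w by rewrite is_mu_involution_word hw.
by exists (exist _ w hi).
Qed.

(** Maximality becomes a finite test: every word of the poset that satisfies [P] and is comparable
    with all of [c] already lies in [c]. The predicate [P] cuts out an interval. *)
Lemma maximal_chain_words (P : pred (seq nat)) (c : seq (seq nat)) :
  uniq c -> all (fun l => (l \in words) && P l) c ->
  all (fun l => all (fun l' => word_le l l' || word_le l' l) c) c ->
  all (fun l => P l ==> all (fun l' => word_le l l' || word_le l' l) c ==> (l \in c)) words ->
  exists C : {set T}, maximal_chain (@induced_bruhat n mu) [set x | P (word (val x))] C /\
    #|C| = size c.
Proof.
move=> uc /allP cP /allP cc /allP cmax; pose C : {set T} := [set x | word (val x) \in c].
have inj : injective (fun x : T => word (val x)) by move=> x y /word_inj/val_inj.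
have cmp (x y : T) : induced_bruhat x y <-> word_le (word (val x)) (word (val y)).
  by rewrite /induced_bruhat bruhat_word.
exists C; split; last first.
  rewrite cardE -(size_map (fun x : T => word (val x))); apply/perm_size/uniq_perm => //.
    by rewrite map_inj_uniq ?enum_uniq.
  move=> l; apply/mapP/idP => [[x]|lc]; first by rewrite mem_enum inE => xc ->.
  have /andP[/words_exist[x xl] _] := cP l lc.
  by exists x; rewrite // mem_enum inE xl.
split.
- by apply/subsetP => x; rewrite !inE => /cP/andP[].
- move=> x y; rewrite !inE => /cc/allP h /h /orP[] h'; [left|right]; exact/cmp.
move=> D DA cD CD; apply/eqP; rewrite eqEsubset CD andbT; apply/subsetP => x xD.
rewrite inE; have := cmax _ (mem_words x).
have -> : P (word (val x)) by have := subsetP DA x xD; rewrite inE.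
rewrite implyTb => /implyP; apply; apply/allP => l lc.
have /andP[/words_exist[y yl] _] := cP l lc.
have yD : y \in D by apply: (subsetP CD); rewrite inE yl.
by rewrite -yl; case: (cD x y xD yD) => /cmp ->; rewrite ?orbT.
Qed.

End Words.

Lemma order_isomorphic_graded (T U : finType) (R : T -> T -> Prop) (R' : U -> U -> Prop) :
  order_isomorphic R R' -> graded R [set: T] -> graded R' [set: U].
Proof.
move=> [f [g fK gK] fR] gR C D mC mD.
have finj := can_inj fK.
have pre (E : {set U}) : maximal_chain R' [set: U] E -> maximal_chain R [set: T] (f @^-1: E).
  move=> [_ cE mE]; split=> [||F _ cF sF]; first exact: subsetT.
    move=> x y; rewrite !inE => xE yE.
    by case: (cE _ _ xE yE) => h; [left|right]; apply/fR.
  have e : f @: F = E.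
    apply: mE; first exact: subsetT.
      move=> _ _ /imsetP[x xF ->] /imsetP[y yF ->].
      by case: (cF x y xF yF) => h; [left|right]; apply/fR.
    apply/subsetP => y yE; rewrite -(gK y); apply: imset_f; apply: (subsetP sF).
    by rewrite inE gK.
  by apply/setP => x; rewrite inE -e mem_imset.
have card (E : {set U}) : #|f @^-1: E| = #|E|.
  by rewrite -(card_imset _ finj); apply: eq_card => y; rewrite -{1}(gK y) mem_imset // inE gK.
by rewrite -(card C) -(card D); apply: gR; apply: pre.
Qed.

Section ThreeOne.

Local Notation T31 := (mu_involution 4 [:: 3; 1]).
Local Notation le31 := (@induced_bruhat 4 [:: 3; 1]).

Lemma induced_31_not_graded : ~ graded le31 [set: T31].
Proof.
move=> gr; have e : [set: T31] = [set x : T31 | predT (word (val x))].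
  by apply/setP => x; rewrite !inE.
(* Both chains run from [[432|1]] to [[123|4]]; this one has six elements, the next one five. *)
have [||||C [mC cC]] := @maximal_chain_words 4 [:: 3; 1] predT
  [:: [:: 3; 2; 1; 0]; [:: 1; 3; 2; 0]; [:: 0; 3; 2; 1]; [:: 0; 2; 3; 1];
      [:: 0; 1; 3; 2]; [:: 0; 1; 2; 3]]; [by vm_compute.. |].
have [||||D [mD cD]] := @maximal_chain_words 4 [:: 3; 1] predT
  [:: [:: 3; 2; 1; 0]; [:: 2; 1; 3; 0]; [:: 2; 1; 0; 3]; [:: 0; 2; 1; 3]; [:: 0; 1; 2; 3]];
  [by vm_compute.. |].
by have := gr C D; rewrite e cC cD => /(_ mC mD).
Qed.

Lemma interval_31_not_graded (x y : T31) :
  word (val x) = [:: 3; 2; 1; 0] -> word (val y) = [:: 2; 1; 0; 3] ->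
  ~ graded le31 (bruhat_interval x y).
Proof.
move=> hx hy gr.
pose P l := word_le 4 [:: 3; 2; 1; 0] l && word_le 4 l [:: 2; 1; 0; 3].
have e : bruhat_interval x y = [set z : T31 | P (word (val z))].
  by apply/setP => z; rewrite !inE !bruhat_word hx hy.
(* Three elements through [[324|1]], against four through [[431|2]] and [[421|3]]. *)
have [||||C [mC cC]] := @maximal_chain_words 4 [:: 3; 1] P
  [:: [:: 3; 2; 1; 0]; [:: 2; 1; 3; 0]; [:: 2; 1; 0; 3]]; [by vm_compute.. |].
have [||||D [mD cD]] := @maximal_chain_words 4 [:: 3; 1] P
  [:: [:: 3; 2; 1; 0]; [:: 3; 2; 0; 1]; [:: 3; 1; 0; 2]; [:: 2; 1; 0; 3]]; [by vm_compute.. |].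
by have := gr C D; rewrite e cC cD => /(_ mC mD).
Qed.

End ThreeOne.

Local Open Scope ring_scope.

(** * Minors *)

Section Minors.

Variables (k : fieldType) (n : nat).
Implicit Types (A B : 'M[k]_n) (I J K : {set 'I_n}).

(** A common default [x0] and a free size [r] put rows and columns on the same footing. *)
Lemma minorE (x0 : 'I_n) (r : nat) A I J : #|I| = r -> #|J| = r ->
  minor A I J = \det (\matrix_(a < r, b < r) A (nth x0 (enum I) a) (nth x0 (enum J) b)).
Proof.
move=> hI hJ; subst r; congr (\det _); apply/matrixP => a b; rewrite !mxE.
rewrite (enum_val_nth x0); congr (A _ _); apply: set_nth_default.
by rewrite -cardE hJ.
Qed.

Lemma minor_set0 A J : minor A set0 J = 1.
Proof.
have det0 r (M : 'M[k]_r) : r = 0%N -> \det M = 1 by move=> r0; subst r; apply: det_mx00.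
by apply: det0; rewrite cards0.
Qed.

Lemma det_neq0_perm r (M : 'M[k]_r) : \det M != 0 -> exists s : 'S_r, forall a, M a (s a) != 0.
Proof.
move=> h; case: (pickP (fun s : 'S_r => [forall a, M a (s a) != 0])) => [s /forallP hs|hn].
  by exists s.
case/negP: h; apply/eqP; rewrite /determinant big1 // => s _.
have /negbT/forallPn[a /negPn/eqP ha] := hn s.
by rewrite (bigD1 a) //= ha mul0r mulr0.
Qed.

(** Turns a term of the Leibniz expansion into a bijection from [I] onto [J], the form in which the
    support of a minor is used. *)
Lemma perm_enum_fun (x0 : 'I_n) I J (s : 'S_#|I|) : #|I| = #|J| ->
  exists f : 'I_n -> 'I_n, [/\ {in I &, injective f}, f @: I = J &
    forall a : 'I_#|I|, f (nth x0 (enum I) a) = nth x0 (enum J) (s a)].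
Proof.
move=> hIJ.
have idx a : a \in I -> (index a (enum I) < #|I|)%N.
  by move=> aI; rewrite cardE index_mem mem_enum.
pose f (a : 'I_n) :=
  if insub (index a (enum I)) is Some r then nth x0 (enum J) (s (r : 'I_#|I|)) else a.
have fE a (aI : a \in I) : f a = nth x0 (enum J) (s (Ordinal (idx a aI))).
  by rewrite /f insubT ?idx // => h; congr (nth _ _ (s _)); apply: val_inj.
have szJ (r : 'I_#|I|) : (r < size (enum J))%N by rewrite -cardE -hIJ.
have finj : {in I &, injective f}.
  move=> a c aI cI; rewrite !fE => /eqP; rewrite nth_uniq ?enum_uniq //.
  move=> /eqP/val_inj/perm_inj/(congr1 val) /= h.
  by rewrite -(nth_index x0 (_ : a \in enum I)) ?mem_enum // h nth_index ?mem_enum.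
exists f; split=> //.
  apply/eqP; rewrite eqEcard card_in_imset // hIJ leqnn andbT.
  by apply/subsetP => _ /imsetP[a aI ->]; rewrite fE -mem_enum mem_nth.
move=> a; have aI : nth x0 (enum I) a \in I by rewrite -mem_enum mem_nth // -cardE.
rewrite fE; congr (nth _ _ (s _)); apply: val_inj.
by rewrite /= index_uniq ?enum_uniq // -cardE.
Qed.

Lemma minor_neq0 A I J : #|I| = #|J| -> minor A I J != 0 ->
  exists f : 'I_n -> 'I_n,
    [/\ {in I &, injective f}, f @: I = J & forall a, a \in I -> A a (f a) != 0].
Proof.
have [->|[x0 Ix0]] := set_0Vmem I.
  rewrite cards0 => /esym/eqP; rewrite cards_eq0 => /eqP -> _.
  by exists id; split=> [a c||a]; rewrite ?inE // imset0.
move=> hIJ; rewrite (@minorE x0 #|I|) // => /det_neq0_perm[s hs].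
have [f [finj fIJ hf]] := perm_enum_fun x0 s hIJ; exists f; split=> // a aI.
have ia : (index a (enum I) < #|I|)%N by rewrite cardE index_mem mem_enum.
have := hs (Ordinal ia); rewrite mxE -hf /= nth_index // mem_enum.
exact: aI.
Qed.

(** The expansions agree term by term: a term contains a zero of [A], hence of [A0], or runs over a
    transversal on which the two matrices coincide. *)
Lemma minor_congr A A0 I J : #|I| = #|J| ->
  (forall a c, A a c = 0 -> A0 a c = 0) ->
  (forall f : 'I_n -> 'I_n, {in I &, injective f} -> f @: I = J ->
    (forall a, a \in I -> A a (f a) != 0) -> forall a, a \in I -> A0 a (f a) = A a (f a)) ->
  minor A I J = minor A0 I J.
Proof.
move=> hIJ h0 hf; have [->|[x0 Ix0]] := set_0Vmem I; first by rewrite !minor_set0.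
rewrite !(@minorE x0 #|I|) //; apply: eq_bigr => s _; congr (_ * _).
have [f [finj fIJ fE]] := perm_enum_fun x0 s hIJ.
have inI (a : 'I_#|I|) : nth x0 (enum I) a \in I by rewrite -mem_enum mem_nth // -cardE.
have [/forallP nz|/forallPn[a]] := boolP [forall a : 'I_n, (a \in I) ==> (A a (f a) != 0)].
  apply: eq_bigr => a _; rewrite !mxE -fE (hf f) // => c cI.
  by have := nz c; rewrite cI.
rewrite negb_imply negbK => /andP[aI /eqP Aa].
have ia : (index a (enum I) < #|I|)%N by rewrite cardE index_mem mem_enum.
have ea : nth x0 (enum I) (Ordinal ia) = a by rewrite /= nth_index // mem_enum.
rewrite (bigD1 (Ordinal ia)) //= [RHS](bigD1 (Ordinal ia)) //=.
by rewrite !mxE -fE ea Aa h0 // !mul0r.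
Qed.

(** The expansion is a sum over all maps [h] from the rows to ['I_n]. A non-injective [h] gives a
    determinant with two equal rows; the injective ones are grouped by their image [K], whose
    enumerations are indexed by permutations. *)
Lemma cauchy_binet A B I J : #|I| = #|J| ->
  minor (A *m B) I J = \sum_(K : {set 'I_n} | #|K| == #|I|) minor A I K * minor B K J.
Proof.
move=> hIJ; have [I0|[x0 Ix0]] := set_0Vmem I.
  rewrite I0 minor_set0 cards0 (big_pred1 set0) ?minor_set0 ?mulr1 //.
  by move=> K; rewrite cards_eq0.
set r := #|I|; have hJ : #|J| = r by [].
pose e K a := nth x0 (enum K) a.
rewrite (@minorE x0 r) //.
have sum1 : \det (\matrix_(a < r, b < r) (A *m B) (e I a) (e J b)) =
  \sum_(h : {ffun 'I_r -> 'I_n}) (\prod_(a < r) A (e I a) (h a)) *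
     \det (\matrix_(a < r, b < r) B (h a) (e J b)).
  transitivity (\sum_(s : 'S_r) \sum_(h : {ffun 'I_r -> 'I_n})
      (-1) ^+ s * \prod_(a < r) (A (e I a) (h a) * B (h a) (e J (s a)))).
    apply: eq_bigr => s _; rewrite -big_distrr /=
      -(bigA_distr_bigA (fun (a : 'I_r) c => A (e I a) c * B c (e J (s a)))); congr (_ * _).
    by apply: eq_bigr => a _; rewrite !mxE.
  rewrite exchange_big; apply: eq_bigr => h _; rewrite big_distrr; apply: eq_bigr => s _ /=.
  rewrite big_split mulrCA; congr (_ * (_ * _)).
  by apply: eq_bigr => a _; rewrite mxE.
rewrite {}sum1 (bigID (fun h : {ffun 'I_r -> 'I_n} => injectiveb h)) /= addrC big1 ?add0r.
  rewrite (partition_big (fun h : {ffun 'I_r -> 'I_n} => h @: setT)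
    (fun K => #|K| == r)) /=; last first.
    by move=> h /injectiveP hinj; rewrite card_imset // cardsT card_ord.
  apply: eq_bigr => K /eqP hK.
  have eK (a : 'I_r) : e K a \in K by rewrite -mem_enum mem_nth // -cardE hK.
  have eKi : injective (fun a : 'I_r => e K a).
    by move=> a c /eqP; rewrite nth_uniq ?enum_uniq -?cardE ?hK // => /eqP/val_inj.
  pose h0 (s : 'S_r) := [ffun a => e K (s a)].
  have h0inj : {in [set: 'S_r] &, injective h0}.
    by move=> s s' _ _ /ffunP h; apply/permP => a; have := h a; rewrite !ffunE => /eKi.
  rewrite (eq_bigl (fun h => h \in h0 @: [set: 'S_r])) => [|h]; last first.
    apply/andP/imsetP => [[/injectiveP hinj /eqP hK']|[s _ ->]].
      have hin a : h a \in enum K by rewrite mem_enum -hK' imset_f.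
      have idx a : (index (h a) (enum K) < r)%N.
        by have := hin a; rewrite -index_mem -cardE hK.
      have ginj : injective (fun a => Ordinal (idx a)).
        by move=> a c /(congr1 (e K \o val)); rewrite /e /= !nth_index // => /hinj.
      exists (perm ginj); first by rewrite inE.
      by apply/ffunP => a; rewrite ffunE permE /e /= nth_index.
    split; first by apply/injectiveP => a c; rewrite !ffunE => /eKi/perm_inj.
    rewrite eqEcard card_imset => [|a c]; last by rewrite !ffunE => /eKi/perm_inj.
    rewrite cardsT card_ord hK leqnn andbT; apply/subsetP => _ /imsetP[a _ ->].
    by rewrite ffunE.
  rewrite big_imset //= (@minorE x0 r A) // (@minorE x0 r B) // big_distrl /=.
  rewrite (eq_bigl xpredT) => [|s]; last by rewrite inE.
  apply: eq_bigr => s _; rewrite -mulrA [in RHS]mulrCA; congr (_ * _).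
    by apply: eq_bigr => a _; rewrite mxE ffunE.
  rewrite -det_perm -det_mulmx -row_permE; congr (\det _).
  by apply/matrixP => a b; rewrite !mxE ffunE.
move=> h /injectivePn[a [c nac hac]].
by rewrite (determinant_alternate nac) ?mulr0 // => b; rewrite !mxE hac.
Qed.
End Minors.

Section MoreMinors.

Variables (k : fieldType) (n : nat).
Implicit Types (A B : 'M[k]_n) (I J K : {set 'I_n}).

Lemma minor_tr A I J : #|I| = #|J| -> minor A^T J I = minor A I J.
Proof.
move=> hIJ; have [I0|[x0 _]] := set_0Vmem I.
  have J0 : J = set0 by apply/eqP; rewrite -cards_eq0 -hIJ I0 cards0.
  by rewrite I0 J0 !minor_set0.
rewrite (@minorE _ _ x0 #|I|) // (@minorE _ _ x0 #|I|) // -det_tr; congr (\det _).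
by apply/matrixP => a b; rewrite !mxE.
Qed.

Lemma minorZ c A I J : minor (c *: A) I J = c ^+ #|I| * minor A I J.
Proof. by rewrite /minor -detZ; congr (\det _); apply/matrixP => a b; rewrite !mxE. Qed.

Lemma minor1 I J : #|I| = #|J| -> minor (1%:M : 'M[k]_n) I J = (I == J)%:R.
Proof.
move=> hIJ; case: eqVneq => [<-|/eqP nIJ]; last first.
  apply/eqP/negPn/negP => /(minor_neq0 hIJ)[f [_ fI hf]]; apply: nIJ.
  rewrite -fI -[LHS]imset_id; apply: eq_in_imset => a /hf.
  by rewrite mxE; apply: contra_neq_eq => h; rewrite (negbTE h).
have [->|[x0 _]] := set_0Vmem I; first by rewrite minor_set0.
rewrite (@minorE _ _ x0 #|I|) // -[RHS](det1 k #|I|); congr (\det _).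
by apply/matrixP => a b; rewrite !mxE nth_uniq ?enum_uniq // -cardE.
Qed.

Lemma minor_monomial A (p : 'I_n -> 'I_n) I : injective p ->
  (forall a b, (A a b != 0) = (b == p a)) -> minor A I (p @: I) != 0.
Proof.
move=> pinj hA; have [->|[x0 _]] := set_0Vmem I; first by rewrite minor_set0 oner_neq0.
have hpI : #|p @: I| = #|I| by rewrite card_imset.
rewrite (@minorE _ _ x0 #|I|) //.
pose e K := nth x0 (enum K).
have inK K (a : 'I_#|K|) : e K a \in K by rewrite -mem_enum mem_nth // -cardE.
have hin (a : 'I_#|I|) : p (e I a) \in enum (p @: I) by rewrite mem_enum imset_f.
have idx (a : 'I_#|I|) : (index (p (e I a)) (enum (p @: I)) < #|I|)%N.
  by have := hin a; rewrite -index_mem -cardE hpI.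
have e1 a : e (p @: I) (Ordinal (idx a)) = p (e I a) by apply: nth_index.
have tinj : injective (fun a => Ordinal (idx a)).
  move=> a c /(congr1 (e (p @: I) \o val)) /=; rewrite !e1 => /pinj/eqP.
  by rewrite nth_uniq ?enum_uniq -?cardE // => /eqP/val_inj.
pose d := \row_(a < #|I|) A (e I a) (p (e I a)).
have -> : \matrix_(a < #|I|, b < #|I|) A (e I a) (e (p @: I) b) =
    diag_mx d *m perm_mx (perm tinj).
  apply/matrixP => a b; rewrite mul_diag_mx !mxE permE.
  case: eqVneq => [<-|nb]; first by rewrite e1 mulr1.
  rewrite mulr0; apply/eqP/negPn; rewrite hA -e1 /e nth_uniq ?enum_uniq -?cardE ?hpI //=; last exact: idx.
  by rewrite eq_sym; apply: contra nb => /eqP e2; apply/eqP/val_inj.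
rewrite det_mulmx det_diag det_perm mulf_neq0 ?signr_eq0 //.
by apply/prodf_neq0 => a _; rewrite mxE hA.
Qed.

Lemma minor_monomial_eq A (p : 'I_n -> 'I_n) I J : #|I| = #|J| ->
  (forall a b, A a b != 0 -> b = p a) -> minor A I J != 0 -> J = p @: I.
Proof.
move=> hIJ hA /(minor_neq0 hIJ)[f [_ <- hf]].
by apply: eq_in_imset => a /hf/hA.
Qed.

Definition upper A := forall i j : 'I_n, (j < i)%N -> A i j = 0.

(** A nonzero term of the minor is a bijection with [a <= f a]; the counts express the resulting
    Gale comparison. *)
Lemma minor_upper A I J (z : nat) : upper A -> #|I| = #|J| -> minor A I J != 0 ->
  (#|[set a in J | a < z]| <= #|[set a in I | a < z]|)%N.
Proof.
move=> uA hIJ /(minor_neq0 hIJ)[f [finj <- hf]].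
have sub : [set a in f @: I | a < z]%N \subset f @: [set a in I | a < z]%N.
  apply/subsetP => c; rewrite inE => /andP[/imsetP[a aI ->] fa].
  apply: imset_f; rewrite inE aI /=; apply: leq_ltn_trans fa.
  by rewrite leqNgt; apply/negP => /uA h; have := hf a aI; rewrite h eqxx.
apply: leq_trans (subset_leq_card sub) _; exact: leq_imset_card.
Qed.

Lemma sum2_distr (I1 I2 : finType) (P1 : pred I1) (P2 : pred I2) (F : I1 -> k) (G : I2 -> k) x :
  (\sum_(i | P1 i) F i) * x * (\sum_(j | P2 j) G j) =
  \sum_(i | P1 i) \sum_(j | P2 j) F i * x * G j.
Proof. by rewrite !mulr_suml; apply: eq_bigr => i _; rewrite mulr_sumr. Qed.

Lemma mul_sum2 (I1 I2 : finType) (P1 : pred I1) (P2 : pred I2) (F : I1 -> I2 -> k) x y :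
  x * (\sum_(i | P1 i) \sum_(j | P2 j) F i j) * y =
  \sum_(i | P1 i) \sum_(j | P2 j) x * F i j * y.
Proof.
rewrite mulr_sumr mulr_suml; apply: eq_bigr => i _.
by rewrite mulr_sumr mulr_suml.
Qed.

Lemma sum_coord (V : nmodType) d (F : {set 'I_n} -> {set 'I_n} -> V) : (0 < d < n)%N ->
  \sum_(c : coord n | cdeg c == d) F (val c).1 (val c).2 =
  \sum_(I : {set 'I_n} | #|I| == d) \sum_(J : {set 'I_n} | #|J| == d) F I J.
Proof.
move=> hd; rewrite pair_big /=.
rewrite [RHS](reindex_omap (val : coord n -> _) insub) /=; last first.
  by move=> [I J] /= /andP[/eqP h1 /eqP h2]; rewrite insubT //= h1 h2 eqxx.
apply: eq_bigl => -[[I J] h] /=; rewrite insubT /= eqxx andbT /cdeg /=.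
by have /andP[/eqP <- _] := h; rewrite andbb.
Qed.

Lemma coord_card (c : coord n) : #|(val c).1| = cdeg c /\ #|(val c).2| = cdeg c.
Proof. by have /andP[/eqP h _] := valP c; rewrite /cdeg -h. Qed.

Lemma coord_deg (c : coord n) : (0 < cdeg c < n)%N.
Proof. by have /andP[_ h] := valP c. Qed.

(** The form composed in both arguments with the exterior powers of [h]: a right action, free of the
    inverse that occurs in [qact]. *)
Definition pullback (h : 'M[k]_n) (x : mvec k n) : mvec k n :=
  [ffun c => \sum_(c' | cdeg c' == cdeg c)
     minor h (val c').1 (val c).1 * x c' * minor h (val c').2 (val c).2].

Lemma qact_pullback g x : qact g x = pullback (invmx g) x. Proof. by []. Qed.

(** Extension by 0 to all pairs of subsets, so that a sum over coordinates splits into independent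
    sums over [I] and [J]. *)
Definition coef (x : mvec k n) I J : k := if insub (I, J) is Some c then x c else 0.

Lemma coefE x (c : coord n) : coef x (val c).1 (val c).2 = x c.
Proof. by rewrite /coef -surjective_pairing valK. Qed.

Lemma pullbackE h x (c : coord n) : pullback h x c =
  \sum_(I : {set 'I_n} | #|I| == cdeg c) \sum_(J : {set 'I_n} | #|J| == cdeg c)
     minor h I (val c).1 * coef x I J * minor h J (val c).2.
Proof.
rewrite ffunE -sum_coord ?coord_deg //; apply: eq_bigr => c' _.
by rewrite coefE.
Qed.

Lemma coef_pullback h x I J : #|I| = #|J| -> (0 < #|I| < n)%N ->
  coef (pullback h x) I J =
  \sum_(I' : {set 'I_n} | #|I'| == #|I|) \sum_(J' : {set 'I_n} | #|J'| == #|I|)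
     minor h I' I * coef x I' J' * minor h J' J.
Proof.
move=> hIJ hI; rewrite {1}/coef insubT => [|hc]; first by rewrite /= hIJ eqxx -hIJ.
by rewrite pullbackE.
Qed.

Lemma pullbackM h1 h2 x : pullback h2 (pullback h1 x) = pullback (h1 *m h2) x.
Proof.
apply/ffunP => c; have [c1 c2] := coord_card c; rewrite !pullbackE.
transitivity (\sum_(I : {set 'I_n} | #|I| == cdeg c) \sum_(J : {set 'I_n} | #|J| == cdeg c)
  \sum_(I' : {set 'I_n} | #|I'| == cdeg c) \sum_(J' : {set 'I_n} | #|J'| == cdeg c)
    (minor h1 I' I * minor h2 I (val c).1) * coef x I' J' * (minor h1 J' J * minor h2 J (val c).2)).
  apply: eq_bigr => I /eqP hI; apply: eq_bigr => J /eqP hJ.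
  rewrite coef_pullback ?hI ?hJ ?coord_deg // mul_sum2.
  apply: eq_bigr => I' _; apply: eq_bigr => J' _.
  by rewrite !mulrA; congr (_ * _ * _); rewrite -!mulrA mulrCA.
transitivity (\sum_(I' : {set 'I_n} | #|I'| == cdeg c) \sum_(J' : {set 'I_n} | #|J'| == cdeg c)
  \sum_(I : {set 'I_n} | #|I| == cdeg c) \sum_(J : {set 'I_n} | #|J| == cdeg c)
    (minor h1 I' I * minor h2 I (val c).1) * coef x I' J' * (minor h1 J' J * minor h2 J (val c).2)).
  etransitivity; first by apply: eq_bigr => I _; apply: exchange_big.
  rewrite exchange_big; apply: eq_bigr => I' _.
  etransitivity; first by apply: eq_bigr => I _; apply: exchange_big.
  exact: exchange_big.
apply: eq_bigr => I' /eqP hI'; apply: eq_bigr => J' /eqP hJ'.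
by rewrite !cauchy_binet ?hI' ?hJ' // sum2_distr.
Qed.

Lemma pullback1 x : pullback 1%:M x = x.
Proof.
apply/ffunP => c; have [c1 c2] := coord_card c; rewrite pullbackE.
rewrite (bigD1 (val c).1) ?c1 //= (bigD1 (val c).2) ?c2 //= big1 => [|J /andP[/eqP hJ nJ]].
  rewrite addr0 big1 => [|I /andP[/eqP hI nI]].
    by rewrite addr0 !minor1 // !eqxx mul1r mulr1 coefE.
  by rewrite big1 // => J _; rewrite minor1 ?hI ?c1 // (negbTE nI) !mul0r.
by rewrite [minor _ J _]minor1 ?hJ ?c2 // (negbTE nJ) mulr0.
Qed.

Lemma pullbackK h x : h \in unitmx -> pullback (invmx h) (pullback h x) = x.
Proof. by move=> uh; rewrite pullbackM mulmxV // pullback1. Qed.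


Lemma pullback_compounds h A : pullback h (compounds A) = compounds (h^T *m A *m h).
Proof.
apply/ffunP => c; have [c1 c2] := coord_card c; rewrite [RHS]ffunE cauchy_binet ?c1 ?c2 //.
rewrite pullbackE; under [RHS]eq_bigr => K /eqP hK.
  rewrite cauchy_binet ?hK ?c1 // mulr_suml.
  over.
rewrite exchange_big; apply: eq_bigr => I /eqP hI; apply: eq_bigr => J /eqP hJ.
rewrite -(minor_tr h) ?hI ?c1 //; congr (_ * _ * _).
rewrite /coef insubT /= ?hI ?hJ ?eqxx ?coord_deg //.
by move=> hh; rewrite ffunE.
Qed.

End MoreMinors.

(** * Zariski closures *)

Section Closure.

Variables (k : closedFieldType) (n : nat).
Local Notation N := #|{: coord n}|.
Implicit Types (f g : {mpoly k[N]}) (x y : mvec k n) (S : mvec k n -> Prop).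

Definition weight (m : 'X_{1..N}) (i : nat) : nat :=
  (\sum_(v < N | cdeg (enum_val v) == i) m v)%N.

Definition multidegree (d : nat -> nat) f := forall m, m \in msupp f -> weight m =1 d.


Lemma weightD m1 m2 i : weight (m1 + m2)%MM i = (weight m1 i + weight m2 i)%N.
Proof. by rewrite /weight -big_split; apply: eq_bigr => v _; rewrite mnmDE. Qed.

Lemma multidegree_mul d e f g : multidegree d f -> multidegree e g -> multidegree (fun i => (d i + e i)%N) (f * g).
Proof.
move=> hf hg m /msuppM_le/allpairsP[[m1 m2] /= [h1 h2 ->]] i.
by rewrite weightD hf // hg.
Qed.

Lemma multidegree_scale c d f : multidegree d f -> multidegree d (c *: f).
Proof. by move=> hf m /msuppZ_le; apply: hf. Qed.

Lemma multidegree_sum (I : Type) (r : seq I) (P : pred I) (F : I -> {mpoly k[N]}) d :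
  (forall i, P i -> multidegree d (F i)) -> multidegree d (\sum_(i <- r | P i) F i).
Proof.
move=> h; elim/big_rec: _ => [m|i f Pi hf m]; first by rewrite msupp0.
by move=> /msuppD_le; rewrite mem_cat => /orP[]; [apply: h | apply: hf].
Qed.

Lemma multidegree1 : multidegree (fun=> 0%N) 1.
Proof.
move=> m; rewrite msupp1 inE => /eqP -> i.
by rewrite /weight big1 // => v _; rewrite mnm0E.
Qed.

Lemma multidegreeX v : multidegree (fun i => (cdeg (enum_val v : coord n) == i) : nat) 'X_v.
Proof.
move=> m; rewrite msuppX inE => /eqP -> i.
rewrite /weight (eq_bigr (fun w => (v == w) : nat)) => [|w _]; last by rewrite mnm1E.
rewrite big_mkcond (bigD1 v) //= eqxx big1 ?addn0 => [|w nw]; last first.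
  by rewrite [v == w]eq_sym (negbTE nw) if_same.
by case: (_ == i).
Qed.

Lemma multidegree_exp d f e : multidegree d f -> multidegree (fun i => (d i * e)%N) (f ^+ e).
Proof.
move=> hf; elim: e => [|e IH].
  by move=> m /multidegree1 h i; rewrite h muln0.
rewrite exprS => m hm i; rewrite mulnS; exact: (multidegree_mul hf IH).
Qed.

Lemma multidegree_prod (I : finType) (F : I -> {mpoly k[N]}) (d : I -> nat -> nat) :
  (forall i, multidegree (d i) (F i)) -> multidegree (fun j => (\sum_i d i j)%N) (\prod_i F i).
Proof.
move=> h; elim: (index_enum I) => [|i r IH] m.
  by rewrite big_nil => /multidegree1 hm j; rewrite hm big_nil.
by rewrite big_cons => hm j; rewrite big_cons (multidegree_mul (h i) IH).
Qed.

Lemma multidegree_comp d f (lq : N.-tuple {mpoly k[N]}) :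
  (forall v, multidegree (fun i => (cdeg (enum_val v : coord n) == i) : nat) (tnth lq v)) ->
  multidegree d f -> multidegree d (f \mPo lq).
Proof.
move=> hl hf; rewrite comp_mpolyE big_seq; apply: multidegree_sum => m hm; apply: multidegree_scale.
have h := multidegree_prod (fun v => multidegree_exp (e := m v) (hl v)).
move=> m' /h hm' i; rewrite hm' -(hf m hm) /weight [RHS]big_mkcond.
by apply: eq_bigr => v _; case: (_ == i); rewrite ?mul1n ?mul0n.
Qed.

Lemma zariski_self S x : is_point x -> S x -> zariski_closure S x.
Proof. by move=> px Sx; split=> // f _ ->. Qed.

Lemma zariski_trans S S' x : (forall y, S y -> zariski_closure S' y) ->
  zariski_closure S x -> zariski_closure S' x.
Proof.
move=> h [px hx]; split=> // f hf h0; apply: hx => // y Sy.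
by have [_] := h y Sy; apply.
Qed.

Definition linmap (M : coord n -> coord n -> k) x : mvec k n :=
  [ffun c => \sum_(c' | cdeg c' == cdeg c) M c c' * x c'].

(** Each variable is replaced by a linear form in the variables of its own degree, which preserves
    multidegrees. *)
Lemma linmap_poly M f : exists f', (multihomogeneous f -> multihomogeneous f') /\
  forall x, peval f' x = peval f (linmap M x).
Proof.
pose lq := [tuple \sum_(c' | cdeg c' == cdeg (enum_val v : coord n))
   M (enum_val v) c' *: 'X_(enum_rank c' : 'I_N) | v < N] : N.-tuple {mpoly k[N]}.
exists (f \mPo lq); split=> [[d hd]|x].
  exists d; apply: multidegree_comp => // v; rewrite tnth_mktuple; apply: multidegree_sum => c' /eqP hc.
  apply: multidegree_scale; have := @multidegreeX (enum_rank c' : 'I_N); by rewrite enum_rankK hc.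
rewrite /peval comp_mpoly_meval; apply: meval_eq => v.
rewrite tnth_mktuple ffunE rmorph_sum /=; apply: eq_bigr => c' _.
by rewrite mevalZ mevalXU enum_rankK.
Qed.

Lemma zariski_linmap M S S' x : (forall y, S y -> zariski_closure S' (linmap M y)) ->
  is_point (linmap M x) -> zariski_closure S x -> zariski_closure S' (linmap M x).
Proof.
move=> h pL [px hx]; split=> // f hf h0.
have [f' [mf' f'E]] := linmap_poly M f; rewrite -f'E.
apply: hx; first exact: mf'.
by move=> y /h[_ hy]; rewrite f'E; apply: hy.
Qed.

Lemma pullback_linmap h : pullback h =1 linmap (fun c c' : coord n =>
  minor h (val c').1 (val c).1 * minor h (val c').2 (val c).2).
Proof.
move=> x; apply/ffunP => c; rewrite !ffunE; apply: eq_bigr => c' _.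
by rewrite mulrAC.
Qed.

Lemma is_point_pullback h x : h \in unitmx -> is_point x -> is_point (pullback h x).
Proof.
move=> uh px i hi; have [c [ci xc]] := px i hi.
case: (pickP (fun c' => (cdeg c' == i) && (pullback h x c' != 0))) => [c' /andP[/eqP]|hn].
  by exists c'.
case/negP: xc; rewrite -(pullbackK x uh) ffunE big1 // => c' /eqP hc'.
have := hn c'; rewrite hc' ci eqxx /= => /negbT/negPn/eqP ->.
by rewrite mulr0 mul0r.
Qed.

Lemma zariski_pullback h S S' x : h \in unitmx ->
  (forall y, S y -> zariski_closure S' (pullback h y)) ->
  zariski_closure S x -> zariski_closure S' (pullback h x).
Proof.
move=> uh hS zx; have px : is_point (pullback h x) by case: zx => px _; apply: is_point_pullback.
rewrite pullback_linmap in px *; apply: zariski_linmap px zx => y /hS.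
by rewrite pullback_linmap.
Qed.

Definition rescale (l : nat -> k) x : mvec k n := [ffun c : coord n => l (cdeg c) * x c].

Lemma peval_rescale d f l x : multidegree d f -> (forall i, l i != 0) ->
  exists2 c, c != 0 & peval f (rescale l x) = c * peval f x.
Proof.
move=> hf hl; exists (\prod_(i < n) l i ^+ d i).
  by apply/prodf_neq0 => i _; rewrite expf_neq0.
rewrite /peval !mevalE mulr_sumr big_seq [RHS]big_seq; apply: eq_bigr => m hm.
rewrite mulrCA; congr (_ * _).
under eq_bigr => v _ do rewrite ffunE exprMn.
rewrite big_split /=; congr (_ * _).
have dlt (v : 'I_N) : (cdeg (enum_val v : coord n) < n)%N by have /andP[] := coord_deg (enum_val v : coord n).
rewrite (partition_big (fun v => Ordinal (dlt v)) xpredT) //=; apply: eq_bigr => i _.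
rewrite -(hf m hm) /weight expr_sum; apply: eq_big => v; first by rewrite -val_eqE.
by move=> /eqP <-.
Qed.

Lemma zariski_rescale l S x : (forall i, l i != 0) ->
  zariski_closure S x -> zariski_closure S (rescale l x).
Proof.
move=> hl [px hx]; split=> [i hi|f [d hd] h0].
  by have [c [ci xc]] := px i hi; exists c; rewrite ffunE mulf_neq0.
have [c _ ->] := peval_rescale x hd hl; rewrite hx ?mulr0 //.
by exists d.
Qed.

Lemma zariski_rescale_inv l S x : (forall i, l i != 0) ->
  zariski_closure S (rescale l x) -> zariski_closure S x.
Proof.
move=> hl /(zariski_rescale (l := fun i => (l i)^-1)).
have -> : rescale (fun i => (l i)^-1) (rescale l x) = x.
  by apply/ffunP => c; rewrite !ffunE mulKf.
by apply=> i; rewrite invr_eq0.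
Qed.

(** An equation restricted to the curve is a polynomial [P] in [t]. If it were nonzero, so would be
    [P * D], and a parameter that is not a root of the product would contradict the hypothesis. *)
Lemma zariski_curve (q : coord n -> {poly k}) (D : {poly k}) S t0 : D != 0 ->
  (forall t, D.[t] != 0 -> zariski_closure S [ffun c => (q c).[t]]) ->
  is_point [ffun c => (q c).[t0]] -> zariski_closure S [ffun c => (q c).[t0]].
Proof.
move=> D0 hS pt; split=> // f hf h0.
pose P : {poly k} := \sum_(m <- msupp f) f@_m *: \prod_v (q (enum_val v)) ^+ m v.
have PE t : P.[t] = peval f [ffun c => (q c).[t]].
  rewrite /peval mevalE horner_sum; apply: eq_bigr => m _.
  rewrite hornerZ horner_prod; congr (_ * _); apply: eq_bigr => v _.
  by rewrite horner_exp ffunE.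
rewrite -PE; have [->|P0] := eqVneq P 0; first by rewrite horner0.
have /closed_nonrootP[t] : P * D != 0 by rewrite mulf_neq0.
rewrite rootM negb_or => /andP[Pt Dt].
have [_ hz] := hS t Dt.
by case/negP: Pt; rewrite /root PE; apply/eqP/hz.
Qed.

End Closure.

(** * Closures of orbits of upper triangular matrices *)

Section Upper.

Variables (k : fieldType) (n : nat).
Implicit Types (A B h : 'M[k]_n).

Lemma upper_mul A B : upper A -> upper B -> upper (A *m B).
Proof.
move=> uA uB i j ji; rewrite mxE big1 // => l _.
case: (ltnP l i) => h; first by rewrite uA ?mul0r.
by rewrite uB ?mulr0 //; apply: leq_trans h.
Qed.

Lemma det_upper A : upper A -> \det A = \prod_i A i i.
Proof.
move=> uA; rewrite -det_tr det_trig; first by apply: eq_bigr => i _; rewrite mxE.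
by apply/is_trig_mxP => i j ij; rewrite mxE uA.
Qed.

Lemma upper_unit A : upper A -> (forall i, A i i != 0) -> A \in unitmx.
Proof.
move=> uA hA; rewrite unitmxE det_upper // unitfE.
by apply/prodf_neq0 => i _; apply: hA.
Qed.

Lemma upper_diag_neq0 A i : upper A -> A \in unitmx -> A i i != 0.
Proof.
move=> uA; rewrite unitmxE det_upper // unitfE => /prodf_neq0; exact.
Qed.

Lemma upper_inv A : upper A -> A \in unitmx -> upper (invmx A).
Proof.
move=> uA unA i j; have [m] := ubnP (n - i); elim: m i => // m IH i hm ji.
have /matrixP/(_ i j) := mulmxV unA; rewrite mxE [RHS]mxE.
rewrite (bigD1 i) //= big1 => [|l nl].
  have -> : (i == j) = false by apply/eqP => e; rewrite e ltnn in ji.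
  rewrite addr0 => /eqP; rewrite mulf_eq0 (negbTE (upper_diag_neq0 i uA unA)) /=.
  by move=> /eqP.
case: (ltngtP l i) => h; first by rewrite uA ?mul0r.
  rewrite IH ?mulr0 //; last exact: ltn_trans h.
  by apply: leq_trans (ltn_sub2l (ltn_ord i) h) _; rewrite -ltnS.
by rewrite (val_inj h) eqxx in nl.
Qed.

(** Without a condition on the determinant, single coordinates can be scaled freely, as the
    reductions of Gram matrices require. *)
Definition upper_orbit (x y : mvec k n) : Prop :=
  exists h, [/\ upper h, h \in unitmx & y = pullback h x].

Lemma pullbackZ c h (x : mvec k n) :
  pullback (c *: h) x = [ffun d : coord n => (c ^+ cdeg d) ^+ 2 * pullback h x d].
Proof.
apply/ffunP => d; rewrite !ffunE mulr_sumr; apply: eq_bigr => d' /eqP hd.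
have [e1 e2] := coord_card d'; rewrite !minorZ e1 e2 hd; ring.
Qed.

End Upper.

Section OrbitClosure.

Variables (k : closedFieldType) (n : nat).
Hypothesis n_gt0 : (0 < n)%N.
Implicit Types (A B h : 'M[k]_n) (x y Q : mvec k n).

Lemma closed_root m (c : k) : (0 < m)%N -> exists r, r ^+ m = c.
Proof.
move=> m_gt0.
have [r hr] := @solve_monicpoly k m (fun i => if i == 0%N then c else 0) m_gt0.
exists r; rewrite hr; case: m m_gt0 {hr} => // m _.
by rewrite big_ord_recl /= expr0 mulr1 big1 ?addr0 // => i _; rewrite mul0r.
Qed.

Lemma closure_B_orbit Q x : is_point Q ->
  zariski_closure (B_orbit Q) x <-> zariski_closure (upper_orbit Q) x.
Proof.
move=> pQ; split; apply: zariski_trans => y.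
  move=> [b [db ub] ->]; have unb : b \in unitmx by rewrite unitmxE db unitr1.
  rewrite qact_pullback; apply: zariski_self; first by apply: is_point_pullback => //; rewrite unitmx_inv.
  by exists (invmx b); split; rewrite ?unitmx_inv //; apply: upper_inv.
move=> [h [uh unh ->]]; have dh : \det h != 0 by rewrite -unitfE -unitmxE.
(* The scalar [c] brings the determinant to 1. By [pullbackZ] it multiplies the coordinates of
   degree [i] by [(c ^+ i) ^+ 2], which does not affect closures. *)
have [c hc] := closed_root (\det h)^-1 n_gt0.
have c0 : c != 0.
  by apply: contraNneq dh => e; move: hc; rewrite e expr0n gtn_eqF //= => /esym/eqP; rewrite invr_eq0.
have d1 : \det (c *: h) = 1 by rewrite detZ hc mulVf.
have unc : c *: h \in unitmx by rewrite unitmxE d1 unitr1.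
apply: (@zariski_rescale_inv _ _ (fun i => (c ^+ i) ^+ 2)); first by move=> i; rewrite !expf_neq0.
rewrite /rescale -pullbackZ; apply: zariski_self; first exact: is_point_pullback.
exists (invmx (c *: h)); last by rewrite qact_pullback invmxK.
split; first by rewrite det_inv d1 invr1.
by apply: upper_inv => // i j ji; rewrite mxE uh ?mulr0.
Qed.

Lemma closure_upper Q x h : upper h -> h \in unitmx -> is_point Q ->
  zariski_closure (upper_orbit Q) x -> zariski_closure (upper_orbit Q) (pullback h x).
Proof.
move=> uh unh pQ; apply: zariski_pullback => // y [h' [uh' unh' ->]].
rewrite pullbackM; have un : h' *m h \in unitmx by rewrite unitmx_mul unh'.
apply: zariski_self; first exact: is_point_pullback.
by exists (h' *m h); split=> //; apply: upper_mul.
Qed.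

Lemma pullback_pencil A B x : exists q : coord n -> {poly k},
  forall t, pullback (A + t *: B) x = [ffun c => (q c).[t]].
Proof.
pose M (I J : {set 'I_n}) : {poly k} := \det (\matrix_(a < #|I|, b < #|I|)
  ((A (enum_val a) (nth (enum_val a) (enum J) b))%:P +
   'X * (B (enum_val a) (nth (enum_val a) (enum J) b))%:P)).
have ME I J t : (M I J).[t] = minor (A + t *: B) I J.
  rewrite /M -[LHS]/(horner_eval t _) -det_map_mx; congr (\det _).
  apply/matrixP => a b; rewrite !mxE.
  set u := A _ _; set v := B _ _.
  transitivity ((u%:P + 'X * v%:P : {poly k}).[t]); first by [].
  by rewrite hornerD hornerC hornerM hornerX hornerC.
exists (fun c => \sum_(c' | cdeg c' == cdeg c)
   M (val c').1 (val c).1 * (x c')%:P * M (val c').2 (val c).2).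
move=> t; apply/ffunP => c; rewrite !ffunE horner_sum; apply: eq_bigr => c' _.
by rewrite !hornerM hornerC !ME.
Qed.

Lemma zariski_pencil A B (D : {poly k}) S x t0 : D != 0 ->
  (forall t, D.[t] != 0 -> zariski_closure S (pullback (A + t *: B) x)) ->
  is_point (pullback (A + t0 *: B) x) -> zariski_closure S (pullback (A + t0 *: B) x).
Proof.
move=> D0; have [q qE] := pullback_pencil A B x; rewrite qE => hS.
by apply: zariski_curve D0 _ => t /hS; rewrite qE.
Qed.

End OrbitClosure.

(** * Coordinate quadrics under flag-preserving matrices, and necessity of the rank inequalities *)

Section LastBlocks.

Variables (n : nat).
Implicit Types (b : 'I_n -> nat) (I J : {set 'I_n}).

Definition above b I j := #|[set a in I | j < b a]%N|.

Lemma above_le b I j : (above b I j <= minn #|I| #|[set a | j < b a]%N|)%N.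
Proof.
rewrite leq_min; apply/andP; split; apply/subset_leq_card/subsetP => a;
  by rewrite !inE => /andP[].
Qed.

(** A set taken from the last blocks meets every final union of blocks as much as its size permits.
    This numerical form can be transported along injections. *)
Lemma last_blocksP b I :
  last_blocks b I <-> forall j, above b I j = minn #|I| #|[set a | j < b a]%N|.
Proof.
split=> [/forallP h j|h].
  apply/eqP; rewrite eqn_leq above_le /=.
  have [/subsetP sub|/subsetPn[c]] := boolP ([set a | j < b a]%N \subset I).
    apply: leq_trans (geq_minr _ _) _; apply/subset_leq_card/subsetP => a.
    by rewrite !inE => ja; rewrite ja sub // inE.
  rewrite inE => jc cI; apply: leq_trans (geq_minl _ _) _; apply/subset_leq_card/subsetP => a aI.
  rewrite inE aI; have := h a; rewrite aI => /forallP/(_ c); rewrite inE cI /=.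
  exact: leq_trans.
apply/forallP => a; apply/implyP => aI; apply/forallP => c; apply/implyP; rewrite inE => cI.
rewrite leqNgt; apply/negP => lt; have := h (b a).
have l1 : (above b I (b a) < #|I|)%N.
  by apply: proper_card; apply/properP; split;
    [apply/subsetP => e; rewrite inE => /andP[] | exists a; rewrite // inE ltnn andbF].
have l2 : (above b I (b a) < #|[set e | b a < b e]%N|)%N.
  apply: proper_card; apply/properP; split.
    by apply/subsetP => e; rewrite !inE => /andP[].
  by exists c; rewrite !inE // (negbTE cI).
move=> e; have : (above b I (b a) < above b I (b a))%N by rewrite {2}e leq_min l1 l2.
by rewrite ltnn.
Qed.

Lemma above_imset b b' (f : 'I_n -> 'I_n) I j : {in I &, injective f} ->
  (forall a, a \in I -> b a <= b' (f a))%N -> (above b I j <= above b' (f @: I) j)%N.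
Proof.
move=> finj hf; rewrite /above.
have -> : #|[set a in I | j < b a]%N| = #|f @: [set a in I | j < b a]%N|.
  by rewrite card_in_imset // => a c; rewrite !inE => /andP[aI _] /andP[cI _]; apply: finj.
apply/subset_leq_card/subsetP => _ /imsetP[a h ->]; move: h; rewrite inE => /andP[aI ja].
by rewrite inE imset_f //=; apply: leq_trans (hf a aI).
Qed.

(** If the block index rose strictly at [a], then at level [b a] the image would gain the extra
    element [f a]. *)
Lemma above_eq b b' (f : 'I_n -> 'I_n) I : {in I &, injective f} ->
  (forall a, a \in I -> b a <= b' (f a))%N ->
  (forall j, above b I j = above b' (f @: I) j) ->
  forall a, a \in I -> b a = b' (f a).
Proof.
move=> finj hf he a aI; apply/eqP; rewrite eqn_leq hf //= leqNgt; apply/negP => lt.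
have := he (b a); rewrite /above.
have -> : #|[set a0 in I | b a < b a0]%N| = #|f @: [set a0 in I | b a < b a0]%N|.
  by rewrite card_in_imset // => e c; rewrite !inE => /andP[eI _] /andP[cI _]; apply: finj.
move=> e; have : (#|f @: [set a0 in I | b a < b a0]%N| < #|[set a0 in f @: I | b a < b' a0]%N|)%N.
  apply: proper_card; apply/properP; split.
    apply/subsetP => _ /imsetP[c h ->]; move: h; rewrite [c \in _]inE => /andP[cI jc].
    by rewrite inE imset_f //=; apply: leq_trans (hf c cI).
  exists (f a); first by rewrite inE imset_f.
  apply/negP => /imsetP[c h ec]; move: h; rewrite [c \in _]inE => /andP[cI ac].
  by rewrite (finj _ _ aI cI ec) ltnn in ac.
by rewrite e ltnn.
Qed.

Variable k : fieldType.
Implicit Types (h S : 'M[k]_n).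

(** The action of [h] on the successive quotients of the flag. Source and target carry separate
    block maps because a permutation matrix moves the flag. *)
Definition levi b b' h : 'M[k]_n := \matrix_(a, c) if b a == b' c then h a c else 0.

(** A transversal of [h] can only raise block indices, and between two sets from the last blocks
    nothing can rise, by [above_eq]. Hence [h] acts on the surviving coordinates through [levi]. *)
Lemma last_blocks_minor b b' h I J :
    (forall a c, h a c != 0 -> (b a <= b' c)%N) ->
    (forall j, #|[set a | j < b a]%N| = #|[set a | j < b' a]%N|) -> #|I| = #|J| ->
  [/\ last_blocks b I -> minor h I J != 0 -> last_blocks b' J,
      last_blocks b I -> last_blocks b' J -> minor h I J = minor (levi b b' h) I J &
      last_blocks b' J -> minor (levi b b' h) I J != 0 -> last_blocks b I].
Proof.
move=> hh hb hIJ; split.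
- move=> /last_blocksP lI /(minor_neq0 hIJ)[f [finj fJ nz]]; apply/last_blocksP => j.
  apply/eqP; rewrite eqn_leq above_le -hIJ -hb -lI -fJ /=.
  by apply: above_imset => // a aI; apply/hh/nz.
- move=> /last_blocksP lI /last_blocksP lJ; apply: minor_congr => // [a c|f finj fJ nz a aI].
    by rewrite mxE => ->; rewrite if_same.
  rewrite mxE ifT //; apply/eqP; apply: (@above_eq b b' f I) => //.
    by move=> c cI; apply/hh/nz.
  by move=> j; rewrite lI fJ lJ hIJ hb.
move=> /last_blocksP lJ /(minor_neq0 hIJ)[f [finj fJ nz]]; apply/last_blocksP => j.
have e a : a \in I -> b a = b' (f a).
  by move=> /nz; rewrite mxE; case: (b a =P _) => // _ /eqP.
rewrite hIJ hb -lJ -fJ; apply/eqP; rewrite eqn_leq above_imset => [|//|a /e -> //].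
apply: leq_trans (leq_imset_card f _); apply/subset_leq_card/subsetP => c.
rewrite inE => /andP[/imsetP[a aI ->] ja]; apply: imset_f.
by rewrite inE aI e.
Qed.

End LastBlocks.

Section Quadrics.

Variables (k : closedFieldType) (n : nat).
Hypothesis n_gt0 : (0 < n)%N.
Hypothesis char_k : (2%:R : k) != 0.
Implicit Types (b : 'I_n -> nat) (p : 'I_n -> 'I_n) (h S : 'M[k]_n) (I J : {set 'I_n}).

Definition gram p : 'M[k]_n :=
  \matrix_(a, c) (if p a == c then (if a == c then 1 else 2%:R^-1) else 0).

Lemma gram_neq0 p a c : (gram p a c != 0) = (c == p a).
Proof.
rewrite mxE [c == _]eq_sym; case: (p a == c); last by rewrite eqxx.
by case: (a == c); rewrite ?oner_neq0 // invr_eq0 char_k.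
Qed.

Lemma coef_quadric b S I J : #|I| = #|J| -> (0 < #|I| < n)%N ->
  coef (coordinate_quadric b S) I J =
  if last_blocks b I && last_blocks b J then minor S I J else 0.
Proof.
move=> hIJ hI; rewrite /coef insubT /=; first by rewrite hIJ eqxx -hIJ.
by move=> h; rewrite ffunE.
Qed.

Lemma coef_compounds S I J : #|I| = #|J| -> (0 < #|I| < n)%N ->
  coef (compounds S) I J = minor S I J.
Proof.
move=> hIJ hI; rewrite /coef insubT /=; first by rewrite hIJ eqxx -hIJ.
by move=> h; rewrite ffunE.
Qed.

Lemma pullback_quadric b b' h S :
    (forall a c, h a c != 0 -> (b a <= b' c)%N) ->
    (forall j, #|[set a | j < b a]%N| = #|[set a | j < b' a]%N|) ->
  pullback h (coordinate_quadric b S) =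
  coordinate_quadric b' ((levi b b' h)^T *m S *m levi b b' h).
Proof.
move=> hh hb; apply/ffunP => c; have [c1 c2] := coord_card c; have hc := coord_deg c.
have -> : coordinate_quadric b' ((levi b b' h)^T *m S *m levi b b' h) c =
    if last_blocks b' (val c).1 && last_blocks b' (val c).2 then
      pullback (levi b b' h) (compounds S) c else 0.
  by rewrite pullback_compounds !ffunE.
have zero : \sum_(I : {set 'I_n} | #|I| == cdeg c) \sum_(J : {set 'I_n} | #|J| == cdeg c) (0 : k) = 0.
  by rewrite big1 // => *; rewrite big1.
case: ifP => hl; rewrite pullbackE ?pullbackE -?[RHS]zero; apply: eq_bigr => I /eqP hI;
  apply: eq_bigr => J /eqP hJ; rewrite coef_quadric ?coef_compounds ?hI ?hJ //.
  move/andP: hl => [l1 l2].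
  have [_ k2 k3] := last_blocks_minor hh hb (etrans hI (esym c1)).
  have [_ k2' k3'] := last_blocks_minor hh hb (etrans hJ (esym c2)).
  have [/andP[lI lJ]|nl] := boolP (last_blocks b I && last_blocks b J).
    by rewrite k2 // k2'.
  rewrite mulr0 mul0r; apply/esym/eqP/negPn/negP; rewrite !mulf_eq0 !negb_or.
  move=> /andP[/andP[n1 _] n2]; case/negP: nl.
  by rewrite k3 // k3'.
have [k1 _ _] := last_blocks_minor hh hb (etrans hI (esym c1)).
have [k1' _ _] := last_blocks_minor hh hb (etrans hJ (esym c2)).
case: ifP => [/andP[lI lJ]|_]; last by rewrite mulr0 mul0r.
apply/eqP/negPn/negP; rewrite !mulf_eq0 !negb_or => /andP[/andP[n1 _] n2].
by rewrite k1 // k1' in hl.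
Qed.

Lemma last_blocks_exists b i : (i <= n)%N ->
  exists I : {set 'I_n}, #|I| = i /\ last_blocks b I.
Proof.
elim: i => [_|i IH li].
  exists set0; split; first exact: cards0.
  by apply/forallP => a; rewrite inE.
have [I [hI lI]] := IH (ltnW li).
have [c0 hc0] : exists c, c \notin I.
  apply/existsP; rewrite -negb_forall; apply/negP => /forallP h.
  have : I = setT by apply/setP => a; rewrite inE h.
  by move=> e; move: hI; rewrite e cardsT card_ord => e'; rewrite e' ltnn in li.
have [c hc cmax] := @arg_maxnP _ c0 (fun c => c \notin I) b hc0.
exists (c |: I); split; first by rewrite cardsU1 hc hI.
apply/forallP => a; apply/implyP; rewrite !inE => /orP[/eqP->|aI].
  by apply/forallP => d; apply/implyP; rewrite !inE negb_or => /andP[_]; apply: cmax.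
apply/forallP => d; apply/implyP; rewrite !inE negb_or => /andP[_ dI].
by have /forallP/(_ a) := lI; rewrite aI => /forallP/(_ d); rewrite inE dI.
Qed.

Lemma above_pairing b p I j : block_pairing b p -> above b (p @: I) j = above b I j.
Proof.
move=> [pK bp]; have le K : (above b K j <= above b (p @: K) j)%N.
  by apply: above_imset => [a c _ _|a _]; [apply: (can_inj pK) | rewrite bp].
apply/eqP; rewrite eqn_leq le andbT.
by apply: leq_trans (le _) _; rewrite -imset_comp (eq_imset (g := id)) ?imset_id.
Qed.

Lemma last_blocks_pairing b p I : block_pairing b p ->
  last_blocks b I -> last_blocks b (p @: I).
Proof.
move=> bp /last_blocksP h; apply/last_blocksP => j.
by rewrite above_pairing // h card_imset //; case: bp => pK _; apply: can_inj pK.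
Qed.

Lemma quadric_support b p I : block_pairing b p -> (0 < #|I| < n)%N -> last_blocks b I ->
  exists c : coord n, [/\ val c = (I, p @: I), cdeg c = #|I| &
    coordinate_quadric b (gram p) c != 0].
Proof.
move=> bp hI lI; have pinj : injective p by case: bp => /can_inj.
have hc : (#|(I, p @: I).1| == #|(I, p @: I).2|) && (0 < #|(I, p @: I).1| < n)%N.
  by rewrite /= card_imset // eqxx.
exists (exist _ (I, p @: I) hc); split=> //; rewrite ffunE /= lI last_blocks_pairing //.
apply: minor_monomial => // a c; exact: gram_neq0.
Qed.

Lemma is_point_quadric b p : block_pairing b p -> is_point (coordinate_quadric b (gram p)).
Proof.
move=> bp i hi; have [|I [hI lI]] := @last_blocks_exists b i.
  by case/andP: hi => _ /ltnW.
have [|c [_ dc nc]] := quadric_support bp _ lI; first by rewrite hI.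
by exists c; rewrite dc hI.
Qed.

Lemma below_card (f : 'I_n -> bool) z : below f z = #|[set a | f a & a < z]%N|.
Proof.
rewrite /below -sum1_card big_mkcond [RHS]big_mkcond; apply: eq_bigr => a _.
by rewrite inE; case: (f a); case: (a < z)%N.
Qed.

Lemma card_sum (P : pred 'I_n) : #|[set a | P a]| = (\sum_a P a)%N.
Proof.
rewrite -sum1_card big_mkcond; apply: eq_bigr => a _.
by rewrite inE; case: (P a).
Qed.

Lemma card_set_sum I : #|I| = (\sum_a (a \in I))%N.
Proof. by rewrite -card_sum; apply: eq_card => a; rewrite inE. Qed.

Lemma card_image_below p I z : injective p ->
  #|[set a in p @: I | a < z]%N| = (\sum_a ((a \in I) && (p a < z)%N))%N.
Proof.
move=> pinj; rewrite -(card_sum (fun a => (a \in I) && (p a < z)%N)).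
rewrite -[RHS](card_imset _ pinj); apply: eq_card => c; rewrite inE.
apply/andP/imsetP => [[/imsetP[a aI ->] az]|[a h ->]]; first by exists a; rewrite // inE aI.
by move: h; rewrite inE => /andP[aI az]; rewrite imset_f.
Qed.

Lemma rank_fun_sum b p j z w : block_pairing b p ->
  rank_fun b p j z w =
  (\sum_a (((j < b a) && (p a < w)) + (corner b p j w a && (a < z))))%N.
Proof.
move=> [pK bp]; rewrite /rank_fun !below_card !card_sum big_split /=; congr (_ + _)%N.
by rewrite (reindex_inj (can_inj pK)); apply: eq_bigr => a _; rewrite bp.
Qed.

Lemma last_blocks_sandwich b I j : last_blocks b I ->
  (#|[set a | j < b a]%N| <= #|I| <= #|[set a | j <= b a]%N|)%N ->
  (forall a, (j < b a)%N -> a \in I) /\ (forall a, a \in I -> (j <= b a)%N).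
Proof.
move=> /forallP lI /andP[h1 h2]; have lt a c : a \in I -> c \notin I -> (b c <= b a)%N.
  by move=> aI cI; have := lI a; rewrite aI => /forallP/(_ c); rewrite inE cI.
split=> a ha; apply/negPn/negP => na.
  have : (#|I| < #|[set a | j < b a]%N|)%N; last by lia.
  apply: proper_card; apply/properP; split; last by exists a; rewrite ?inE.
  by apply/subsetP => c /lt/(_ na) h; rewrite inE; lia.
have : (#|[set a | j <= b a]%N| < #|I|)%N; last by lia.
apply: proper_card; apply/properP; split; last by exists a; rewrite ?inE.
apply/subsetP => c; rewrite inE => hc; apply/negPn/negP => /(lt a _ ha); lia.
Qed.

Lemma closure_rank b p b' p' : block_pairing b p -> block_pairing b' p' ->
    (forall j, #|[set a | j < b a]%N| = #|[set a | j < b' a]%N|) ->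
    (forall j, #|[set a | j <= b a]%N| = #|[set a | j <= b' a]%N|) ->
    zariski_closure (B_orbit (coordinate_quadric b' (gram p'))) (coordinate_quadric b (gram p)) ->
  forall j z w, (rank_fun b p j z w <= rank_fun b' p' j z w)%N.
Proof.
move=> bp bp' hb hb1 [_ hz] j z w.
have pinj : injective p by case: bp => /can_inj.
pose I := [set a | (j < b a)%N || [&& b a == j, a < z & p a < w]%N].
have lI : last_blocks b I.
  apply/forallP => a; apply/implyP; rewrite inE => ha; apply/forallP => c; apply/implyP.
  by rewrite !inE negb_or -leqNgt => /andP[hc _]; move: ha => /orP[]; [|case/and3P]; lia.
have hJ : #|p @: I| = #|I| by rewrite card_imset.
(* The counting is isolated because [I] may be empty or full: no coordinate exists then, and [I'] is
   supplied directly. *)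
have key (I' : {set 'I_n}) : #|I'| = #|I| -> last_blocks b' I' ->
    (#|[set a in I | a < z]%N| <= #|[set a in I' | a < z]%N|)%N ->
    (#|[set a in p @: I | a < w]%N| <= #|[set a in p' @: I' | a < w]%N|)%N ->
    (rank_fun b p j z w <= rank_fun b' p' j z w)%N.
  have pinj' : injective p' by case: bp' => /can_inj.
  move=> eI l'; rewrite !card_image_below // !card_sum => h1 h2.
  have sI : (#|[set a | j < b a]%N| <= #|I|)%N.
    by apply/subset_leq_card/subsetP => a; rewrite !inE => ->.
  have [|S' C'] := @last_blocks_sandwich b' I' j l'.
    rewrite eI -hb sI -hb1; apply/subset_leq_card/subsetP => a; rewrite !inE.
    by case: ltngtP.
  have c1 : #|I| = (\sum_a (j < b a) + \sum_a [&& b a == j, a < z & p a < w])%N.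
    rewrite card_set_sum -big_split; apply: eq_bigr => a _; rewrite inE.
    by case: (ltngtP j (b a)) => //= _; case: (_ && _).
  have c2 : #|I'| = (\sum_a (j < b' a) + \sum_a ((a \in I') && (b' a == j)))%N.
    rewrite card_set_sum -big_split; apply: eq_bigr => a _.
    have := S' a; have := C' a; case: (a \in I'); case: (ltngtP j (b' a)) => //= _.
      by move=> /(_ isT).
    by move=> _ /(_ isT).
  have c3 : (\sum_a (j < b a) = \sum_a (j < b' a))%N by rewrite -!card_sum hb.
  (* A letter of block [j] in [I] satisfies both bounds and counts twice on the right, whence the
     correction term. For [I'] only an inequality holds, since [(a < z) + (p' a < w)] exceeds the
     conjunction by at most one. By [eK] the corrections are equal. *)
  have e1 : (rank_fun b p j z w + \sum_a [&& b a == j, a < z & p a < w] =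
      \sum_a ((a \in I) && (a < z)) + \sum_a ((a \in I) && (p a < w)))%N.
    rewrite rank_fun_sum // -!big_split; apply: eq_bigr => a _ /=.
    rewrite /corner inE; case: (ltngtP j (b a)) => //= _;
    by case: (a < z)%N; case: (p a < w)%N.
  have e2 : (\sum_a ((a \in I') && (a < z)) + \sum_a ((a \in I') && (p' a < w)) <=
      rank_fun b' p' j z w + \sum_a ((a \in I') && (b' a == j)))%N.
    rewrite rank_fun_sum // -!big_split; apply: leq_sum => a _ /=; rewrite /corner.
    case: (boolP (a \in I')) => //= aI; have := C' a aI.
    by case: (ltngtP j (b' a)) => //= _ _; case: (a < z)%N; case: (p' a < w)%N.
  have eK : (\sum_a [&& b a == j, a < z & p a < w] = \sum_a ((a \in I') && (b' a == j)))%N.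
    by have := etrans (esym c2) (etrans eI c1); rewrite -c3 => /addnI.
  move: e2; rewrite -eK => e2; rewrite -(leq_add2r (\sum_a [&& b a == j, a < z & p a < w])%N).
  by apply: leq_trans e2; rewrite e1; apply: leq_add.
have [d0|dpos] := posnP #|I|.
  apply: (key set0); rewrite ?cards0 //.
  - by apply/forallP => a; rewrite inE.
  - by apply: leq_trans (subset_leq_card (_ : _ \subset I)) _; rewrite ?d0 //;
      apply/subsetP => a; rewrite inE => /andP[].
  - by apply: leq_trans (subset_leq_card (_ : _ \subset p @: I)) _; rewrite ?hJ ?d0 //;
      apply/subsetP => a; rewrite inE => /andP[].
have [dn|dn] := leqP n #|I|.
  have IT : I = setT by apply/eqP; rewrite eqEcard subsetT cardsT card_ord.
  have pT q (qinj : injective q) : q @: [set: 'I_n] = [set: 'I_n].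
    by apply/eqP; rewrite eqEcard subsetT card_imset /=.
  have pinj' : injective p' by case: bp' => /can_inj.
  apply: (key setT); rewrite ?IT ?pT //.
  by apply/forallP => a; apply/implyP => _; apply/forallP => c; rewrite !inE.
have hI : (0 < #|I| < n)%N by rewrite dpos.
have [c [vc dc nc]] := quadric_support bp hI lI.
(* If the inequality failed, the single coordinate [c] would vanish on the orbit of the second
   quadric but not at the first. *)
apply/negPn/negP => hn; case/negP: nc; apply/eqP.
have := hz ('X_(enum_rank c)) _ _; rewrite /peval mevalXU enum_rankK; apply.
  by exists (fun i => (cdeg (enum_val (enum_rank c) : coord n) == i) : nat); apply: multidegreeX.
move=> y [g [dg ug] ->]; rewrite /peval mevalXU enum_rankK qact_pullback pullbackE.
have ung : g \in unitmx by rewrite unitmxE dg unitr1.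
have ui := upper_inv ug ung.
rewrite big1 // => I' /eqP hI'; rewrite big1 // => J' /eqP hJ'.
apply/eqP/negPn/negP; rewrite !mulf_eq0 !negb_or => /andP[/andP[n1 n2] n3].
rewrite dc in hI' hJ'; rewrite vc /= in n1 n3.
move: n2; rewrite coef_quadric ?hI' ?hJ' //.
case: ifP => [/andP[l1 l2] n2|_]; last by rewrite eqxx.
have eJ : J' = p' @: I'.
  apply: (minor_monomial_eq _ _ n2); first by rewrite hI' hJ'.
  by move=> a e; rewrite gram_neq0 => /eqP.
case/negP: hn; apply: (key I') => //; first by apply: (minor_upper z ui _ n1).
by rewrite -eJ; apply: (minor_upper w ui _ n3); rewrite hJ' hJ.
Qed.

End Quadrics.

Lemma gram_sym (k : closedFieldType) n (p : 'I_n -> 'I_n) a c : involutive p ->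
  gram k p a c = gram k p c a.
Proof.
move=> pK; rewrite !mxE [c == a]eq_sym; congr (if _ then _ else _).
by rewrite -{1}(pK c) (inj_eq (can_inj pK)) eq_sym.
Qed.

(** * Distinguished quadrics are complete *)

Section Degeneration.

Variables (k : closedFieldType) (n : nat).
Hypothesis n_gt0 : (0 < n)%N.
Hypothesis char_k : (2%:R : k) != 0.
Variables (b : 'I_n -> nat) (p : 'I_n -> 'I_n).
Hypothesis bp : block_pairing b p.
Implicit Types (I J : {set 'I_n}).

Definition block_weight I := (\sum_(a in I) b a)%N.
Definition max_weight i := (\max_(I : {set 'I_n} | #|I| == i) block_weight I)%N.

Lemma block_weight_above I m : (forall a, b a <= m)%N ->
  block_weight I = (\sum_(j < m) above b I j)%N.
Proof.
move=> hm; rewrite /block_weight.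
transitivity (\sum_(a in I) \sum_(j < m) (j < b a))%N.
  apply: eq_bigr => a _; have := hm a; elim: m {hm} => [|m IH] h.
    by rewrite big_ord0; move: h; rewrite leqn0 => /eqP.
  rewrite big_ord_recr /=; move: h; rewrite leq_eqVlt => /orP[/eqP e|h].
    rewrite e ltnSn (eq_bigr (fun=> 1%N)) ?sum1_card ?card_ord ?addn1 //.
    by move=> j _; rewrite ltnS ltnW.
  by rewrite -IH // ltnNge -ltnS h addn0.
rewrite exchange_big; apply: eq_bigr => j _.
rewrite /above -sum1_card big_mkcond [RHS]big_mkcond; apply: eq_bigr => a _.
by rewrite inE; case: (a \in I); case: (_ < _)%N.
Qed.

Lemma block_weight_max I : (block_weight I <= max_weight #|I|)%N.
Proof. exact: (@leq_bigmax_cond _ (fun J : {set 'I_n} => #|J| == #|I|) block_weight). Qed.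

Lemma b_bound a : (b a <= \max_c b c)%N.
Proof. exact: leq_bigmax. Qed.

(** By layers, the weight is a sum of the counts [above b I j], and it is maximal exactly when every
    layer is. So the coordinates that survive the degeneration are those taken from the last
    blocks. *)
Lemma block_weight_last I : (block_weight I == max_weight #|I|) = last_blocks b I.
Proof.
set m := (\max_c b c)%N; have wE J := @block_weight_above J m b_bound.
have le J : #|J| = #|I| -> last_blocks b I -> (block_weight J <= block_weight I)%N.
  move=> hJ /last_blocksP hI; rewrite !wE; apply: leq_sum => j _.
  by rewrite hI -hJ above_le.
apply/eqP/idP => [h|lI]; last first.
  apply/eqP; rewrite eqn_leq block_weight_max; apply/bigmax_leqP => J /eqP hJ; exact: le.
have [|L [hL /last_blocksP lL]] := @last_blocks_exists n b #|I|.
  by rewrite -[X in (_ <= X)%N](card_ord n) max_card.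
have hLI : (block_weight L <= block_weight I)%N by rewrite h -hL block_weight_max.
have leL j : (above b I j <= above b L j)%N by rewrite lL hL above_le.
have eqj : forall j : 'I_m, above b I j = above b L j.
  move=> j0; apply/eqP; rewrite eqn_leq leL leqNgt; apply/negP => lt.
  move: hLI; rewrite !wE leqNgt; case/negP.
  rewrite (bigD1 j0) //= [ltnRHS](bigD1 j0) //= -addSn leq_add //.
  exact: leq_sum.
apply/last_blocksP => j; case: (ltnP j m) => hj.
  by rewrite (eqj (Ordinal hj)) /= lL hL.
apply/eqP; rewrite eqn_leq above_le.
have -> : [set a | j < b a]%N = set0.
  by apply/setP => a; rewrite !inE; apply/negbTE; rewrite -leqNgt; apply: leq_trans (b_bound a) hj.
by rewrite cards0 minn0.
Qed.

Lemma minor_row_scale (d : 'I_n -> k) (A : 'M[k]_n) I J :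
  minor (\matrix_(a, c) (d a * A a c)) I J = (\prod_(a in I) d a) * minor A I J.
Proof.
rewrite /minor.
have -> : \matrix_(a < #|I|, c < #|I|)
    (\matrix_(a0, c0) (d a0 * A a0 c0)) (enum_val a) (nth (enum_val a) (enum J) c) =
  diag_mx (\row_a d (enum_val a)) *m
    \matrix_(a < #|I|, c < #|I|) A (enum_val a) (nth (enum_val a) (enum J) c).
  by apply/matrixP => a c; rewrite mul_diag_mx !mxE.
rewrite det_mulmx det_diag; congr (_ * _); rewrite [RHS]big_enum_val.
by apply: eq_bigr => a _; rewrite mxE.
Qed.

Lemma is_point_compounds (A : 'M[k]_n) (q : 'I_n -> 'I_n) : injective q ->
  (forall a c, (A a c != 0) = (c == q a)) -> is_point (compounds A).
Proof.
move=> qinj hA i hi; have [|I [hI _]] := @last_blocks_exists n (fun=> 0%N) i.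
  by case/andP: hi => _ /ltnW.
have hc : (#|(I, q @: I).1| == #|(I, q @: I).2|) && (0 < #|(I, q @: I).1| < n)%N.
  by rewrite /= card_imset // eqxx hI.
exists (exist _ (I, q @: I) hc); split=> //; rewrite ffunE /=.
exact: minor_monomial.
Qed.

(* Limit at [t = 0] of the quadrics with Gram matrices [t ^ (m - b a) * S a c],
   rescaled in each degree by the smallest power of [t] that occurs. *)
Lemma quadric_complete : complete_quadrics (coordinate_quadric b (gram k p)).
Proof.
set m := (\max_c b c)%N; have [pK bpE] := bp.
have pinj : injective p := can_inj pK.
pose q (c : coord n) : {poly k} :=
  (minor (gram k p) (val c).1 (val c).2) *: 'X^(max_weight (cdeg c) - block_weight (val c).1).
have q0 : coordinate_quadric b (gram k p) = [ffun c => (q c).[0]].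
  apply/ffunP => c; rewrite !ffunE hornerZ hornerXn expr0n subn_eq0.
  have [c1 c2] := coord_card c; have := block_weight_max (val c).1.
  rewrite leq_eqVlt block_weight_last c1 => /orP[l1|h]; last first.
    have /negbTE -> : ~~ last_blocks b (val c).1 by rewrite -block_weight_last c1; lia.
    by rewrite leqNgt h mulr0.
  have /eqP <- : block_weight (val c).1 == max_weight (cdeg c) by rewrite -c1 block_weight_last.
  rewrite leqnn mulr1 l1 /=; case: ifP => // nl2; apply/esym/eqP/negPn/negP => nz.
  have e : (val c).2 = p @: (val c).1.
    apply: (minor_monomial_eq _ _ nz); first by rewrite c1 c2.
    by move=> a d; rewrite gram_neq0 // => /eqP.
  by rewrite e last_blocks_pairing in nl2.
rewrite q0; apply: (@zariski_curve _ _ q 'X); first by rewrite polyX_eq0.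
  move=> t; rewrite hornerX => t0.
  apply: (@zariski_rescale_inv _ _ (fun i => t ^+ (m * i - max_weight i))) => [i|].
    by rewrite expf_neq0.
  pose A := \matrix_(a, c) (t ^+ (m - b a) * gram k p a c).
  have hA a c : (A a c != 0) = (c == p a).
    by rewrite mxE mulf_eq0 negb_or expf_neq0 // gram_neq0.
  have -> : rescale (fun i => t ^+ (m * i - max_weight i)) [ffun c => (q c).[t]] = compounds A.
    apply/ffunP => c; rewrite !ffunE minor_row_scale hornerZ hornerXn mulrCA mulrC; congr (_ * _).
    have [c1 c2] := coord_card c; rewrite -exprD prodrXr; congr (t ^+ _).
    have h1 : (\sum_(a in (val c).1) (m - b a) + block_weight (val c).1 = m * cdeg c)%N.
      rewrite -big_split /= (eq_bigr (fun=> m)); last by move=> a _; rewrite subnK ?b_bound.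
      by rewrite sum_nat_const c1 mulnC.
    have h2 : (max_weight (cdeg c) <= m * cdeg c)%N.
      apply/bigmax_leqP => J /eqP hJ; rewrite -hJ mulnC -sum_nat_const.
      by apply: leq_sum => a _; apply: b_bound.
    have := block_weight_max (val c).1; rewrite c1 => hw.
    have tri (x y z : nat) : (z <= y <= x -> x - y + (y - z) = x - z)%N by lia.
    by rewrite tri ?hw ?h2 // -h1 addnK.
  apply: zariski_self; first exact: is_point_compounds hA.
  exists A; split=> //.
    apply/matrixP => a c; rewrite mxE [LHS]mxE [RHS]mxE gram_sym //.
    have [h|] := eqVneq c (p a); first by rewrite h bpE.
    by rewrite -(gram_neq0 char_k) => /negPn/eqP ->; rewrite !mulr0.
  rewrite -unitfE -unitmxE.
  have [] := @mulmx1_unit _ _ A (\matrix_(a, c) (if p a == c then (A c a)^-1 else 0)) => //.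
  apply/matrixP => a c; rewrite mxE [RHS]mxE (bigD1 (p a)) //= big1 ?addr0.
    rewrite [in X in _ * X]mxE pK; case: (a =P c) => [<-|_]; last by rewrite mulr0.
    by rewrite mulfV // hA.
  by move=> u nu; have := hA a u; rewrite (negbTE nu) => /negbT/negPn/eqP ->; rewrite mul0r.
rewrite -q0; exact: is_point_quadric.
Qed.

End Degeneration.

(** * Stability under minimal parabolic subgroups *)

Section Elementary.

Variables (k : closedFieldType) (n : nat).
Implicit Types (u v x y : 'I_n) (c d : k).

(** For [u = v] this is diagonal with entry [1 + c] at [u]; scaling by [a] is thus
    [elem (a - 1) u u]. *)
Definition elem c u v : 'M[k]_n := 1%:M + c *: delta_mx u v.

Lemma elemE c u v x y : elem c u v x y = (x == y)%:R + c * ((x == u) && (y == v))%:R.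
Proof. by rewrite !mxE. Qed.

Lemma elem_mul c u v : u != v -> elem c u v *m elem (- c) u v = 1%:M.
Proof.
move=> nuv; rewrite /elem mulmxDl mul1mx mulmxDr mulmx1 -scalemxAl -scalemxAr.
by rewrite mul_delta_mx_0 1?eq_sym // !scaler0 addr0 scaleNr subrK.
Qed.

Lemma elem_unit c u v : u != v -> elem c u v \in unitmx.
Proof. by move=> /(elem_mul c)/mulmx1_unit[]. Qed.


Lemma upper_elem c u v : (u <= v)%N -> upper (elem c u v).
Proof.
move=> uv x y yx; rewrite elemE; have -> : (x == y) = false by apply/eqP => e; rewrite e ltnn in yx.
case: (x =P u) => [ex|_]; last by rewrite mulr0 addr0.
case: (y =P v) => [ey|_]; last by rewrite mulr0 addr0.
by move: yx; rewrite ex ey; lia.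
Qed.

Lemma elem_diag_unit c u : 1 + c != 0 -> elem c u u \in unitmx.
Proof.
move=> hc; apply: upper_unit; first exact: upper_elem.
move=> x; rewrite elemE eqxx andbb; case: (x == u); first by rewrite mulr1.
by rewrite mulr0 addr0 oner_neq0.
Qed.

(** The only nonzero entry of row [u] of the Gram matrix, located in column [p u]. *)
Definition gram_entry (p : 'I_n -> 'I_n) u : k := if p u == u then 1 else 2%:R^-1.

Lemma gram_entryE (p : 'I_n -> 'I_n) u v :
  gram k p u v = (v == p u)%:R * gram_entry p u.
Proof.
rewrite mxE /gram_entry eq_sym; case: (v =P p u) => [->|_]; last by rewrite mul0r.
by rewrite mul1r eq_sym.
Qed.

Lemma gram_delta p u v : involutive p ->
  gram k p *m delta_mx u v = gram_entry p u *: delta_mx (p u) v.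
Proof.
move=> pK; apply/matrixP => x y; rewrite !mxE (bigD1 u) //= big1 ?addr0.
  rewrite gram_sym // gram_entryE !mxE eqxx /=.
  by case: (x == p u); case: (y == v); rewrite ?mul0r ?mulr0 ?mul1r ?mulr1.
by move=> w /negbTE nw; rewrite !mxE nw mulr0.
Qed.

Lemma delta_gram p u v : delta_mx u v *m gram k p = gram_entry p v *: delta_mx u (p v).
Proof.
apply/matrixP => x y; rewrite !mxE (bigD1 v) //= big1 ?addr0.
  rewrite gram_entryE !mxE eqxx andbT.
  by case: (x == u); case: (y == p v); rewrite ?mul0r ?mulr0 ?mul1r ?mulr1.
by move=> w /negbTE nw; rewrite !mxE nw andbF mul0r.
Qed.

Lemma elem_congr c u v (S : 'M[k]_n) :
  (elem c u v)^T *m S *m elem c u v =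
  S + c *: (delta_mx v u *m S) + c *: (S *m delta_mx u v) +
    c ^+ 2 *: (delta_mx v u *m S *m delta_mx u v).
Proof.
have -> : (elem c u v)^T = 1%:M + c *: delta_mx v u.
  by apply/matrixP => x y; rewrite mxE elemE !mxE eq_sym andbC.
rewrite /elem mulmxDl mul1mx mulmxDr mulmx1.
rewrite -scalemxAl -scalemxAr mulmxDl -scalemxAl scalerDr scalerA expr2 !addrA.
by [].
Qed.

Lemma elem_congr_gram c u v p : involutive p ->
  (elem c u v)^T *m gram k p *m elem c u v =
  gram k p + (c * gram_entry p u) *: (delta_mx v (p u) + delta_mx (p u) v) +
    (c ^+ 2 * gram_entry p u * (p u == u)%:R) *: delta_mx v v.
Proof.
move=> pK; rewrite elem_congr delta_gram gram_delta // -!scalemxAl mul_delta_mx_cond.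
rewrite !scalerA scalerDr !addrA; congr (_ + _).
by case: (p u == u); rewrite ?mulr1 // mulr0 scale0r mulr0n scaler0.
Qed.

Lemma elem_congr_delta c u v x y :
  (elem c u v)^T *m delta_mx x y *m elem c u v =
  delta_mx x y + (c * (u == x)%:R) *: delta_mx v y + (c * (y == u)%:R) *: delta_mx x v
    + (c ^+ 2 * (u == x)%:R * (y == u)%:R) *: delta_mx v v.
Proof.
rewrite elem_congr !mul_delta_mx_cond; congr (_ + _ + _ + _).
- by case: (u == x); rewrite ?mulr1 // mulr0 scale0r mulr0n scaler0.
- by case: (y == u); rewrite ?mulr1 // mulr0 scale0r mulr0n scaler0.
case: (u == x); last by rewrite mulr0n mul0mx scaler0 mulr0 mul0r scale0r.
rewrite mulr1n mul_delta_mx_cond mulr1.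
by case: (y == u); rewrite ?mulr1 // mulr0 scale0r mulr0n scaler0.
Qed.

Lemma elem_congrD c u v (S T : 'M[k]_n) :
  (elem c u v)^T *m (S + T) *m elem c u v =
  (elem c u v)^T *m S *m elem c u v + (elem c u v)^T *m T *m elem c u v.
Proof. by rewrite (mulmxDr _ S T) mulmxDl. Qed.

Lemma elem_congrZ c u v d (S : 'M[k]_n) :
  (elem c u v)^T *m (d *: S) *m elem c u v = d *: ((elem c u v)^T *m S *m elem c u v).
Proof. by rewrite -scalemxAr -scalemxAl. Qed.

Lemma pullback_elem_quadric c u v (b : 'I_n -> nat) S : b u = b v ->
  pullback (elem c u v) (coordinate_quadric b S) =
  coordinate_quadric b ((elem c u v)^T *m S *m elem c u v).
Proof.
move=> buv; have hh a e : elem c u v a e != 0 -> b a = b e.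
  rewrite elemE; case: (a =P e) => [->//|_]; rewrite add0r.
  by case: (a =P u) => [->|_]; case: (e =P v) => [->|_]; rewrite ?mulr0 ?eqxx.
rewrite (@pullback_quadric _ _ b b) //; last by move=> a e /hh ->.
congr (coordinate_quadric b (_^T *m S *m _)); apply/matrixP => a e; rewrite mxE;
  case: (b a =P b e) => // ne; apply/esym/eqP/negPn/negP => /hh; exact: ne.
Qed.

(** Such a matrix is the identity on the successive quotients of the flag. *)
Lemma pullback_elem_flag c u v (b : 'I_n -> nat) S : (b u < b v)%N ->
  pullback (elem c u v) (coordinate_quadric b S) = coordinate_quadric b S.
Proof.
move=> buv; have nuv : u != v by apply/eqP => e; rewrite e ltnn in buv.
rewrite (@pullback_quadric _ _ b b) //; last first.
  move=> a e; rewrite elemE; case: (a =P e) => [->//|_]; rewrite add0r.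
  by case: (a =P u) => [->|_]; case: (e =P v) => [->|_]; rewrite ?mulr0 ?eqxx // ltnW.
suff -> : levi b b (elem c u v) = 1%:M by rewrite trmx1 mul1mx mulmx1.
apply/matrixP => a e; rewrite mxE elemE mxE.
case: (b a =P b e) => [h|h]; last by case: (a =P e) => // e'; case: h; rewrite e'.
case: (a =P u) => [au|_]; last by rewrite mulr0 addr0.
case: (e =P v) => [ev|_]; last by rewrite mulr0 addr0.
by move: h; rewrite au ev => h; rewrite h ltnn in buv.
Qed.

End Elementary.

Section LowerStable.

Variables (k : closedFieldType) (n : nat).
Hypothesis n_gt0 : (0 < n)%N.
Hypothesis char_k : (2%:R : k) != 0.
Variables (b : 'I_n -> nat) (p : 'I_n -> 'I_n) (i i' : 'I_n).
Hypothesis bp : block_pairing b p.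
Hypothesis ii' : i' = i.+1 :> nat.
Hypothesis desc : ~~ ascent b p i i'.

Let Q := coordinate_quadric b (gram k p).
Let X := zariski_closure (upper_orbit Q).

Lemma point_Q : is_point Q. Proof. exact: is_point_quadric. Qed.

Lemma closure_quadric : X Q.
Proof.
apply: zariski_self; first exact: point_Q.
exists 1%:M; rewrite pullback1 unitmx1; split=> // x y yx.
by rewrite mxE; case: eqP => // e; rewrite e ltnn in yx.
Qed.

Let ltii' : (i < i')%N. Proof. by rewrite ii'. Qed.
Let nii' : i != i'. Proof. by apply/eqP => e; have := ltii'; rewrite e ltnn. Qed.

Lemma elem_step c u v S : b u = b v -> (u < v)%N \/ (u = v /\ 1 + c != 0) ->
  X (coordinate_quadric b S) ->
  X (coordinate_quadric b ((elem c u v)^T *m S *m elem c u v)).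
Proof.
move=> buv huv hX; rewrite -pullback_elem_quadric //; apply: closure_upper => //.
- by apply: upper_elem; case: huv => [/ltnW|[-> _]].
- case: huv => [uv|[-> hc]]; last exact: elem_diag_unit.
  by apply: elem_unit; apply/eqP => e; rewrite e ltnn in uv.
exact: point_Q.
Qed.

Lemma gram_entry_neq0 u : gram_entry k p u != 0.
Proof. by rewrite /gram_entry; case: ifP; rewrite ?oner_neq0 // invr_eq0 char_k. Qed.

(* Gauss decomposition of [[1 + t^2, t], [t, 1]]: only available off the roots
   of [1 + t^2], which [zariski_pencil] recovers by continuity. *)
Lemma lower_base_singular t : b i = b i' -> p i = i -> p i' = i' -> 1 + t ^+ 2 != 0 ->
  X (pullback (elem t i' i) Q).
Proof.
move=> bii pi pi' t0; have [pK _] := bp.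
have [al hal] := @closed_root k 2 (1 + t ^+ 2) isT.
have [ga hga] := @closed_root k 2 (1 + t ^+ 2)^-1 isT.
have al0 : al != 0 by apply: contraNneq t0 => h; rewrite -hal h expr0n.
have ga0 : ga != 0.
  by apply: contraNneq t0 => h; move/eqP: hga; rewrite h expr0n /= eq_sym invr_eq0.
have gi : gram_entry k p i = 1 by rewrite /gram_entry pi eqxx.
have gi' : gram_entry k p i' = 1 by rewrite /gram_entry pi' eqxx.
have nii : (i == i') = false by apply/negbTE.
have ni'i : (i' == i) = false by rewrite eq_sym.
pose ka := t / (1 + t ^+ 2).
have c1 : 1 + (ga - 1) != 0 by rewrite addrC subrK.
have c2 : 1 + (al - 1) != 0 by rewrite addrC subrK.
have s1 := @elem_step (ga - 1) i' i' _ erefl (or_intror (conj erefl c1)) closure_quadric.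
have s2 := @elem_step (al - 1) i i _ erefl (or_intror (conj erefl c2)) s1.
have s3 := @elem_step ka i i' _ bii (or_introl ltii') s2.
rewrite pullback_elem_quadric //; congr (X (coordinate_quadric b _)): s3.
do 3 rewrite ?elem_congr_gram // ?elem_congrD ?elem_congrZ ?elem_congr_delta.
rewrite pi pi' gi gi' !eqxx nii ni'i.
move: (gram k p) => S; apply/matrixP => x y; rewrite !mxE /=.
move: (S x y) ((x == i) && (y == i))%:R ((x == i) && (y == i'))%:R
  ((x == i') && (y == i))%:R ((x == i') && (y == i'))%:R => s e11 e12 e21 e22.
transitivity (s + (al ^+ 2 - 1) * e11 + (ka * al ^+ 2) * (e12 + e21) +
  (ga ^+ 2 - 1 + ka ^+ 2 * al ^+ 2) * e22); first by ring.
by rewrite hal hga /ka; field.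
Qed.

Lemma elem_pencil (h : 'M[k]_n) t u v : h *m elem t u v = h + t *: (h *m delta_mx u v).
Proof. by rewrite /elem mulmxDr mulmx1 -scalemxAr. Qed.

(** Inside one block a descent means [p i < p i'], and the pairing turns the lower move at [(i', i)]
    into an upper move at [(p i, p i')]. If one letter is fixed, a square term appears and a second
    upper move adjusts it; if both are fixed, the Gauss decomposition takes over. *)
Lemma lower_base t : X (pullback (elem t i' i) Q).
Proof.
have [pK _] := bp; have pinj := can_inj pK.
have nii : (i == i') = false by apply/negbTE.
have ni'i : (i' == i) = false by rewrite eq_sym.
move: desc; rewrite /ascent negb_or -leqNgt leq_eqVlt => /andP[/orP[/eqP bii|lb] hp]; last first.
  by rewrite pullback_elem_flag //; apply: closure_quadric.
move: hp; rewrite bii eqxx /= -leqNgt => lp.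
have bii' : b i = b i' by [].
have {lp}lp : (p i < p i')%N.
  rewrite ltn_neqAle lp andbT; by apply: contraNneq nii' => /val_inj/pinj ->.
have [_ bpE] := bp.
have ba : b (p i) = b i by []. have bq : b (p i') = b i by rewrite bpE.
have hg := gram_entry_neq0.
have piN : p i != i'.
  by apply/eqP => e; move: lp; rewrite e -{2}e pK; lia.
have pi'N : p i' != i.
  by apply/eqP => e; move: lp; rewrite e -{1}e pK; lia.
have npp : p i != p i' by rewrite (inj_eq pinj).
rewrite pullback_elem_quadric //.
have [pi|npi] := eqVneq (p i) i; have [pi'|npi'] := eqVneq (p i') i'.
- have D0 : 1 + 'X ^+ 2 != 0 :> {poly k}.
    apply/eqP => /(congr1 (fun q : {poly k} => q.[0])).
    by rewrite hornerD hornerC hornerXn expr0n addr0 horner0 => /eqP; rewrite oner_eq0.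
  rewrite -pullback_elem_quadric // -[elem t i' i]mul1mx elem_pencil.
  apply: (zariski_pencil D0) => [s|].
    rewrite hornerD hornerC hornerXn -elem_pencil mul1mx => hs.
    exact: lower_base_singular.
  rewrite -elem_pencil mul1mx; apply: is_point_pullback; last exact: point_Q.
  by apply: elem_unit; rewrite eq_sym.
- have gi : gram_entry k p i = 1 by rewrite /gram_entry pi eqxx.
  have lq : (i' < p i')%N.
    move: lp; rewrite pi => lp; rewrite ltn_neqAle ii' lp andbT -ii'.
    by apply: contraNneq npi' => h; apply/eqP/val_inj.
  have lq' : (i < p i')%N by rewrite -{1}pi.
  (* [ka] reproduces the mixed terms but adds [ka ^+ 2] at [(p i', p i')]. The move [la] removes it
     in advance; the 2 comes from its two symmetric contributions there. *)
  pose ka := t * gram_entry k p i'; pose la := - (ka ^+ 2 / (2%:R * gram_entry k p i')).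
  have s1 := @elem_step la i' (p i') _ (esym (etrans bq bii')) (or_introl lq) closure_quadric.
  have s2 := @elem_step ka i (p i') _ (esym bq) (or_introl lq') s1.
  congr (X (coordinate_quadric b _)): s2.
  do 2 rewrite ?elem_congr_gram // ?elem_congrD ?elem_congrZ ?elem_congr_delta.
  rewrite !pi !gi !eqxx ?(negbTE npi') ?(negbTE pi'N) [i == p i']eq_sym ?(negbTE pi'N).
  move: (hg i') => hgi'; move: (gram k p) => S; apply/matrixP => x y; rewrite !mxE /=.
  rewrite /la /ka; field.
  by apply/andP; split; [exact: hgi' | exact: char_k].
- have gi' : gram_entry k p i' = 1 by rewrite /gram_entry pi' eqxx.
  have la : (p i < i)%N.
    move: lp; rewrite pi' ii' ltnS leq_eqVlt => /orP[/eqP/val_inj e|//].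
    by rewrite e eqxx in npi.
  have la' : (p i < i')%N by rewrite -pi'.
  have gp : gram_entry k p (p i) != 0 by apply: hg.
  (* Here the lower move itself adds [t ^+ 2] at [(i, i)]; [la1] matches the mixed terms, and [ka],
     acting along the pair [(p i, i)], supplies the square. *)
  pose la1 := t / gram_entry k p (p i); pose ka := t ^+ 2 / (2%:R * gram_entry k p (p i)).
  have s1 := @elem_step la1 (p i) i' _ (etrans ba bii') (or_introl la') closure_quadric.
  have s2 := @elem_step ka (p i) i _ ba (or_introl la) s1.
  congr (X (coordinate_quadric b _)): s2.
  do 2 rewrite ?elem_congr_gram // ?elem_congrD ?elem_congrZ ?elem_congr_delta.
  rewrite !pK !pi' !gi' !eqxx [i == p i]eq_sym [i' == p i]eq_sym (negbTE npi) (negbTE piN).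
  rewrite ?ni'i; move: gp; rewrite /la1 /ka; move: (gram_entry k p (p i)) => g g0.
  move: (gram k p) => S; apply/matrixP => x y; rewrite !mxE /=; field.
  by apply/andP; split; [exact: g0 | exact: char_k].
have gp : gram_entry k p (p i) != 0 by apply: hg.
(* Both moves add a multiple of the symmetric unit at [(i, p i')]; [ka] equates the multiples. *)
pose ka := t * gram_entry k p i' / gram_entry k p (p i).
have s1 := @elem_step ka (p i) (p i') _ (etrans ba (esym bq)) (or_introl lp) closure_quadric.
congr (X (coordinate_quadric b _)): s1.
rewrite !elem_congr_gram // !pK [i == p i]eq_sym (negbTE npi) (negbTE npi').
move: gp; rewrite /ka; move: (gram_entry k p (p i)) (gram_entry k p i') => g g' g0.
by move: (gram k p) => S; apply/matrixP => x y; rewrite !mxE /=; field.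
Qed.

(* With [l_t := elem t i' i], one has [h * l_t = l_s * h'] with [h] and [h']
   upper triangular, as soon as [h i i + h i i' * t] is nonzero. *)
Lemma lower_stable t x : X x -> X (pullback (elem t i' i) x).
Proof.
have un : elem t i' i \in unitmx by apply: elem_unit; rewrite eq_sym.
apply: zariski_pullback => // _ [h [uh unh ->]]; rewrite pullbackM elem_pencil.
have hii : h i i != 0 by apply: upper_diag_neq0.
have D0 : (h i i)%:P + h i i' *: 'X != 0 :> {poly k}.
  apply/eqP => /(congr1 (fun q : {poly k} => q.[0])).
  by rewrite hornerD hornerC hornerZ hornerX mulr0 addr0 horner0 => /eqP; rewrite (negbTE hii).
apply: (zariski_pencil D0) => [s|]; last first.
  rewrite -elem_pencil; apply: is_point_pullback; last exact: point_Q.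
  by rewrite unitmx_mul unh.
rewrite hornerD hornerC hornerZ hornerX -elem_pencil => hs.
have uns u : elem u i' i \in unitmx by apply: elem_unit; rewrite eq_sym.
(* The quotient of the entries of [h *m elem s i' i] at [(i', i)] and [(i, i)]: the row operation in
   [h'] then clears the entry below the diagonal. *)
pose s' := s * h i' i' / (h i i + h i i' * s).
pose h' := elem (- s') i' i *m (h *m elem s i' i).
have -> : h *m elem s i' i = elem s' i' i *m h'.
  by rewrite mulmxA elem_mul ?mul1mx // eq_sym.
rewrite -pullbackM; apply: closure_upper => //; last exact: lower_base.
- move=> x0 y0 yx; have hE a c : (h *m elem s i' i) a c = h a c + s * (h a i' * (c == i)%:R).
    rewrite elem_pencil mxE mxE; congr (_ + _ * _); rewrite mxE (bigD1 i') //= big1 ?addr0.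
      by rewrite mxE eqxx.
    by move=> w nw; rewrite mxE (negbTE nw) mulr0.
  have -> : h' x0 y0 = (h *m elem s i' i) x0 y0 - s' * ((x0 == i')%:R * (h *m elem s i' i) i y0).
    rewrite /h' {1}/elem mulmxDl mul1mx -scalemxAl [LHS]mxE [X in _ + X]mxE mulNr; congr (_ - _ * _).
    rewrite mxE (bigD1 i) //= big1 ?addr0; first by rewrite mxE eqxx andbT.
    by move=> w nw; rewrite mxE (negbTE nw) andbF mul0r.
  rewrite !hE uh // add0r; case: (x0 =P i') => [ex|nx]; last first.
    rewrite mul0r mulr0 subr0; case: (y0 =P i) => [ey|_]; last by rewrite !mulr0.
    rewrite uh ?mul0r ?mulr0 // ltn_neqAle ii' -ey yx andbT.
    by apply/eqP => e'; apply: nx; apply: val_inj; rewrite /= -e' ii' ey.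
  rewrite ex mul1r; case: (y0 =P i) => [->|ny].
    by rewrite !mulr1 /s' [s * h i i']mulrC; field.
  rewrite !mulr0 addr0 sub0r uh ?mulr0 ?oppr0 //.
  rewrite ltn_neqAle; move: yx; rewrite ex ii' ltnS => ->; rewrite andbT.
  by apply/eqP => /val_inj.
- by rewrite /h' !unitmx_mul uns unh uns.
exact: point_Q.
Qed.

End LowerStable.

Section Exts.

Variables (k : closedFieldType) (n : nat).

Lemma eq_coordinate_quadric (b b' : 'I_n -> nat) (S : 'M[k]_n) :
  b =1 b' -> coordinate_quadric b S = coordinate_quadric b' S.
Proof.
move=> e; have l I : last_blocks b I = last_blocks b' I.
  apply: eq_forallb => a; congr (_ ==> _); apply: eq_forallb => c; congr (_ ==> _).
  by rewrite !e.
by apply/ffunP => c; rewrite !ffunE !l.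
Qed.

Lemma eq_gram (p p' : 'I_n -> 'I_n) : p =1 p' -> gram k p = gram k p'.
Proof. by move=> e; apply/matrixP => a c; rewrite !mxE e. Qed.

End Exts.

Section SwapStable.

Variables (k : closedFieldType) (n : nat).
Hypothesis char_k : (2%:R : k) != 0.
Variables (i i' : 'I_n) (X : mvec k n -> Prop).
Hypothesis ii' : i' = i.+1 :> nat.
Hypothesis X_upper : forall h x, upper h -> h \in unitmx -> X x -> X (pullback h x).
Hypothesis X_lower : forall t x, X x -> X (pullback (elem t i' i) x).

Let ltii' : (i < i')%N. Proof. by rewrite ii'. Qed.
Let nii' : i != i'. Proof. by apply/eqP => e; have := ltii'; rewrite e ltnn. Qed.

Lemma elem_iff t (u v : 'I_n) x : (u < v)%N \/ (u = i' /\ v = i) ->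
  X x <-> X (pullback (elem t u v) x).
Proof.
move=> huv; have nuv : u != v.
  by case: huv => [h|[-> ->]]; [apply/eqP => e; rewrite e ltnn in h | rewrite eq_sym].
have one c y : X y -> X (pullback (elem c u v) y).
  case: huv => [h|[-> ->]] hX; last exact: X_lower.
  by apply: X_upper => //; [apply: upper_elem; apply: ltnW | apply: elem_unit].
split; first exact: one.
by move=> /(one (- t)); rewrite pullbackM elem_mul // pullback1.
Qed.

Lemma elem_diag_iff t (u : 'I_n) x : 1 + t != 0 -> X x <-> X (pullback (elem t u u) x).
Proof.
move=> ht; have un := elem_diag_unit u ht.
split=> h; first by apply: X_upper => //; apply: upper_elem.
rewrite -(pullbackK x un); apply: X_upper => //; last by rewrite unitmx_inv.
by apply: upper_inv => //; apply: upper_elem.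
Qed.

Lemma mul_elemE (M : 'M[k]_n) c u v x y :
  (M *m elem c u v) x y = M x y + c * (M x u * (y == v)%:R).
Proof.
rewrite elem_pencil mxE mxE; congr (_ + _ * _); rewrite mxE (bigD1 u) //= big1 ?addr0.
  by rewrite mxE eqxx.
by move=> w nw; rewrite mxE (negbTE nw) mulr0.
Qed.

(** The three unipotent factors produce a quarter turn in the plane of [i] and [i']; the diagonal
    entry [1 - 2 = -1] of the last factor corrects the sign. *)
Lemma tperm_mx_elem : tperm_mx i i' =
  elem 1 i' i *m elem (-1) i i' *m elem 1 i' i *m elem (- 2%:R) i' i' :> 'M[k]_n.
Proof.
have nii : (i == i') = false by apply/negbTE.
have ni'i : (i' == i) = false by rewrite eq_sym.
apply/matrixP => x y; rewrite !mul_elemE !elemE !mxE ?nii ?ni'i ?eqxx.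
case: tpermP => [->|->|/eqP/negbTE nx /eqP/negbTE nx'].
- rewrite ?eqxx ?nii ![i == y]eq_sym ![i' == y]eq_sym.
  by have [e|e] := eqVneq y i; [|have [{}e|_] := eqVneq y i'];
      rewrite ?e ?eqxx ?nii ?ni'i /=; ring.
- rewrite ?eqxx ?ni'i ![i == y]eq_sym ![i' == y]eq_sym.
  by have [e|e] := eqVneq y i; [|have [{}e|_] := eqVneq y i'];
      rewrite ?e ?eqxx ?nii ?ni'i /=; ring.
by rewrite nx nx' /=; ring.
Qed.

Lemma tperm_iff x : X x <-> X (pullback (tperm_mx i i') x).
Proof.
rewrite tperm_mx_elem -!pullbackM.
have h2 : (1 + (- 2%:R) : k) != 0.
  by rewrite (_ : 1 + - 2%:R = -1); [rewrite oppr_eq0 oner_neq0 | ring].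
rewrite -(elem_diag_iff i' _ h2) -elem_iff; last by right.
by rewrite -elem_iff; [rewrite -elem_iff; [|right] | left].
Qed.

Lemma quadric_tperm (b : 'I_n -> nat) (p : 'I_n -> 'I_n) :
  pullback (tperm_mx i i') (coordinate_quadric b (gram k p)) =
  coordinate_quadric (swap_blocks b i i')
    (gram k (fun a => tperm i i' (p (tperm i i' a)))).
Proof.
have hT a c : (tperm_mx i i' : 'M[k]_n) a c != 0 -> a = tperm i i' c.
  by rewrite !mxE; case: (tperm i i' a =P c) => [<- _|_]; rewrite ?tpermK ?eqxx.
rewrite (@pullback_quadric _ _ b (swap_blocks b i i')) //; first last.
- move=> j; rewrite -(card_imset _ (@perm_inj _ (tperm i i'))).
  apply: eq_card => a; rewrite inE /swap_blocks; apply/imsetP/idP => [[c h ->]|h].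
    by move: h; rewrite inE tpermK.
  by exists (tperm i i' a); rewrite ?tpermK // inE.
- by move=> a c /hT ->.
have -> : levi b (swap_blocks b i i') (tperm_mx i i') = tperm_mx i i' :> 'M[k]_n.
  apply/matrixP => a c; rewrite mxE; case: eqP => // ne.
  by apply/esym/eqP/negPn/negP => /hT e; apply: ne; rewrite e.
congr coordinate_quadric; rewrite tr_perm_mx tpermV -row_permE -[X in _ *m perm_mx X]tpermV -col_permE.
apply/matrixP => a c; rewrite !mxE (inj_eq perm_inj); congr (if _ then _ else _).
by rewrite (can2_eq (tpermK i i') (tpermK i i')).
Qed.

(* [x^2 + y^2 = (x + r y) (x - r y)] for [r^2 = -1], in elementary steps. *)
Lemma quadric_fixed (b : 'I_n -> nat) (p : 'I_n -> 'I_n) :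
  involutive p -> b i = b i' -> p i = i -> p i' = i' ->
  X (coordinate_quadric b (gram k p)) <->
  X (coordinate_quadric b (gram k (fun a => p (tperm i i' a)))).
Proof.
move=> pK bii pi pi'.
have nii : (i == i') = false by apply/negbTE.
have ni'i : (i' == i) = false by rewrite eq_sym.
have [r hr] := @closed_root k 2 (-1) isT.
have r0 : r != 0.
  by apply/eqP => h; move/eqP: hr; rewrite h expr0n /= eq_sym oppr_eq0 oner_eq0.
have gi : gram_entry k p i = 1 by rewrite /gram_entry pi eqxx.
have gi' : gram_entry k p i' = 1 by rewrite /gram_entry pi' eqxx.
(* On [i] and [i'] the Gram matrix passes from the identity to diagonal [0, 1] with off-diagonal
   [r], then to diagonal [0, 0]; scaling by [1 + c = 1 / (2 r)] leaves the entry [1 / 2] of a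
   two-cycle. *)
pose c := (2%:R * r)^-1 - 1.
have hc : 1 + c != 0 by rewrite addrC subrK invr_eq0 mulf_neq0.
rewrite (@elem_iff r i' i); last by right.
rewrite (@elem_iff (r / 2%:R) i i'); last by left.
rewrite (elem_diag_iff i _ hc) !pullback_elem_quadric //.
suff -> : (elem c i i)^T *m ((elem (r / 2) i i')^T *m
    ((elem r i' i)^T *m gram k p *m elem r i' i) *m elem (r / 2) i i') *m elem c i i =
    gram k (fun a => p (tperm i i' a)) by [].
do 3 rewrite ?elem_congr_gram // ?elem_congrD ?elem_congrZ ?elem_congr_delta.
rewrite !pi !pi' gi gi' !eqxx nii ni'i.
have -> : gram k (fun a => p (tperm i i' a)) = gram k p - delta_mx i i - delta_mx i' i'
    + 2%:R^-1 *: (delta_mx i i' + delta_mx i' i).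
  have pinj := can_inj pK.
  apply/matrixP => x y; rewrite !mxE.
  case: tpermP => [->|->|/eqP nx /eqP nx'].
  - rewrite pi pi' !eqxx ![i == y]eq_sym ![i' == y]eq_sym nii.
    by have [e|e] := eqVneq y i; [|have [{}e|_] := eqVneq y i'];
      rewrite ?e ?eqxx ?nii ?ni'i /=; ring.
  - rewrite pi pi' !eqxx ![i == y]eq_sym ![i' == y]eq_sym ni'i.
    by have [e|e] := eqVneq y i; [|have [{}e|_] := eqVneq y i'];
      rewrite ?e ?eqxx ?nii ?ni'i /=; ring.
  by rewrite (negbTE nx) (negbTE nx') /=; ring.
move: (gram k p) => S; apply/matrixP => x y; rewrite !mxE /=.
move: (S x y) ((x == i) && (y == i))%:R ((x == i) && (y == i'))%:R
  ((x == i') && (y == i))%:R ((x == i') && (y == i'))%:R => s e11 e12 e21 e22.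
transitivity (s + (2%:R * c + c ^+ 2 + r ^+ 2 * (1 + c) ^+ 2) * e11 +
  (1 + c) * (r / 2%:R * 3%:R + r ^+ 2 * r / 2%:R) * (e12 + e21) +
  (r ^+ 2 / 4%:R + r ^+ 2 + r ^+ 2 * r ^+ 2 / 4%:R) * e22).
  field; rewrite ?char_k ?(natrM _ 2 2) ?mulf_neq0 //.
have h4 : (4%:R : k) != 0 by rewrite (natrM _ 2 2) mulf_neq0.
rewrite hr /c; field.
by apply/and3P; split; [exact: char_k | exact: h4 | exact: r0].
Qed.

(** Outside the singular case the exchange is the action of a permutation matrix. In the singular
    case one of the two quadrics has [i] and [i'] as fixed points, and [quadric_fixed] is applied to
    that one. *)
Lemma quadric_swap_iff (b : 'I_n -> nat) (p : 'I_n -> 'I_n) : block_pairing b p ->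
  X (coordinate_quadric b (gram k p)) <->
  X (coordinate_quadric (swap_blocks b i i') (gram k (swap_pairing b p i i'))).
Proof.
move=> bp; have [pK bpE] := bp.
have [sg|/negbTE nsg] := boolP (swap_singular b p i i'); last first.
  rewrite (tperm_iff (coordinate_quadric b (gram k p))) quadric_tperm.
  by rewrite (eq_gram k (p' := swap_pairing b p i i')) // => a; rewrite /swap_pairing nsg.
have [bii pi] := swap_singularP nii' bp sg.
have eb : swap_blocks b i i' =1 b.
  by move=> a; rewrite /swap_blocks; case: tpermP => [->|->|].
rewrite (eq_coordinate_quadric _ eb).
have ep : swap_pairing b p i i' =1 (fun a => p (tperm i i' a)).
  by move=> a; rewrite /swap_pairing sg.
rewrite (eq_gram k ep); case: pi => [[pi pi']|[pi pi']]; first exact: quadric_fixed.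
have [qK _] := swap_block_pairing nii' bp.
have := @quadric_fixed b (swap_pairing b p i i') qK bii.
rewrite !ep tpermL tpermR => /(_ pi' pi); rewrite (eq_gram k ep).
rewrite (eq_gram k (p := fun a => swap_pairing b p i i' (tperm i i' a)) (p' := p)) => [|a].
  by move=> h; split=> /h.
by rewrite ep tpermK.
Qed.

End SwapStable.

(** * Identification of the closure order with the rank order *)

Section MuBruhat.

Variables (k : closedFieldType) (n : nat) (mu : seq nat).
Hypothesis n_gt0 : (0 < n)%N.
Hypothesis char_k : (2%:R : k) != 0.
Hypothesis mu_sum : sumn mu = n.
Local Notation T := (mu_involution n mu).
Implicit Types (x y : T) (q : adjacent n).

Definition quadric_of x : mvec k n :=
  coordinate_quadric (block_of x) (gram k (pairing_of x)).

Lemma is_point_quadric_of x : is_point (quadric_of x).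
Proof. exact/is_point_quadric/block_pairing_of. Qed.

(** A closure stable under upper triangular matrices contains an orbit as soon as it contains one
    point of it. To read this point off the inclusion, the distinguished quadric must be known to be
    complete. *)
Lemma mu_bruhat_closure x y :
  mu_bruhat k x y <-> zariski_closure (upper_orbit (quadric_of y)) (quadric_of x).
Proof.
have px := is_point_quadric_of.
split=> [h|h z [cz hz]].
  have [|_] := h (quadric_of x); last by move/(closure_B_orbit n_gt0 _ (px y)).
  split; first exact/quadric_complete/block_pairing_of.
  apply/(closure_B_orbit n_gt0 _ (px x)); apply: zariski_self => //.
  exists 1%:M; rewrite pullback1 unitmx1; split=> // a c ca.
  by rewrite mxE; case: eqP => // e; rewrite e ltnn in ca.
split=> //; apply/(closure_B_orbit n_gt0 _ (px y)).
move: hz => /(closure_B_orbit n_gt0 _ (px x)); apply: zariski_trans => _ [g [ug ung ->]].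
exact: closure_upper.
Qed.

(** At a descent of [y] the closure is stable under upper triangular matrices and under the lower
    elementary matrices of [q], which is what [quadric_swap_iff] asks of [X]. *)
Lemma mu_bruhat_swap q y : ~~ mu_asc q y -> forall x,
  zariski_closure (upper_orbit (quadric_of y)) (quadric_of x) <->
  zariski_closure (upper_orbit (quadric_of y)) (quadric_of (mu_swap mu_sum q x)).
Proof.
move=> dy x; have bp := block_pairing_of mu_sum.
rewrite /quadric_of -[in X in _ <-> X](eq_coordinate_quadric _ (fun a => esym (block_of_swap mu_sum q x a))).
rewrite (eq_gram k (pairing_of_swap mu_sum q x)).
apply: (quadric_swap_iff char_k (adjacentP q)) => //.
- by move=> h z uh ung hz; apply: closure_upper => //; apply: is_point_quadric_of.
- by move=> t z; apply: (lower_stable n_gt0 char_k (bp y) (adjacentP q)); apply: dy.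
Qed.

Theorem mu_bruhatE x y : mu_bruhat k x y <-> mu_le x y.
Proof.
have px := is_point_quadric_of; split=> [/mu_bruhat_closure h|].
  apply/(mu_leP mu_sum) => j z w.
  apply: (closure_rank n_gt0 char_k (block_pairing_of mu_sum x)
    (block_pairing_of mu_sum y) (card_above mu_sum x y) (card_from mu_sum x y)).
  exact/(closure_B_orbit n_gt0 _ (px y)).
have self z : zariski_closure (upper_orbit (quadric_of z)) (quadric_of z).
  by apply/mu_bruhat_closure => t; apply: id.
apply: (mu_le_minimal (mu_sum := mu_sum) (R := fun x y => mu_bruhat k x y)) => {x y}.
- by move=> x t; apply: id.
- by move=> x y z h1 h2 t /h1/h2.
- move=> q x ax; apply/mu_bruhat_closure.
  by apply/(@mu_bruhat_swap q); rewrite ?mu_asc_swap ?ax.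
move=> q x y /mu_bruhat_closure h ay; apply/mu_bruhat_closure.
(* The orbit closure of the exchanged [y] is stable under the exchange and contains the orbit of
   [y], hence the quadric of [x], which may then be exchanged inside it. *)
have dy : ~~ mu_asc q (mu_swap mu_sum q y) by rewrite mu_asc_swap ay.
apply/(mu_bruhat_swap dy x); move: h; apply: zariski_trans => _ [g [ug ung ->]].
by apply: closure_upper => //; apply/(mu_bruhat_swap dy y).
Qed.

End MuBruhat.

Theorem mainTheorem5 (k : closedFieldType) (char_k : (2%:R : k) != 0) :
  (forall n : nat, (0 < n)%N ->
     [/\ forall w : 'S_n, is_mu_involution (nseq n 1%N) w,
         forall w : 'S_n, is_mu_involution [:: n] w <-> involutive w
       & forall pi rho : mu_involution n [:: n],
           mu_bruhat k pi rho <-> induced_bruhat pi rho])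
  /\ (forall (n : nat) (mu : seq nat), (0 < n)%N -> composition n mu ->
        partial_order (@mu_bruhat n k mu)
        /\ graded (@mu_bruhat n k mu) [set: mu_involution n mu])
  /\ ~ graded (@induced_bruhat 4 [:: 3; 1]%N) [set: mu_involution 4 [:: 3; 1]%N]
  /\ (exists pi rho : mu_involution 4 [:: 3; 1]%N,
        [/\ letters [:: 3; 1]%N (val pi) = [:: [:: 4; 3; 2]; [:: 1]]%N,
            letters [:: 3; 1]%N (val rho) = [:: [:: 3; 2; 1]; [:: 4]]%N,
            induced_bruhat pi rho
          & ~ graded (@induced_bruhat 4 [:: 3; 1]%N) (bruhat_interval pi rho)])
  /\ ~ (forall pi rho : mu_involution 4 [:: 3; 1]%N,
          mu_bruhat k pi rho <-> induced_bruhat pi rho)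
  /\ ~ order_isomorphic (@mu_bruhat 4 k [:: 3; 1]%N)
                        (@induced_bruhat 4 [:: 3; 1]%N).
Proof.
have gr (n : nat) (mu : seq nat) : (0 < n)%N -> composition n mu ->
    partial_order (@mu_bruhat n k mu) /\ graded (@mu_bruhat n k mu) [set: mu_involution n mu].
  move=> n0 [_ hs]; have E := mu_bruhatE n0 char_k hs; split; last first.
    by apply: (graded_iff _ (mu_le_graded hs)) => x y; apply: iff_sym.
  split=> [x t|x y /E h1 /E h2|x y z h1 h2 t /h1/h2]; [exact: id | | exact: id].
  exact: mu_le_anti hs _ _ h1 h2.
have [_ gr31] := gr 4 [:: 3; 1]%N isT (conj isT erefl).
(* An isomorphism would carry gradedness from the closure order to the induced order. That the two
   orders differ is the special case of the identity map. *)
have niso : ~ order_isomorphic (@mu_bruhat 4 k [:: 3; 1]%N) (@induced_bruhat 4 [:: 3; 1]%N).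
  by move=> /order_isomorphic_graded/(_ gr31); apply: induced_31_not_graded.
split; [|split; [exact: gr | split; [exact: induced_31_not_graded | split]]].
- move=> n n0; split=> [w|w|x y].
  + exact: is_mu_involution_ones.
  + exact: is_mu_involution_whole.
  have hs : sumn [:: n] = n by rewrite /= addn0.
  by rewrite (mu_bruhatE n0 char_k hs) mu_le_bruhat.
- have [x hx] : exists x : mu_involution 4 [:: 3; 1]%N, word (val x) = [:: 3; 2; 1; 0]%N.
    by apply: words_exist; vm_compute.
  have [y hy] : exists y : mu_involution 4 [:: 3; 1]%N, word (val y) = [:: 2; 1; 0; 3]%N.
    by apply: words_exist; vm_compute.
  exists x, y; split; rewrite ?letters_word ?hx ?hy //.
  + by rewrite /induced_bruhat bruhat_word hx hy; vm_compute.
  exact: interval_31_not_graded hx hy.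
split=> // h; apply: niso; exists id; first by exists id.
exact: h.
Qed.
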